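(* Let $m\ge1$ and $0<\lambda<1-\frac{2}{m+2}$. There is a polynomial-time algorithm that, given any laminar instance of \textsf{MaxT} with $m$ hosts satisfying $p_j\le\lambda|\chi_j|$ for all jobs $j$, outputs a feasibly scheduled subset of jobs (together with a feasible schedule) whose total profit is at least $\frac12-\lambda\left(\frac12+\frac1m\right)$ times the optimal profit.
   Context: \textsf{MaxT} (preemptive throughput maximization): time is slotted into integer slots $1,\dots,T$. There is a set $M$ of $m$ identical hosts, each having one unit of a single resource, and a set $J$ of jobs. Each job $j$ has a time window $\chi_j=[r_j,d_j]$ (integer slots, $|\chi_j|=d_j-r_j+1$), processing length $p_j\in\mathbb{Z}_{>0}$, resource requirement $s_j\in(0,1]$ and profit $w_j\ge0$. A subset $S\subseteq J$ is feasibly scheduled if there are sets $S_{i,t}\subseteq S$ (jobs run on host $i$ at slot $t$) such that: $j\in S_{i,t}$ only if $t\in\chi_j$; $\sum_{j\in S_{i,t}}s_j\le1$ for all $i,t$; no job runs on two different hosts in the same slot; and each $j\in S$ runs in at least $p_j$ distinct slots of $\chi_j$ (preemption and migration allowed). The goal is to maximize $\sum_{j\in S}w_j$ over feasibly scheduled $S$. The instance is laminar if $\{\chi_j:j\in J\}$ is a laminar family (any two intervals nested or disjoint). *)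

(* Defs.v *)
From mathcomp Require Import all_boot all_order all_algebra.
From mathcomp Require Import boolp.
Set Implicit Arguments.
Unset Strict Implicit.
Unset Printing Implicit Defensive.
Import Order.TTheory GRing.Theory Num.Theory.

(* A random access machine under the logarithmic cost criterion, presented as
    while-programs.  A program uses finitely many variables, each holding a
    natural number of any size, and finitely many unbounded arrays of such
    numbers.  Every number that is read, written, used as an address or
    obtained as an intermediate result is charged its length in binary, so that
    running times are polynomially related to those of Turing machines. *)

Definition bitlen (n : nat) : nat := (trunc_log 2 n).+1.

Definition bitsize (s : seq nat) : nat := \sum_(a <- s) bitlen a.

Variant binop := Add | Sub | Mul | Div | Leq.

Inductive expr :=
  | Const of nat
  | Var of nat
  | Get of nat & expr               (* Get a e : cell number e of array a *)
  | Bin of binop & expr & expr.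

Inductive cmd :=
  | Skip
  | Assign of nat & expr
  | Put of nat & expr & expr        (* Put a e f : a[e] := f *)
  | Seq of cmd & cmd
  | If of expr & cmd & cmd
  | While of expr & cmd.

Record state := State { vars : nat -> nat; arrs : nat -> nat -> nat }.

Definition upd (T : Type) (f : nat -> T) (x : nat) (v : T) : nat -> T :=
  fun y => if y == x then v else f y.

Definition set_var (s : state) (x v : nat) : state :=
  State (upd (vars s) x v) (arrs s).

Definition set_cell (s : state) (a i v : nat) : state :=
  State (vars s) (upd (arrs s) a (upd (arrs s a) i v)).

(* Sub is truncated, Div is Euclidean with n / 0 = 0, Leq returns 0 or 1. *)
Definition binop_eval (o : binop) (a b : nat) : nat :=
  match o with
  | Add => a + b
  | Sub => a - b
  | Mul => a * b
  | Div => a %/ b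
  | Leq => a <= b
  end.

Fixpoint eval (s : state) (e : expr) : nat :=
  match e with
  | Const n => n
  | Var x => vars s x
  | Get a e1 => arrs s a (eval s e1)
  | Bin o e1 e2 => binop_eval o (eval s e1) (eval s e2)
  end.

Fixpoint eval_cost (s : state) (e : expr) : nat :=
  bitlen (eval s e) +
  match e with
  | Const _ | Var _ => 0
  | Get _ e1 => eval_cost s e1
  | Bin _ e1 e2 => eval_cost s e1 + eval_cost s e2
  end.

(* exec c s s' k : c started in s terminates in s' at total cost k.
   A test succeeds when its value is nonzero. *)
Inductive exec : cmd -> state -> state -> nat -> Prop :=
  | exec_skip s : exec Skip s s 1
  | exec_assign x e s :
      exec (Assign x e) s (set_var s x (eval s e)) (eval_cost s e).+1
  | exec_put a e f s :
      exec (Put a e f) s (set_cell s a (eval s e) (eval s f))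
        (eval_cost s e + eval_cost s f).+1
  | exec_seq c d s s' s'' k l :
      exec c s s' k -> exec d s' s'' l -> exec (Seq c d) s s'' (k + l)
  | exec_if_true e c d s s' k :
      eval s e != 0 -> exec c s s' k ->
      exec (If e c d) s s' (eval_cost s e + k).+1
  | exec_if_false e c d s s' k :
      eval s e = 0 -> exec d s s' k ->
      exec (If e c d) s s' (eval_cost s e + k).+1
  | exec_while_true e c s s' s'' k l :
      eval s e != 0 -> exec c s s' k -> exec (While e c) s' s'' l ->
      exec (While e c) s s'' (eval_cost s e + k + l).+1
  | exec_while_false e c s :
      eval s e = 0 -> exec (While e c) s s (eval_cost s e).+1.

(* The input is found in array 0, its length in variable 0; all other variables
   and cells are initially 0. *)
Definition init_state (x : seq nat) : state :=
  State (upd (fun=> 0) 0 (size x)) (upd (fun=> fun=> 0) 0 (nth 0 x)).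

(* The output is left in array 1, its length in variable 1. *)
Definition output (s : state) : seq nat := mkseq (arrs s 1) (vars s 1).

(* The cost of reading the output off is part of the running time, since a
   program could announce a long output made of cells that it never wrote. *)
Definition computes (c : cmd) (x y : seq nat) (t : nat) : Prop :=
  exists s k, [/\ exec c (init_state x) s k, output s = y & t = k + bitsize y].

Record job := Job {
  release : nat;
  deadline : nat;
  plen : nat;
  req : rat;
  weight : rat }.

Record instance := Instance { horizon : nat; jobs : seq job }.

Notation jobidx I := 'I_(size (jobs I)).
Notation slotidx I := 'I_(horizon I).

Definition jobof (I : instance) (j : jobidx I) : job := tnth (in_tuple (jobs I)) j.

(* The slots are 1, ..., horizon, whereas ordinals start at 0. *)
Definition slot (I : instance) (t : slotidx I) : nat := t.+1.

Definition window (I : instance) (j : jobidx I) : {set slotidx I} :=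
  [set t | release (jobof j) <= slot t <= deadline (jobof j)].

Definition wlen (I : instance) (j : jobidx I) : nat :=
  deadline (jobof j) - release (jobof j) + 1.

Definition valid_job (T : nat) (j : job) : Prop :=
  [/\ [/\ 0 < release j, release j <= deadline j & deadline j <= T],
      0 < plen j, (0 < req j <= 1)%R & (0 <= weight j)%R].

Definition valid_instance (I : instance) : Prop :=
  forall j : jobidx I, valid_job (horizon I) (jobof j).

Definition laminar (I : instance) : Prop :=
  forall j k : jobidx I,
    [|| window j \subset window k, window k \subset window j
      | [disjoint window j & window k]].

Definition schedules (m : nat) (I : instance) (S : {set jobidx I})
    (sched : 'I_m -> slotidx I -> {set jobidx I}) : Prop :=
  [/\ forall i t, sched i t \subset S,
      forall i t j, j \in sched i t -> t \in window j,
      forall i t, (\sum_(j in sched i t) req (jobof j) <= 1)%R,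
      forall i i' t j, j \in sched i t -> j \in sched i' t -> i = i'
    & forall j, j \in S ->
        plen (jobof j) <= #|[set t in window j | [exists i, j \in sched i t]]| ].

Definition feasible (m : nat) (I : instance) (S : {set jobidx I}) : Prop :=
  exists sched : 'I_m -> slotidx I -> {set jobidx I}, schedules S sched.

Definition profit (I : instance) (S : {set jobidx I}) : rat :=
  (\sum_(j in S) weight (jobof j))%R.

(* The default 0 is harmless: set0 is feasible and has profit 0. *)
Definition opt (m : nat) (I : instance) : rat :=
  \big[Order.max/0%R]_(S : {set jobidx I} | `[< feasible m S >]) profit S.

Definition encode_rat (q : rat) : seq nat := [:: `|numq q|; `|denq q|].

Definition encode_job (j : job) : seq nat :=
  [:: release j; deadline j; plen j] ++ encode_rat (req j)
    ++ encode_rat (weight j).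

Definition encode_instance (I : instance) : seq nat :=
  [:: horizon I; size (jobs I)] ++ flatten (map encode_job (jobs I)).

(* (j, i, a, b) : job j runs on host i throughout slots a, ..., b.  As numbers
   are written in binary, the horizon may be exponential in the length of the
   input, and a schedule has to be output as a list of such pieces. *)
Definition piece (m : nat) (I : instance) : Type :=
  (jobidx I * 'I_m * nat * nat)%type.

Definition schedule_of (m : nat) (I : instance) (ps : seq (piece m I)) :
    'I_m -> slotidx I -> {set jobidx I} :=
  fun i t => [set j | has (fun q : piece m I =>
    let: (j', i', a, b) := q in [&& j' == j, i' == i & a <= slot t <= b]) ps].

Definition encode_piece (m : nat) (I : instance) (q : piece m I) : seq nat :=
  let: (j, i, a, b) := q in [:: nat_of_ord j; nat_of_ord i; a; b].

Definition encode_solution (m : nat) (I : instance)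
    (sel : seq (jobidx I)) (ps : seq (piece m I)) : seq nat :=
  size sel :: [seq nat_of_ord j | j <- sel] ++ flatten (map (@encode_piece m I) ps).

(* Main.v *)
(** Jobs are selected greedily by density w_j / (s_j p_j): a job is accepted if
    afterwards the total area s_j p_j of the accepted jobs inside each window
    chi_k is at most m |chi_k| (1 - lam) / 2, where lam = max_j p_j / |chi_j|.
    A rejected job lies in a window whose accepted area exceeds the fraction
    omega = 1/2 - lam (1/2 + 1/m) of its capacity m |chi_k|.  The maximal such
    windows are disjoint, so in each prefix of the density order the accepted
    area is at least omega times the area of any feasible set; summation by
    parts turns this into the bound on profits.

    The accepted jobs can all be scheduled, in the order of increasing window
    length.  A wide job (s_j > 1/2) gets a fresh host in each of its slots, a
    narrow job first fills the gray slots, which have a host of load below 1/2.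
    All other hosts in use are at least half full.  Gray slots stay rare: if a
    narrow job needs fresh hosts at all, then it runs in all gray slots of its
    window, so at most p_j <= lam |chi_j| gray slots remain there.  A job that
    does not find enough slots would make the area in its window too large.

    The horizon may be exponential, so the slots are grouped into cells, that
    is, intervals of slots in equal states; a job splits at most one cell, and
    there are never more than 3n + 1 of them. *)

Require Import Defs.
From mathcomp Require Import all_boot all_order all_algebra.
From mathcomp Require Import reals zify ring lra.
Set Implicit Arguments.
Unset Strict Implicit.
Unset Printing Implicit Defensive.
Import Order.TTheory GRing.Theory Num.Theory.

(** * Programs and their running times *)

(** The value of omega comes from one rejection: if b is refused because of window k, then A + a_b >
    m |chi_k| (1 - lam) / 2 for the accepted area A, while a_b <= p_b <= lam |chi_k|; hence A > m
    |chi_k| ((1 - lam) / 2 - lam / m). The cap (1 - lam) / 2 is also just what the scheduler can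
    afford. A job occupies at most lam |chi| slots of its own window, and in the other slots a
    blocked job sees all m hosts in use, half full up to one gray host. For a wide job, the gray
    hosts cost up to lam |chi| half-loads, which are made up for by the load above 1/2 that the job
    itself brings to each of its slots. The running time needs no analysis of the algorithm.
    Programs are written in a language whose loops all run up to the length of the input and whose
    products have a short factor; a syntactic check then yields the polynomial. Loops over cells fit
    in, as 3n + 1 is below the input length 7n + 2. The programs work with natural numbers only:
    requirements are scaled by a common denominator, fractions are compared by
    cross-multiplication. *)

Lemma bitlen_le n k : 0 < k -> (bitlen n <= k) = (n < 2 ^ k).
Proof.
rewrite /bitlen => k0; apply/idP/idP => [le|].
  by apply: (leq_trans (trunc_log_ltn n (isT : 1 < 2))); rewrite leq_exp2l.
case: n => [|n lt]; first by rewrite trunc_log0.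
rewrite -(ltn_exp2l _ _ (isT : 1 < 2)).
by apply: leq_ltn_trans lt; apply: trunc_logP.
Qed.

Lemma ltn_bitlen n : n < 2 ^ bitlen n.
Proof. by rewrite -bitlen_le. Qed.

Lemma bitlen_gt0 n : 0 < bitlen n.
Proof. by []. Qed.

Lemma bitlen0 : bitlen 0 = 1. Proof. by []. Qed.

Lemma bitlen1 : bitlen 1 = 1. Proof. by []. Qed.

Lemma leq_bitlen a b : a <= b -> bitlen a <= bitlen b.
Proof.
by move=> le; rewrite bitlen_le // (leq_ltn_trans le) // ltn_bitlen.
Qed.

Lemma bitlenD a b : bitlen (a + b) <= (maxn (bitlen a) (bitlen b)).+1.
Proof.
rewrite bitlen_le // expnS mul2n -addnn.
have [la lb] := (ltn_bitlen a, ltn_bitlen b).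
have: 2 ^ bitlen a <= 2 ^ maxn (bitlen a) (bitlen b) by rewrite leq_exp2l ?leq_maxl.
have: 2 ^ bitlen b <= 2 ^ maxn (bitlen a) (bitlen b) by rewrite leq_exp2l ?leq_maxr.
lia.
Qed.

Lemma bitlenM a b : bitlen (a * b) <= bitlen a + bitlen b.
Proof.
rewrite bitlen_le // expnD.
have [la lb] := (ltn_bitlen a, ltn_bitlen b).
by apply: ltn_mul.
Qed.

Lemma bitlen_leS n : bitlen n <= n.+1.
Proof. by rewrite bitlen_le // (leq_trans (ltn_expl n (isT : 1 < 2))) // leq_exp2l. Qed.

Lemma size_bitsize (x : seq nat) : size x <= bitsize x.
Proof.
rewrite /bitsize -sum1_size; apply: leq_sum => i _; exact: bitlen_gt0.
Qed.

(** The successor covers reads beyond the end: the default [0] has length 1 even if [x] is empty. *)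
Lemma bitlen_nth (x : seq nat) i : bitlen (nth 0 x i) <= (bitsize x).+1.
Proof.
elim: x i => [|a x IH] [|i] //=; rewrite /bitsize big_cons; first lia.
by apply: leq_trans (IH i) _; rewrite /bitsize; lia.
Qed.

(** Only bounded loops are offered, so every program terminates and has a total denotation, and cost
    can be bounded by induction on syntax. *)
Inductive prog :=
  | PSkip
  | PAssign of nat & expr
  | PPut of nat & expr & expr
  | PSeq of prog & prog
  | PIf of expr & prog & prog
  | PFor of nat & prog.

Definition esucc x := Bin Add (Var x) (Const 1).

(* All loops run over the indices below variable 0, the length of the input. *)
Fixpoint comp (P : prog) : cmd :=
  match P with
  | PSkip => Skip
  | PAssign x e => Assign x e
  | PPut a e f => Put a e f
  | PSeq P Q => Seq (comp P) (comp Q)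
  | PIf e P Q => If e (comp P) (comp Q)
  | PFor i P => Seq (Assign i (Const 0))
      (While (Bin Leq (esucc i) (Var 0)) (Seq (comp P) (Assign i (esucc i))))
  end.

(** The number of iterations is read off once, whereas the compiled loop tests variable 0 at each
    turn; they agree because [wf] forbids the body to write variable 0 or the counter. *)
Fixpoint den (P : prog) (s : state) : state :=
  match P with
  | PSkip => s
  | PAssign x e => set_var s x (eval s e)
  | PPut a e f => set_cell s a (eval s e) (eval s f)
  | PSeq P Q => den Q (den P s)
  | PIf e P Q => if eval s e != 0 then den P s else den Q s
  | PFor i P => iter (vars s 0)
      (fun s => set_var (den P s) i (vars (den P s) i + 1)) (set_var s i 0)
  end.

(* wrv and wra over-approximate the variables and the arrays that are written. *)
Fixpoint wrv (P : prog) (x : nat) : bool :=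
  match P with
  | PSkip | PPut _ _ _ => false
  | PAssign y _ => x == y
  | PSeq P Q | PIf _ P Q => wrv P x || wrv Q x
  | PFor i P => (x == i) || wrv P x
  end.

Fixpoint wra (P : prog) (a : nat) : bool :=
  match P with
  | PSkip | PAssign _ _ => false
  | PPut b _ _ => a == b
  | PSeq P Q | PIf _ P Q => wra P a || wra Q a
  | PFor i P => wra P a
  end.

Lemma den_var P x s : ~~ wrv P x -> vars (den P s) x = vars s x.
Proof.
elim: P s => //= [y e|P IH Q IH'|e P IH Q IH'|i P IH] s.
- by rewrite /upd => /negPf->.
- by rewrite negb_or => /andP[? ?]; rewrite IH' // IH.
- by rewrite negb_or => /andP[? ?]; case: ifP => _; [apply: IH|apply: IH'].
rewrite negb_or => /andP[/negPf ne h]; elim: (vars s 0) => [|k IHk] /=.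
  by rewrite /upd ne.
by rewrite /upd ne IH.
Qed.

Lemma den_arr P a s : ~~ wra P a -> arrs (den P s) a = arrs s a.
Proof.
elim: P s => //= [b e f|P IH Q IH'|e P IH Q IH'|i P IH] s.
- by rewrite /upd => /negPf->.
- by rewrite negb_or => /andP[? ?]; rewrite IH' // IH.
- by rewrite negb_or => /andP[? ?]; case: ifP => _; [apply: IH|apply: IH'].
by move=> h; elim: (vars s 0) => [|k IHk] //=; rewrite IH.
Qed.

(* Whatever the state, the value has length linear in the length of the input. *)
Fixpoint smallv (e : expr) : bool :=
  match e with
  | Const _ => true
  | Var x => x == 0
  | Get a _ => a == 0
  | Bin Leq _ _ => true
  | Bin (Defs.Sub | Div) e _ => smallv e
  | Bin (Add | Mul) e f => smallv e && smallv f
  end.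

(* Products with a small factor only: the lengths of the numbers then grow
   additively, whence polynomially under repetition. *)
Fixpoint oke (e : expr) : bool :=
  match e with
  | Const _ | Var _ => true
  | Get _ e => oke e
  | Bin Mul e f => [&& smallv e, oke e & oke f]
  | Bin _ e f => oke e && oke f
  end.

(** Variable 1 is the length of the output, so its value, and not only its binary length, must stay
    polynomial. *)
Definition okv1 (e : expr) : bool :=
  match e with
  | Const _ | Bin Add (Var 1) (Const _) => true
  | _ => false
  end.

Fixpoint wf (P : prog) : bool :=
  match P with
  | PSkip => true
  | PAssign x e => [&& x != 0, oke e & (x == 1) ==> okv1 e]
  | PPut a e f => [&& a != 0, oke e & oke f]
  | PSeq P Q => wf P && wf Q
  | PIf e P Q => [&& oke e, wf P & wf Q]
  | PFor i P => [&& 1 < i, ~~ wrv P i & wf P]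
  end.

(** * Growth of the numbers and running time of well-formed programs *)

Definition inp (x : seq nat) (s : state) : Prop :=
  vars s 0 = size x /\ arrs s 0 = nth 0 x.

Definition bnd (L : nat) (s : state) : Prop :=
  [/\ forall x, bitlen (vars s x) <= L,
      forall a i, bitlen (arrs s a i) <= L & vars s 1 <= L].

Lemma wf_wrv0 P : wf P -> ~~ wrv P 0.
Proof.
elim: P => //= [x e|P IH Q IH'|e P IH Q IH'|i P IH].
- by case/and3P => ne _ _; rewrite eq_sym.
- by case/andP => /IH/negPf-> /IH'/negPf->.
- by case/and3P => _ /IH/negPf-> /IH'/negPf->.
by case/and3P => i1 _ /IH/negPf->; rewrite orbF; case: i i1.
Qed.

Lemma wf_wra0 P : wf P -> ~~ wra P 0.
Proof.
elim: P => //= [a e f|P IH Q IH'|e P IH Q IH'|i P IH].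
- by case/and3P => ne _ _; rewrite eq_sym.
- by case/andP => /IH/negPf-> /IH'/negPf->.
- by case/and3P => _ /IH/negPf-> /IH'/negPf->.
by case/and3P => i1 _ /IH/negPf->.
Qed.

Lemma den_inp P x s : wf P -> inp x s -> inp x (den P s).
Proof.
by move=> w [h1 h2]; split; rewrite ?den_var ?den_arr ?wf_wrv0 ?wf_wra0.
Qed.

Lemma inp_set_var x s i v : 0 < i -> inp x s -> inp x (set_var s i v).
Proof. by case: i => // i _ []. Qed.

Lemma bnd_le L L' s : L <= L' -> bnd L s -> bnd L' s.
Proof.
move=> le [h1 h2 h3]; split=> [x|a i|]; last exact: leq_trans le.
  exact: leq_trans (h1 x) le.
exact: leq_trans (h2 a i) le.
Qed.

(** The summand [n] for a constant bounds its value as well as its length, which is needed when it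
    is added to variable 1. *)
Fixpoint esz (e : expr) : nat :=
  match e with
  | Const n => (bitlen n + n).+1
  | Var _ => 1
  | Get _ e => (esz e).+1
  | Bin _ e f => (esz e + esz f).+1
  end.

Section Cost.

Variable x : seq nat.
(** A base of at least 2 lets a sum of two powers be absorbed by raising the exponent by one. *)
Let X := (bitsize x).+2.

Lemma smallv_bound s e : inp x s -> smallv e -> bitlen (eval s e) <= esz e * X.
Proof.
move=> [i0 i1]; elim: e => [n|y|a e IH|o e IH f IH'] /=.
- by move=> _; rewrite /X; nia.
- move/eqP->; rewrite i0 mul1n /X (leq_trans (bitlen_leS _)) //.
  by have := size_bitsize x; lia.
- by move=> /eqP->; rewrite i1 (leq_trans (bitlen_nth _ _)) // /X; nia.
have le1: 1 <= (esz e + esz f).+1 * X by rewrite /X.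
case: o => /=.
- case/andP => /IH h /IH' h'; apply: leq_trans (bitlenD _ _) _.
  by rewrite /X in h h' *; nia.
- move=> /IH h; apply: leq_trans (leq_bitlen (leq_subr _ _)) _.
  by apply: leq_trans h _; rewrite leq_mul2r; lia.
- case/andP => /IH h /IH' h'; apply: leq_trans (bitlenM _ _) _.
  by rewrite /X in h h' *; nia.
- move=> /IH h; apply: leq_trans (leq_bitlen (leq_div _ _)) _.
  by apply: leq_trans h _; rewrite leq_mul2r; lia.
by move=> _; case: (eval s e <= eval s f).
Qed.

Lemma oke_bound s L e : inp x s -> bnd L s -> oke e ->
  bitlen (eval s e) <= L + esz e * X.
Proof.
move=> I [b1 b2 _]; elim: e => [n|y|a e IH|o e IH f IH'] /=.
- by move=> _; rewrite /X; nia.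
- by move=> _; apply: leq_trans (b1 _) _; rewrite leq_addr.
- by move=> _; apply: leq_trans (b2 _ _) _; rewrite leq_addr.
case: o => /=.
- case/andP => /IH h /IH' h'; apply: leq_trans (bitlenD _ _) _.
  by rewrite /X in h h' *; nia.
- case/andP => /IH h _; apply: leq_trans (leq_bitlen (leq_subr _ _)) _.
  by apply: leq_trans h _; rewrite leq_add2l leq_mul2r; lia.
- case/and3P => /(smallv_bound I) h _ /IH' h'; apply: leq_trans (bitlenM _ _) _.
  by rewrite /X in h h' *; nia.
- case/andP => /IH h _; apply: leq_trans (leq_bitlen (leq_div _ _)) _.
  by apply: leq_trans h _; rewrite leq_add2l leq_mul2r; lia.
by move=> _; apply: (@leq_trans 1); [case: (eval s e <= eval s f)|rewrite addn_gt0 muln_gt0 orbT].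
Qed.

Lemma eval_cost_bound s L e : inp x s -> bnd L s -> oke e ->
  eval_cost s e <= esz e * (L + esz e * X).
Proof.
move=> I b; elim: e => [n|y|a e IH|o e IH f IH'] w.
- by move: (oke_bound I b w); rewrite /= addn0; nia.
- by move: (oke_bound I b w); rewrite /= addn0; nia.
- by move: (oke_bound I b w) (IH w); rewrite /=; nia.
have [w1 w2]: oke e /\ oke f.
  by case: o w => /=; [move/andP|move/andP|case/and3P|move/andP|move/andP].
have := oke_bound I b w; move: (IH w1) (IH' w2) => /=.
set u := bitlen _; move=> h1 h2 h3.
have e1: esz e * (L + esz e * X) <= esz e * (L + (esz e + esz f).+1 * X).
  by rewrite leq_mul2l leq_add2l leq_mul2r; lia.
have e2: esz f * (L + esz f * X) <= esz f * (L + (esz e + esz f).+1 * X).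
  by rewrite leq_mul2l leq_add2l leq_mul2r; lia.
move: h3 e1 e2; set q := (L + _); lia.
Qed.

Lemma leX a b : a <= b -> X ^ a <= X ^ b.
Proof. by move=> le; rewrite leq_exp2l. Qed.

Lemma const_leX a : a <= X ^ a.
Proof. by apply: ltnW; apply: ltn_expl. Qed.

Lemma addX a b : X ^ a + X ^ b <= X ^ (maxn a b).+1.
Proof.
have := leX (leq_maxl a b); have := leX (leq_maxr a b).
by rewrite expnS; have : 2 <= X by []; nia.
Qed.

Lemma eszX e : esz e * X <= X ^ (esz e).+1.
Proof. by rewrite expnS mulnC leq_mul2l const_leX orbT. Qed.

End Cost.

(** The increment is additive and its exponent depends on the program alone. A loop thus only
    multiplies it by the number of iterations, which is below the base; the exponent [g.+2] also
    leaves room for the increments of the counter. *)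
Lemma growth P : wf P -> exists g, forall x s L, inp x s -> bnd L s ->
  bnd (L + (bitsize x).+2 ^ g) (den P s).
Proof.
elim: P => /= [_|y e|a e f|P IH Q IH'|e P IH Q IH'|i P IH].
- by exists 0 => x s L _; apply: bnd_le; rewrite leq_addr.
- case/and3P => y0 w y1; exists (esz e).+1 => x s L I b.
  have h := oke_bound I b w; have hX := eszX x e; case: (b) => b1 b2 b3.
  have le: L <= L + (bitsize x).+2 ^ (esz e).+1 by rewrite leq_addr.
  split=> [z|c j|] /=; last 2 first.
  + exact: leq_trans (b2 _ _) le.
  + rewrite /upd eq_sym; case: eqP y1 => /= [_ ok|_ _]; last exact: leq_trans b3 le.
    suff: eval s e <= L + esz e * (bitsize x).+2 by move: hX; lia.
    case: e ok {w h hX le} => //= [n _|[] //= [] //= [|[|?]] // [] // n _] /=; nia.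
  by rewrite /upd; case: eqP => _; [move: hX h; lia|exact: leq_trans (b1 _) le].
- case/and3P => a0 w w'; exists (esz f).+1 => x s L I b.
  have h := oke_bound I b w'; have hX := eszX x f; case: (b) => b1 b2 b3.
  have le: L <= L + (bitsize x).+2 ^ (esz f).+1 by rewrite leq_addr.
  split=> [z|c j|] /=; [exact: leq_trans (b1 _) le| |exact: leq_trans b3 le].
  rewrite /upd; case: eqP => _; last exact: leq_trans (b2 _ _) le.
  by case: eqP => _; [move: hX h; lia|exact: leq_trans (b2 _ _) le].
- case/andP => w w'; have [g h] := IH w; have [g' h'] := IH' w'.
  exists (maxn g g').+1 => x s L I b.
  apply: bnd_le (h' _ _ _ (den_inp w I) (h _ _ _ I b)).
  by rewrite -addnA leq_add2l addX.
- case/and3P => we w w'; have [g h] := IH w; have [g' h'] := IH' w'.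
  exists (maxn g g') => x s L I b; case: ifP => _.
    by apply: bnd_le (h _ _ _ I b); rewrite leq_add2l leX ?leq_maxl.
  by apply: bnd_le (h' _ _ _ I b); rewrite leq_add2l leX ?leq_maxr.
case/and3P => i1 wi w; have [g h] := IH w.
exists g.+2 => x s L I b; set X := (bitsize x).+2.
have NX: (vars s 0).+1 <= X by rewrite I.1 /X; have := size_bitsize x; lia.
have: L + ((vars s 0) * (X ^ g + 1)).+1 <= L + X ^ g.+2.
  rewrite leq_add2l !expnS; have := expn_gt0 X g; rewrite /= => g0.
  have e1: (vars s 0) * (X ^ g + 1) + (X ^ g + 1) <= X * (X ^ g + 1).
    by rewrite -mulSnr leq_mul2r NX orbT.
  have: X * (X ^ g + 1) <= X * (X * X ^ g).
    by rewrite leq_mul2l; apply/orP; right; rewrite /X in g0 *; nia.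
  by move: e1; nia.
move/bnd_le; apply; elim: (vars s 0) => [|k].
  case: b => b1 b2 b3; split => [z|c j|] /=.
  - by rewrite /upd; case: eqP => _; [rewrite bitlen0; lia|have := b1 z; lia].
  - by have := b2 c j; lia.
  by rewrite /upd; case: eqP => _; lia.
set F := fun s => _.
have If j : inp x (iter j F (set_var s i 0)).
  elim: j => [|j IHj] /=; first by apply: inp_set_var => //; lia.
  by apply: inp_set_var; [lia|apply: den_inp].
move=> IHk; have [b1 b2 b3] := h _ _ _ (If k) IHk.
rewrite iterS {1}/F; set t := den P _ in b1 b2 b3 *.
have -> : L + (k.+1 * (X ^ g + 1)).+1 = L + (k * (X ^ g + 1)).+1 + X ^ g + 1.
  by rewrite mulSn; lia.
split => [z|c j|] /=; last 2 first.
- by have := b2 c j; rewrite -/X; lia.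
- by rewrite /upd; case: eqP => // E; [subst i|rewrite -/X in b3; lia].
rewrite /upd; case: eqP => _; last by have := b1 z; rewrite -/X; lia.
have := bitlenD (vars t i) 1; have := b1 i; rewrite -/X.
have := bitlen_gt0 (vars t i); rewrite bitlen1; lia.
Qed.

(** The exponent [d] depends on the exponent [e] of the initial bound because the second part of a
    sequence starts from the larger state described by [growth]. *)
Lemma cost P : wf P -> forall e, exists d, forall x s, inp x s ->
  bnd ((bitsize x).+2 ^ e) s ->
  exists2 k, exec (comp P) s (den P s) k & k <= (bitsize x).+2 ^ d.
Proof.
have ebound e ex x s : oke ex -> inp x s -> bnd ((bitsize x).+2 ^ e) s ->
    (eval_cost s ex).+1 <= (bitsize x).+2 ^ (esz ex + (maxn e (esz ex).+1).+2).
  move=> w I b; have := eval_cost_bound I b w; set X := (bitsize x).+2 => h.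
  have h1: X ^ e + esz ex * X <= X ^ (maxn e (esz ex).+1).+1.
    by apply: leq_trans (addX _ _ _); rewrite leq_add2l eszX.
  have h2: eval_cost s ex <= X ^ (esz ex + (maxn e (esz ex).+1).+1).
    apply: leq_trans h _; rewrite expnD; apply: leq_mul => //; exact: const_leX.
  rewrite addnS expnS; have: 0 < X ^ (esz ex + (maxn e (esz ex).+1).+1) by rewrite expn_gt0.
  by move: h2; rewrite /X; nia.
elim: P => /= [_|y ex|a ex f|P IH Q IH'|ex P IH Q IH'|i P IH].
- by move=> e; exists 1 => x s _ _; exists 1; [constructor|].
- case/and3P => _ w _ e; eexists => x s I b.
  by exists (eval_cost s ex).+1; [constructor|exact: ebound w I b].
- case/and3P => _ w w' e; eexists => x s I b.
  exists (eval_cost s ex + eval_cost s f).+1; first by constructor.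
  apply: leq_trans (addX x _ _).
  apply: leq_trans (leq_add (ebound _ _ _ _ w I b) (ebound _ _ _ _ w' I b)); lia.
- case/andP => w w' e; have [d h] := IH w e; have [g hg] := growth w.
  have [d' h'] := IH' w' (maxn e g).+1; exists (maxn d d').+1 => x s I b.
  have [k e1 l1] := h _ _ I b.
  have b': bnd ((bitsize x).+2 ^ (maxn e g).+1) (den P s).
    by apply: bnd_le (hg _ _ _ I b); exact: addX.
  have [k' e2 l2] := h' _ _ (den_inp w I) b'.
  exists (k + k'); first by econstructor; eauto.
  by apply: leq_trans (addX x _ _); apply: leq_add.
- case/and3P => we w w' e; have [d h] := IH w e; have [d' h'] := IH' w' e.
  eexists => x s I b; have he := ebound _ _ _ _ we I b.
  have [k e1 l1] := h _ _ I b; have [k' e2 l2] := h' _ _ I b.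
  exists (eval_cost s ex + if eval s ex != 0 then k else k').+1.
    case: ifP => [t|/negbFE/eqP t]; first exact: exec_if_true.
    exact: exec_if_false.
  apply: leq_trans (addX x _ _); rewrite -addSn.
  apply: leq_add; first exact: he.
  apply: (@leq_trans ((bitsize x).+2 ^ maxn d d')); last exact: leqnn.
  case: ifP => _; [apply: leq_trans l1 _|apply: leq_trans l2 _].
    by rewrite leX ?leq_maxl.
  by rewrite leX ?leq_maxr.
case/and3P => i1 wi w e.
have wF: wf (PFor i P) by rewrite /= i1 wi.
have [g hg] := growth w.
(* [e'] bounds the state at every iteration: [X ^ e] at the start plus at most [X] increments of
   [X ^ g + 1]. The exponents [d1], [d2], [d3] are for the test, the increment and the
   initialisation of the counter. *)
pose e' := (maxn e g.+2).+1.
have [d h] := IH w e'.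
pose E := Bin Leq (esucc i) (Var 0).
pose d1 := esz E + (maxn e' (esz E).+1).+2.
pose d2 := esz (esucc i) + (maxn e'.+1 (esz (esucc i)).+1).+2.
pose d3 := esz (Const 0) + (maxn e (esz (Const 0)).+1).+2.
exists (maxn d3 (maxn (maxn d1 d).+1 d2).+2).+1 => x s I b.
set X := (bitsize x).+2; set N := vars s 0.
set F := (X in iter N X); set s0 := set_var s i 0.
have NX: N.+1 <= X by rewrite /N I.1 /X; have := size_bitsize x; lia.
have If j : inp x (iter j F s0).
  elim: j => [|j IHj] /=; first by apply: inp_set_var => //; lia.
  by apply: inp_set_var; [lia|apply: den_inp].
have vi j : vars (iter j F s0) i = j.
  by elim: j => [|j IHj] /=; rewrite /upd eqxx ?den_var // IHj addn1.
have gP : 0 < X ^ g by rewrite expn_gt0.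
have bF j : bnd (X ^ e + j * (X ^ g + 1)) (iter j F s0).
  elim: j => [|j IHj].
    rewrite addn0; case: b => b1 b2 b3; split => [z|c k|] //=.
      by rewrite /upd; case: eqP => _ //; rewrite bitlen0 expn_gt0.
    by rewrite /upd; case: eqP.
  have [b1 b2 b3] := hg _ _ _ (If j) IHj.
  rewrite iterS {1}/F; set t := den P _ in b1 b2 b3 *.
  rewrite mulSn [_ + _ + _ * _]addnC addnA -/X in b1 b2 b3 *.
  split => [z|c k|] /=; last 2 first.
  - by have := b2 c k; lia.
  - by rewrite /upd; case: eqP => // E'; [subst i|lia].
  rewrite /upd; case: eqP => _; last by have := b1 z; lia.
  have := bitlenD (vars t i) 1; have := b1 i.
  by have := bitlen_gt0 (vars t i); rewrite bitlen1; lia.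
have bE j : j <= N -> bnd (X ^ e') (iter j F s0).
  move=> jN; apply: bnd_le (bF j); apply: leq_trans (addX x _ _).
  rewrite leq_add2l !expnS -/X.
  have e1: j * (X ^ g + 1) <= X * (X ^ g + 1) by rewrite leq_mul2r; lia.
  apply: leq_trans e1 _; rewrite leq_mul2l; apply/orP; right.
  by move: gP; rewrite /X; nia.
have step j : j < N -> exists2 k,
    exec (Seq (comp P) (Assign i (esucc i))) (iter j F s0) (iter j.+1 F s0) k
    & k <= X ^ d + X ^ d2.
  move=> jN; have bj := bE _ (ltnW jN); have [k ek lk] := h _ _ (If j) bj.
  exists (k + (eval_cost (den P (iter j F s0)) (esucc i)).+1).
    rewrite iterS {2}/F; apply: exec_seq ek _; exact: exec_assign.
  apply: leq_add => //; apply: ebound => //; first exact: den_inp.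
  apply: bnd_le (hg _ _ _ (If j) bj); apply: leq_trans (addX x _ _) _.
  by rewrite leX //; rewrite /e'; lia.
(* Induction on the number [j] of remaining iterations, as [exec] unfolds a loop from its first
   turn. *)
have loop j : j <= N -> exists2 k, exec (While E (Seq (comp P) (Assign i (esucc i))))
    (iter (N - j) F s0) (iter N F s0) k & k <= (j.+1) * (X ^ d1 + (X ^ d + X ^ d2)).
  elim: j => [_|j IHj jN].
    rewrite subn0; eexists; first apply: exec_while_false.
      by rewrite /= vi (If N).1 -I.1 -/N; case: leqP => //; lia.
    rewrite mul1n; apply: leq_trans (leq_addr _ _).
    exact: (@ebound e' E x _ isT (If N) (bE N (leqnn _))).
  have [k ek lk] := IHj (ltnW jN).
  have jN' : N - j.+1 < N by lia.
  have [k' ek' lk'] := step _ jN'.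
  eexists; first apply: exec_while_true ek' _.
  - by rewrite /= vi (If _).1 -I.1 -/N; case: leqP => //; lia.
  - have -> : (N - j.+1).+1 = N - j by lia.
    exact: ek.
  have := @ebound e' E x _ isT (If _) (bE _ (ltnW jN')).
  rewrite -/X -/d1; move: lk lk'; rewrite [_.+2 * _]mulSn.
  set u := eval_cost _ _; lia.
have [k ek lk] := loop N (leqnn _); rewrite subnn /= in ek.
exists ((eval_cost s (Const 0)).+1 + k).
  by apply: exec_seq ek; apply: exec_assign.
apply: leq_trans (addX x _ _); apply: leq_add.
  exact: (@ebound e (Const 0) x s isT I b).
apply: leq_trans lk _; rewrite [X in _ <= X]expnS; apply: leq_mul => //.
have := addX x d1 d; have := addX x (maxn d1 d).+1 d2; rewrite -/X; lia.
Qed.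

Lemma computes_comp P : wf P -> exists p : {poly nat}, forall x, exists t,
  computes (comp P) x (output (den P (init_state x))) t /\
  (t <= p.[bitsize x]%R).
Proof.
move=> w; have [g hg] := growth w; have [d h] := cost w 1.
pose q := (maxn 1 g).+1.
(* The exponent [q + q] pays for reading off the output: at most [X ^ q] cells, each of length at
   most [X ^ q]. *)
exists (('X + 2%:P) ^+ (maxn d (q + q)).+1)%R => x.
have I : inp x (init_state x) by split.
have b : bnd ((bitsize x).+2 ^ 1) (init_state x).
  rewrite expn1; split => [[|z]|[|c] i|] //=.
  - by apply: leq_trans (bitlen_leS _) _; have := size_bitsize x; rewrite /upd /=; lia.
  - by rewrite /upd /=; apply: leq_trans (bitlen_nth _ _) _.
have [k ek lk] := h _ _ I b.
have [b1 b2 b3] := hg _ _ _ I b.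
set s := den P _ in ek b1 b2 b3 *; set X := (bitsize x).+2 in lk b1 b2 b3 *.
exists (k + bitsize (output s)); split; first by exists s, k.
have -> : (('X + 2%:P) ^+ (maxn d (q + q)).+1).[bitsize x]%R = X ^ (maxn d (q + q)).+1.
  rewrite horner_exp hornerD hornerX hornerC natrXE; congr (_ ^ _); exact: addn2.
apply: leq_trans (addX x _ _); apply: leq_add => //.
have le : X ^ 1 + X ^ g <= X ^ q by apply: addX.
rewrite -/X expnD /output /bitsize big_map.
apply: (@leq_trans (\sum_(i <- iota 0 (vars s 1)) X ^ q)).
  by apply: leq_sum => i _; apply: leq_trans (b2 _ _) le.
rewrite big_const_seq count_predT size_iota iter_addn addn0 mulnC leq_mul2r.
by rewrite (leq_trans b3 le) orbT.
Qed.

(** * Greedy selection *)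

Lemma perm_filter_iota n (G : seq nat) : uniq G -> {in G, forall j, (j < n)%N} ->
  perm_eq G [seq j <- iota 0 n | j \in G].
Proof.
move=> uG lt; apply: uniq_perm => //; first by rewrite filter_uniq ?iota_uniq.
move=> j; rewrite mem_filter mem_iota /= add0n; case jG: (j \in G) => //=.
by rewrite lt.
Qed.

Lemma sum_seq_iota n (G : seq nat) (P : pred nat) (F : nat -> nat) :
  uniq G -> {in G, forall j, (j < n)%N} ->
  \sum_(j <- G | P j) F j = \sum_(j <- iota 0 n | (j \in G) && P j) F j.
Proof.
by move=> uG lt; rewrite (perm_big _ (perm_filter_iota uG lt)) big_filter_cond.
Qed.

Section Greedy.

Variables (n : nat) (r d : nat -> nat).

Definition subw j k := (r k <= r j) && (d j <= d k).
Definition wl j := d j - r j + 1.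
Definition inw j t := r j <= t <= d j.

Hypothesis rd : forall j, j < n -> r j <= d j.
Hypothesis lam : forall j k, j < n -> k < n ->
  [|| subw j k, subw k j, d j < r k | d k < r j].

Lemma subw_trans i j k : subw i j -> subw j k -> subw i k.
Proof. rewrite /subw; lia. Qed.

(** A longest window absorbs the windows inside it and, by laminarity, is disjoint from all the
    others, so no job is counted twice; induction on the number of windows does the rest. *)
Lemma laminar_cover (s Ks : seq nat) (x y : nat -> nat) :
  {in s, forall j, (j < n)%N} -> {in Ks, forall j, (j < n)%N} ->
  (forall k, k \in Ks -> \sum_(j <- s | subw j k) y j <= \sum_(j <- s | subw j k) x j) ->
  \sum_(j <- s | has (subw j) Ks) y j <= \sum_(j <- s | has (subw j) Ks) x j.
Proof.
move=> sn; have [N] := ubnP (size Ks); elim: N Ks => // N IH Ks le Ksn h.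
case: Ks le Ksn h => [|k0 Ks0] le Ksn h; first by rewrite !big_pred0_eq.
move: le Ksn h; set Ks := k0 :: Ks0 => le Ksn h.
have [k kK kmax] : exists2 k, k \in Ks & forall k', k' \in Ks -> wl k' <= wl k.
  rewrite /Ks; elim: (Ks0) (k0) => [|k2 K2 IHK] k1.
    by exists k1; rewrite ?inE // => k'; rewrite inE => /eqP->.
  have [k kK km] := IHK k2.
  case: (leqP (wl k1) (wl k)) => lek.
    exists k; first by rewrite inE kK orbT.
    by move=> k'; rewrite inE => /predU1P[->//|/km].
  exists k1; first by rewrite inE eqxx.
  move=> k'; rewrite inE => /predU1P[->//|/km h']; lia.
move: kmax; clearbody Ks => kmax; have kn := Ksn _ kK.
pose Ks' := [seq k' <- Ks | ~~ subw k' k].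
have split j : j < n -> has (subw j) Ks = subw j k || has (subw j) Ks'.
  move=> jn; apply/idP/idP => [/hasP[k' k'K jk']|].
    case k'k: (subw k' k); first by rewrite (subw_trans jk' k'k).
    by apply/orP; right; apply/hasP; exists k' => //; rewrite mem_filter k'k.
  case/orP => [jk|/hasP[k' ]]; first by apply/hasP; exists k.
  by rewrite mem_filter => /andP[_ k'K] jk'; apply/hasP; exists k'.
have excl j : j < n -> subw j k -> has (subw j) Ks' = false.
  move=> jn jk; apply/negP => /hasP[k']; rewrite mem_filter => /andP[nk k'K] jk'.
  have := lam (Ksn _ k'K) kn; have := kmax _ k'K; have := rd jn.
  have := rd (Ksn _ k'K); have := rd kn.
  by move: nk jk jk'; rewrite /subw /wl; lia.
have E (F : nat -> nat) : \sum_(j <- s | has (subw j) Ks) F j =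
    \sum_(j <- s | subw j k) F j + \sum_(j <- s | has (subw j) Ks') F j.
  rewrite (bigID (subw^~ k)) /=; congr (_ + _); rewrite big_seq_cond [RHS]big_seq_cond;
    apply: eq_bigl => j; case js: (j \in s) => //=.
    by rewrite split ?sn //; case: (subw j k); rewrite ?andbF.
  rewrite split ?sn //; case jk: (subw j k); rewrite /= ?andbT //.
  by rewrite excl ?sn.
rewrite !E; apply: leq_add; first exact: h.
apply: IH.
- have: size Ks' < size Ks; last by move: le; lia.
  rewrite size_filter -(count_predC (fun k' => ~~ subw k' k) Ks) -[ltnLHS]addn0.
  rewrite ltn_add2l -has_count; apply/hasP; exists k => //=.
  by rewrite negbK /subw !leqnn.
- by move=> k'; rewrite mem_filter => /andP[_ /Ksn].
by move=> k'; rewrite mem_filter => /andP[_ /h].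
Qed.

Variables (a : nat -> nat) (c1 : nat) (cap : nat -> nat).

Definition area (G : seq nat) k := \sum_(j <- G | subw j k) a j.

(** [c1] clears a denominator: it will be twice the window length of the job with the largest p_j /
    |chi_j|, and [cap k] the equally scaled capacity of window [k]. *)
Definition within (G : seq nat) := all (fun k => c1 * area G k <= cap k) (iota 0 n).

Definition greedy_step G b := if within (rcons G b) then rcons G b else G.
Definition greedy s := foldl greedy_step [::] s.

Lemma greedy_rcons s b : greedy (rcons s b) = greedy_step (greedy s) b.
Proof. by rewrite /greedy foldl_rcons. Qed.

(** Acceptance is never revoked. Hence what is accepted in a prefix of the density order is part of
    the final selection, which summation by parts relies on. *)
Lemma greedy_cat s1 s2 :
  exists2 t, greedy (s1 ++ s2) = greedy s1 ++ t & subseq t s2.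
Proof.
elim/last_ind: s2 => [|s2 b [t e st]]; first by exists [::]; rewrite ?cats0.
rewrite -rcons_cat greedy_rcons e /greedy_step; case: ifP => _.
  by exists (rcons t b); [rewrite rcons_cat|rewrite -!cats1 cat_subseq].
by exists t => //; apply: subseq_trans st (subseq_rcons _ _).
Qed.

Lemma greedy_subseq s : subseq (greedy s) s.
Proof. by have [t] := greedy_cat [::] s; rewrite /= => ->. Qed.

Lemma greedy_within s : within (greedy s).
Proof.
elim/last_ind: s => [|s b IH].
  by apply/allP => k _; rewrite /area /= big_nil muln0.
by rewrite greedy_rcons /greedy_step; case: ifP.
Qed.

Lemma area_rcons G b k : area (rcons G b) k = area G k + subw b k * a b.
Proof.
rewrite /area -cats1 big_cat big_cons big_nil /=; case: ifP => _; lia.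
Qed.

(** The window that blocked [b] must contain it, since otherwise its area would not have changed;
    and it stays blocked, since the accepted area only grows. *)
Lemma greedy_rejects s b : b \in s -> b \notin greedy s ->
  exists k, [/\ k < n, subw b k & cap k < c1 * (area (greedy s) k + a b)].
Proof.
elim/last_ind: s => // s b' IH.
rewrite mem_rcons inE greedy_rcons /greedy_step.
have := greedy_within s; set G := greedy s in IH *; move=> wG.
case: ifP => [_|wb].
  rewrite mem_rcons inE; case: eqP => //= _ bs nb; have [k [kn bk h]] := IH bs nb.
  by exists k; split => //; rewrite area_rcons; nia.
case/predU1P => [->|bs nb]; last exact: IH.
move=> nb; move/allPn: wb => [k]; rewrite mem_iota add0n => /andP[_ kn].
rewrite -ltnNge area_rcons => h; exists k; split => //; last by case: (subw b' k) h; nia.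
by move: (allP wG k); rewrite mem_iota kn => /(_ isT); case: (subw b' k) h => //=; nia.
Qed.

(** [O] is the feasible set to compare with and [q1 / q2] the ratio omega; [saturated] is all that
    the greedy analysis has to know about feasibility. *)
Variables (O : pred nat) (q1 q2 : nat).
Hypothesis q12 : q1 <= q2.
Hypothesis saturated : forall k b A, k < n -> b < n -> subw b k ->
  cap k < c1 * (A + a b) ->
  q1 * (\sum_(j <- iota 0 n | O j && subw j k) a j) <= q2 * A.

Lemma greedy_area s : uniq s -> {in s, forall j, (j < n)%N} ->
  \sum_(j <- s) q1 * (O j * a j) <= \sum_(j <- s) q2 * ((j \in greedy s) * a j).
Proof.
move=> us sn; set G := greedy s.
have uG : uniq G by apply: subseq_uniq us; apply: greedy_subseq.
have Gs j : j \in G -> j \in s by apply: mem_subseq; apply: greedy_subseq.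
have Gn : {in G, forall j, (j < n)%N} by move=> j /Gs /sn.
have areaE k : area G k = \sum_(j <- s | subw j k) (j \in G) * a j.
  rewrite /area (sum_seq_iota _ _ uG Gn) (sum_seq_iota _ _ us sn).
  rewrite big_mkcond [RHS]big_mkcond; apply: eq_bigr => j _ /=.
  by case jG: (j \in G); [rewrite Gs //= mul1n|rewrite /= mul0n; case: ifP].
(* The windows are chosen by the inequality wanted rather than by being full, so that
   [laminar_cover] applies directly. *)
pose Ks := [seq k <- iota 0 n | q1 * (\sum_(j <- iota 0 n | O j && subw j k) a j) <= q2 * area G k].
have Ksn : {in Ks, forall j, (j < n)%N}.
  by move=> k; rewrite mem_filter mem_iota add0n => /andP[_ /andP[_]].
rewrite (bigID (fun j => has (subw j) Ks)) [leqRHS](bigID (fun j => has (subw j) Ks)) /=.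
(* Outside these windows every job is accepted, as a rejected one would lie in a saturated window;
   there [q1 <= q2] is enough. *)
apply: leq_add; last first.
  rewrite big_seq_cond [leqRHS]big_seq_cond; apply: leq_sum => j /andP[js nh].
  case jG: (j \in G); first by case: (O j); rewrite ?muln0 //= leq_mul2r q12 orbT.
  have [k [kn jk h]] := greedy_rejects js (negbT jG).
  case/negP: nh; apply/hasP; exists k => //.
  rewrite mem_filter mem_iota /= add0n kn andbT.
  by apply: saturated h => //; apply: sn.
apply: laminar_cover => // k; rewrite mem_filter => /andP[h _].
rewrite -!big_distrr /= -areaE; apply: leq_trans h; rewrite leq_mul2l; apply/orP; right.
rewrite (sum_seq_iota _ _ us sn) big_mkcond [leqRHS]big_mkcond; apply: leq_sum => j _ /=.
by case: (j \in s); case: (subw j k); case: (O j); rewrite /= ?mul1n.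
Qed.

Local Open Scope ring_scope.

(** The lower bound [c] makes the induction work: the last density [dl b] is the smallest, and after
    it has been split off it becomes the bound for the remaining jobs. *)
Lemma abel_sum_ge0 (s : seq nat) (z dl : nat -> rat) (c : rat) :
  pairwise (fun i j => dl j <= dl i) s -> {in s, forall i, c <= dl i} ->
  (forall t, 0 <= \sum_(j <- take t s) z j) ->
  0 <= \sum_(j <- s) z j * (dl j - c).
Proof.
elim/last_ind: s c => [|s b IH] c; first by move=> *; rewrite big_nil.
rewrite pairwise_rcons => /andP[/allP hb hs] hc hz.
have hbs : {in s, forall i, dl b <= dl i} by move=> i /hb.
have hzs t : 0 <= \sum_(j <- take t s) z j.
  have [ts|ts] := leqP t (size s).
    by have := hz t; rewrite -cats1 takel_cat.
  have := hz (size s); rewrite -cats1 takel_cat // take_size.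
  by rewrite take_oversize // ltnW.
have h1 := IH _ hs hbs hzs.
have h2 : 0 <= (dl b - c) * \sum_(j <- rcons s b) z j.
  rewrite mulr_ge0 ?subr_ge0 ?hc ?mem_rcons ?inE ?eqxx //.
  by have := hz (size (rcons s b)); rewrite take_size.
have -> : \sum_(j <- rcons s b) z j * (dl j - c) =
  \sum_(j <- s) z j * (dl j - dl b) + (dl b - c) * \sum_(j <- rcons s b) z j.
  rewrite -!cats1 !big_cat /= !big_cons !big_nil !addr0.
  rewrite [X in _ = _ + X]mulrDr addrA mulr_sumr -big_split /=.
  congr (_ + _); last by rewrite mulrC.
  by apply: eq_bigr => j _; ring.
exact: addr_ge0.
Qed.

Lemma greedy_profit s (dl : nat -> rat) : perm_eq s (iota 0 n) ->
  pairwise (fun i j => dl j <= dl i) s -> (forall j, (j < n)%N -> 0 <= dl j) ->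
  q1%:R * (\sum_(j <- iota 0 n | O j) (a j)%:R * dl j)
    <= q2%:R * (\sum_(j <- greedy s) (a j)%:R * dl j).
Proof.
move=> ps hs dl0.
have us : uniq s by rewrite (perm_uniq ps) iota_uniq.
have sn : {in s, forall j, (j < n)%N}.
  by move=> j; rewrite (perm_mem ps) mem_iota add0n => /andP[].
set G := greedy s.
pose z j : rat := (q2 * ((j \in G) * a j))%:R - (q1 * (O j * a j))%:R.
have zt t : 0 <= \sum_(j <- take t s) z j.
  rewrite /z sumrB subr_ge0 -!natr_sum ler_nat.
  have ut : uniq (take t s) by rewrite take_uniq.
  have tn : {in take t s, forall j, (j < n)%N} by move=> j /mem_take /sn.
  apply: leq_trans (greedy_area ut tn) _; rewrite big_seq [leqRHS]big_seq.
  apply: leq_sum => j jt; rewrite leq_mul2l; apply/orP; right.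
  rewrite leq_mul2r; apply/orP; right.
  have [t' e st'] := greedy_cat (take t s) (drop t s).
  by rewrite cat_take_drop in e; rewrite /G e mem_cat; case: (_ \in greedy _).
have := @abel_sum_ge0 s z dl 0 hs _ zt.
have h0 : {in s, forall i, 0 <= dl i} by move=> i /sn /dl0.
move=> /(_ h0).
have -> : \sum_(j <- s) z j * (dl j - 0) = q2%:R * (\sum_(j <- G) (a j)%:R * dl j)
   - q1%:R * (\sum_(j <- iota 0 n | O j) (a j)%:R * dl j); last by rewrite subr_ge0.
have -> : \sum_(j <- G) (a j)%:R * dl j = \sum_(j <- s) (j \in G)%:R * ((a j)%:R * dl j).
  have uG : uniq G by apply: subseq_uniq us; apply: greedy_subseq.
  have Gn : {in G, forall j, (j < n)%N}.
    by move=> j /(mem_subseq (greedy_subseq s)) /sn.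
  rewrite (perm_big _ (perm_filter_iota uG Gn)) (perm_big _ ps) big_filter big_mkcond.
  by apply: eq_bigr => j _; case: (_ \in _); rewrite ?mul1r ?mul0r.
rewrite -(perm_big _ ps) [\sum_(j <- s | O j) _]big_mkcond /= !big_distrr -sumrB /=.
apply: eq_bigr => j _; rewrite /z !natrM; case: (O j) => /=; ring.
Qed.

End Greedy.

(** * Scheduling slot by slot *)

(* The state of a slot: hosts 0, ..., ch-1 are in use; cu is the host that
   received the last narrow job placed on a fresh host, with load cg (in units
   of 1/D).  The slot is gray if that load is below 1/2.  All other hosts in use
   have load at least 1/2.  The mark cm prevents running a job twice. *)
Record cellst := Cell { ch : nat; cu : nat; cg : nat; cm : nat }.

Definition runs (ps : seq (nat * nat * nat * nat)) j i t :=
  has (fun q => let: (j', i', a, e) := q in [&& j' == j, i' == i & a <= t <= e]) ps.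

Definition active (ps : seq (nat * nat * nat * nat)) j t :=
  has (fun q => let: (j', _, a, e) := q in (j' == j) && (a <= t <= e)) ps.

Lemma runs_active ps j i t : runs ps j i t -> active ps j t.
Proof. by apply: sub_has => [[[[j' i'] a] e]] /and3P[-> _ ->]. Qed.

Lemma active_runs ps j t : active ps j t -> exists i, runs ps j i t.
Proof.
case/hasP => [[[[j' i] a] e]] qp /andP[h1 h2]; exists i; apply/hasP.
by exists (j', i, a, e) => //; rewrite h1 eqxx.
Qed.

Lemma runs_rcons ps b i0 a e j i t : runs (rcons ps (b, i0, a, e)) j i t =
  runs ps j i t || [&& b == j, i0 == i & a <= t <= e].
Proof. by rewrite /runs has_rcons orbC. Qed.

Lemma active_rcons ps b i0 a e j t : active (rcons ps (b, i0, a, e)) j t =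
  active ps j t || (b == j) && (a <= t <= e).
Proof. by rewrite /active has_rcons orbC. Qed.

Lemma sum_pred1 (s : seq nat) (x c : nat) : uniq s ->
  \sum_(i <- s) (i == x) * c = (x \in s) * c.
Proof.
elim: s => [|i s IH] /=; first by rewrite big_nil.
case/andP => nis us; rewrite big_cons IH // inE eq_sym.
case: eqP nis => [->|_] /=; last by rewrite mul0n.
by move/negPf => ->; rewrite mul1n addn0.
Qed.

Lemma sum_bool (s : seq nat) (P : pred nat) : \sum_(t <- s) P t = count P s.
Proof. by elim: s => [|t s IH]; rewrite ?big_nil // big_cons IH. Qed.

Lemma sum_interval T a e : 1 <= a -> a <= e.+1 -> e <= T ->
  \sum_(t <- iota 1 T) (a <= t <= e) = e.+1 - a.
Proof.
move=> a1 ae eT; rewrite (sum_bool _ (fun t => a <= t <= e)) -(size_iota a (e.+1 - a)) -size_filter.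
apply: perm_size; apply: uniq_perm; rewrite ?filter_uniq ?iota_uniq //.
by move=> t; rewrite mem_filter !mem_iota; lia.
Qed.

Lemma mul_pred D x c : x < c -> c * D = (c - 1) * D + D.
Proof. by case: c => // c _; rewrite subn1 mulSn addnC. Qed.

Section Slots.

Variables (n T m D ln ld : nat) (r d p sz : nat -> nat).

Local Notation subw := (subw r d).
Local Notation inw := (inw r d).
Local Notation wl := (wl r d).
Local Notation slots := (iota 1 T).

Hypothesis rdT : forall j, j < n -> [/\ 0 < r j, r j <= d j & d j <= T].
Hypothesis lam : forall j k, j < n -> k < n ->
  [|| subw j k, subw k j, d j < r k | d k < r j].
Hypothesis szD : forall j, j < n -> 0 < sz j <= D.
Hypothesis plam : forall j, j < n -> p j * ld <= ln * wl j.

Definition load ps i t := \sum_(j <- iota 0 n | runs ps j i t) sz j.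

Definition gray q := 2 * cg q < D.

(** Only the effect of half-full hosts on the total load is kept, in [so_ge]: each host in use other
    than the gray one contributes at least [D] to twice the total. *)
Record slotok ps q t : Prop := Slotok {
  so_hm : ch q <= m;
  so_host : forall j i, runs ps j i t -> i < ch q;
  so_le : forall i, load ps i t <= D;
  so_ge : (ch q - gray q) * D + gray q * (2 * cg q)
            <= 2 * \sum_(i <- iota 0 m) load ps i t;
  so_gray : gray q -> cu q < ch q /\ load ps (cu q) t = cg q;
  so_one : forall j i i', runs ps j i t -> runs ps j i' t -> i = i';
  so_win : forall j i, runs ps j i t -> inw j t }.

(** The mark is [b.+1] because the initial mark 0 must differ from that of job 0. *)
Definition put_gray b q := Cell (ch q) (cu q) (cg q + sz b) b.+1.

(** A narrow job turns its fresh host into the one that may be gray, which is sound only if the slot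
    was not gray before. A wide job is itself above half and leaves the gray host alone. *)
Definition put_fresh b q :=
  if 2 * sz b <= D then Cell (ch q).+1 (ch q) (sz b) b.+1
  else Cell (ch q).+1 (cu q) (cg q) b.+1.

Lemma load_rcons ps b i0 a e i t : b < n -> a <= t <= e -> ~~ active ps b t ->
  load (rcons ps (b, i0, a, e)) i t = load ps i t + (i == i0) * sz b.
Proof.
move=> bn te nb; rewrite /load big_mkcond [in RHS]big_mkcond /=.
have -> : (i == i0) * sz b = \sum_(j <- iota 0 n) (j == b) * ((i == i0) * sz b).
  by rewrite sum_pred1 ?iota_uniq // mem_iota add0n bn mul1n.
rewrite -big_split; apply: eq_bigr => j _ /=.
rewrite runs_rcons te andbT [j == b]eq_sym [i == i0]eq_sym.
case: (b =P j) => [<-|_]; last by rewrite orbF addn0.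
have -> : runs ps b i t = false by apply: contraNF nb; apply: runs_active.
by case: (i0 == i); rewrite /= ?mul1n.
Qed.

Lemma load_gt0 ps q t j i : slotok ps q t -> runs ps j i t -> j < n ->
  sz j <= \sum_(i <- iota 0 m) load ps i t.
Proof.
move=> ok rj jn; have im : i < m by apply: leq_trans (so_host ok rj) (so_hm ok).
rewrite (big_rem i) /= ?mem_iota //; apply: leq_trans (leq_addr _ _).
rewrite /load big_mkcond (big_rem j) /= ?mem_iota // rj; exact: leq_addr.
Qed.

Lemma sum_load_rcons ps b i0 a e t : b < n -> a <= t <= e -> ~~ active ps b t ->
  i0 < m ->
  \sum_(i <- iota 0 m) load (rcons ps (b, i0, a, e)) i t =
  \sum_(i <- iota 0 m) load ps i t + sz b.
Proof.
move=> bn te nb im; under eq_bigr => i _ do rewrite load_rcons //.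
by rewrite big_split sum_pred1 ?iota_uniq //= mem_iota add0n im mul1n.
Qed.

Lemma load_fresh ps q t i : slotok ps q t -> ch q <= i -> load ps i t = 0.
Proof.
move=> ok le; rewrite /load big_pred0 // => j.
by apply/negP => /(so_host ok); rewrite ltnNge le.
Qed.

Lemma slotok_other ps q t b i0 a e : ~~ (a <= t <= e) ->
  slotok ps q t -> slotok (rcons ps (b, i0, a, e)) q t.
Proof.
move=> te; have E j i : runs (rcons ps (b, i0, a, e)) j i t = runs ps j i t.
  by rewrite runs_rcons (negPf te) !andbF orbF.
have EL i : load (rcons ps (b, i0, a, e)) i t = load ps i t.
  by apply: eq_bigl => j; rewrite E.
case=> h1 h2 h3 h4 h5 h6 h7; split => //.
- by move=> j i; rewrite E; apply: h2.
- by move=> i; rewrite EL.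
- by under [in leqRHS]eq_bigr => i _ do rewrite EL.
- by rewrite EL.
- by move=> j i i'; rewrite !E; apply: h6.
by move=> j i; rewrite E; apply: h7.
Qed.

Section Put.

Variables (ps : seq (nat * nat * nat * nat)) (q : cellst) (t b a e : nat).
Hypotheses (bn : b < n) (te : a <= t <= e) (nb : ~~ active ps b t).
Hypotheses (ok : slotok ps q t) (wb : inw b t).

Lemma put_one i0 j i i' : runs (rcons ps (b, i0, a, e)) j i t ->
  runs (rcons ps (b, i0, a, e)) j i' t -> i = i'.
Proof.
rewrite !runs_rcons te !andbT => /orP[r1|/andP[/eqP<- /eqP<-]] /orP[r2|/andP[/eqP e2 /eqP<-]] //.
- exact: (so_one ok r1 r2).
- by case/negP: nb; rewrite e2; apply: runs_active r1.
by case/negP: nb; apply: runs_active r2.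
Qed.

Lemma put_win i0 j i : runs (rcons ps (b, i0, a, e)) j i t -> inw j t.
Proof.
by rewrite runs_rcons => /orP[/(so_win ok)//|/and3P[/eqP<-]].
Qed.

(** A load below 1/2 and a narrow job fit on one host, which then either stays gray or joins the
    half-full ones. *)
Lemma put_gray_ok : gray q -> 2 * sz b <= D ->
  slotok (rcons ps (b, cu q, a, e)) (put_gray b q) t.
Proof.
move=> gq nar; have [uh lu] := so_gray ok gq.
have um : cu q < m by apply: leq_trans uh (so_hm ok).
split; rewrite /put_gray /=.
- exact: so_hm ok.
- move=> j i; rewrite runs_rcons => /orP[/(so_host ok)//|/and3P[_ /eqP<-] //].
- move=> i; rewrite load_rcons //; case: eqP => [->|_]; last by rewrite addn0 (so_le ok).
  by rewrite lu mul1n; move: gq nar; rewrite /gray; lia.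
- rewrite sum_load_rcons //; have := so_ge ok; rewrite gq /gray /= mul1n.
  case: ltnP => /=; rewrite ?subn0 ?mul1n ?mul0n; [lia|].
  by have := mul_pred D uh; lia.
- move=> _; rewrite load_rcons // lu eqxx mul1n; split => //.
- exact: put_one.
exact: put_win.
Qed.

Lemma put_fresh_ok : ch q < m -> (2 * sz b <= D -> ~~ gray q) ->
  slotok (rcons ps (b, ch q, a, e)) (put_fresh b q) t.
Proof.
move=> hm ng; have lf := load_fresh ok (leqnn _).
have chE : ch (put_fresh b q) = (ch q).+1 by rewrite /put_fresh; case: ifP.
have /andP[_ sbD] := szD bn.
split; rewrite ?chE //.
- move=> j i; rewrite runs_rcons => /orP[/(so_host ok)|/and3P[_ /eqP<-] //]; lia.
- move=> i; rewrite load_rcons //; case: eqP => [->|_]; last by rewrite addn0 (so_le ok).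
  by rewrite lf mul1n.
- rewrite sum_load_rcons //; have := so_ge ok; rewrite /put_fresh.
  have [nar|wide] := leqP (2 * sz b) D.
    rewrite (negPf (ng nar)) /= subn0 mul0n addn0 /gray /=.
    case: ltnP => /=; rewrite ?subn1 ?subn0 ?mul1n ?mul0n ?mulSn /=; lia.
  rewrite /gray /= -/(gray q); case gq: (gray q); last by rewrite !subn0 mulSn; lia.
  have [uh _] := so_gray ok gq; rewrite !mul1n /= subn1 /= -subn1.
  by have := mul_pred D uh; lia.
- rewrite /put_fresh; have [nar|wide] := leqP (2 * sz b) D => /= gq.
    by rewrite load_rcons // lf eqxx mul1n.
  have [uh lu] := so_gray ok gq; split; first exact: ltnW.
  by rewrite load_rcons // lu; case: eqP uh => [->|]; rewrite ?ltnn //= addn0.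
- exact: put_one.
exact: put_win.
Qed.

End Put.

(** * Placing one job piece by piece *)

Definition cnt ps j := \sum_(t <- slots) active ps j t.

Lemma cnt_rcons ps b i0 a e : 1 <= a -> a <= e -> e <= T ->
  (forall t, a <= t <= e -> ~~ active ps b t) ->
  cnt (rcons ps (b, i0, a, e)) b = cnt ps b + (e.+1 - a).
Proof.
move=> a1 ae eT nb; rewrite -(sum_interval a1 (leqW ae) eT) -big_split.
apply: eq_bigr => t _; rewrite active_rcons eqxx /=.
by case te: (a <= t <= e); [rewrite (negPf (nb _ te))|rewrite orbF addn0].
Qed.

Lemma cnt_rcons_other ps b i0 a e j : b != j ->
  cnt (rcons ps (b, i0, a, e)) j = cnt ps j.
Proof.
by move=> ne; apply: eq_bigr => t _; rewrite active_rcons (negPf ne) orbF.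
Qed.

Definition slot_in t := 0 < t <= T.

Lemma mem_slots t : (t \in slots) = slot_in t.
Proof. by rewrite mem_iota /slot_in; lia. Qed.

Lemma inw_slot j t : j < n -> inw j t -> slot_in t.
Proof. by move=> /rdT[? ? ?]; rewrite /inw /slot_in; lia. Qed.

Record placed (proc : seq nat) (F : nat -> cellst) ps : Prop := Placed {
  pl_ok : forall t, slot_in t -> slotok ps (F t) t;
  pl_cnt : forall j, j \in proc -> cnt ps j = p j;
  pl_all : {in ps, forall q, let: (j, i, _, _) := q in (j \in proc) && (i < m)} }.

Lemma placed_proc proc F ps j t : placed proc F ps -> active ps j t -> j \in proc.
Proof.
move=> P /hasP[[[[j' i] a] e] qp /andP[/eqP<- _]].
by have /andP[] := pl_all P qp.
Qed.

(** The state in the middle of a job, with [need] slots still lacking. [pg_mark] ties the marks,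
    which the program can test, to the slots where [b] already runs. *)
Record placing proc b F ps need : Prop := Placing {
  pg_ok : forall t, slot_in t -> slotok ps (F t) t;
  pg_cnt : forall j, j \in proc -> cnt ps j = p j;
  pg_all : {in ps, forall q, let: (j, i, _, _) := q in (j \in b :: proc) && (i < m)};
  pg_mark : forall t, slot_in t -> (cm (F t) == b.+1) = active ps b t;
  pg_need : cnt ps b + need = p b }.

Definition put_seg F a e q t := if a <= t <= e then q else F t : cellst.

Lemma placing_step proc b F ps need i0 q a e :
  b < n -> b \notin proc -> placing proc b F ps need ->
  a <= e -> inw b a -> inw b e -> e.+1 - a <= need -> i0 < m -> cm q = b.+1 ->
  (forall t, a <= t <= e -> cm (F t) != b.+1) ->
  (forall t, a <= t <= e -> inw b t -> ~~ active ps b t -> slotok ps (F t) t ->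
     slotok (rcons ps (b, i0, a, e)) q t) ->
  placing proc b (put_seg F a e q) (rcons ps (b, i0, a, e)) (need - (e.+1 - a)).
Proof.
move=> bn nbp P ae wa we le im cq nm hq.
have [r1 r2 r3] := rdT bn.
have sub t : a <= t <= e -> inw b t by move: wa we; rewrite /inw; lia.
have sl t : a <= t <= e -> slot_in t by move=> /sub; apply: inw_slot.
have nact t : a <= t <= e -> ~~ active ps b t.
  by move=> te; rewrite -(pg_mark P) ?sl ?nm.
split.
- move=> t ts; rewrite /put_seg; case: ifP => te.
    by apply: hq => //; [exact: sub|exact: nact|exact: pg_ok P _ ts].
  by apply: slotok_other; [rewrite te|exact: pg_ok P _ ts].
- move=> j jp; rewrite cnt_rcons_other ?(pg_cnt P) //.
  by apply: contraNneq nbp => ->.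
- move=> x; rewrite mem_rcons inE => /predU1P[->|]; last exact: pg_all P x.
  by rewrite inE eqxx.
- move=> t ts; rewrite active_rcons eqxx -(pg_mark P ts) /put_seg.
  by case: ifP; rewrite ?orbT ?orbF // cq eqxx.
have sa := sl a; have se := sl e.
by rewrite cnt_rcons //; [have := pg_need P|move: sa|move: se]; rewrite /slot_in; lia.
Qed.

(** * The effect of the two passes on gray slots *)

Definition gray_pass1 b (gr0 : pred nat) F ps :=
  forall t, slot_in t -> (gray (F t) -> gr0 t) /\
    (~~ active ps b t -> gray (F t) = gr0 t).

Definition narrow b := 2 * sz b <= D.

Definition cond1 b q := [&& narrow b, gray q & cm q != b.+1].
Definition cond2 b q := (ch q < m) && (cm q != b.+1).

Definition shrunk (gr0 : pred nat) F := forall t, slot_in t -> gray (F t) -> gr0 t.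

Definition moved b (gr0 : pred nat) F ps := forall t, slot_in t -> gray (F t) ->
  if inw b t then active ps b t : Prop else gr0 t.

(** The second pass is in one of three situations: a wide job never makes a slot gray; a narrow job
    that the first pass could not satisfy runs in every gray slot of its window, old or new; or no
    slot is lacking. *)
Definition gray_pass2 b gr0 F ps need :=
  [\/ ~~ narrow b /\ shrunk gr0 F, narrow b /\ moved b gr0 F ps
    | need = 0 /\ shrunk gr0 F].

Lemma pass1_step proc b gr0 F ps need q a e :
  b < n -> b \notin proc -> placing proc b F ps need -> gray_pass1 b gr0 F ps ->
  a <= e -> inw b a -> inw b e -> e.+1 - a <= need -> cond1 b q ->
  (forall t, a <= t <= e -> F t = q) ->
  let F' := put_seg F a e (put_gray b q) in
  let ps' := rcons ps (b, cu q, a, e) in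
  placing proc b F' ps' (need - (e.+1 - a)) /\ gray_pass1 b gr0 F' ps'.
Proof.
move=> bn nbp P G ae wa we le /and3P[nb gq mq] hF F' ps'.
have ts0 : slot_in a := inw_slot bn wa.
have te0 : a <= a <= e by rewrite leqnn ae.
have um : cu q < m.
  have := pg_ok P ts0; rewrite hF // => ok; have [h _] := so_gray ok gq.
  exact: leq_trans h (so_hm ok).
split.
  apply: placing_step => //; first by move=> t /hF ->.
  by move=> t te wt na; rewrite hF // => ok; apply: put_gray_ok.
move=> t ts; rewrite /F' /ps' /put_seg active_rcons eqxx /=.
have [g1 g2] := G t ts; case te: (a <= t <= e); last by rewrite orbF.
by rewrite orbT; split => // g'; apply: g1; rewrite hF.
Qed.

Lemma pass2_step proc b gr0 F ps need q a e :
  b < n -> b \notin proc -> placing proc b F ps need -> gray_pass2 b gr0 F ps need ->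
  a <= e -> inw b a -> inw b e -> e.+1 - a <= need -> cond2 b q ->
  (forall t, a <= t <= e -> F t = q) ->
  let F' := put_seg F a e (put_fresh b q) in
  let ps' := rcons ps (b, ch q, a, e) in
  placing proc b F' ps' (need - (e.+1 - a)) /\
  gray_pass2 b gr0 F' ps' (need - (e.+1 - a)).
Proof.
move=> bn nbp P G ae wa we le /andP[hm mq] hF F' ps'.
have sub t : a <= t <= e -> inw b t by move: wa we; rewrite /inw; lia.
have sl t : a <= t <= e -> slot_in t by move=> /sub; apply: inw_slot.
split.
  apply: placing_step => //; first by rewrite /put_fresh; case: ifP.
    by move=> t /hF ->.
  move=> t te wt na; rewrite hF // => ok; apply: put_fresh_ok => // nb.
  apply/negP => gq; case: G => [[]|[_ mv]|[n0 _]]; [by rewrite /narrow nb| |lia].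
  by have := mv t (sl t te); rewrite hF // wt => /(_ gq); rewrite (negPf na).
case: G => [[nb sh]|[nb mv]|[n0 _]]; [constructor 1|constructor 2|lia].
  split => // t ts; rewrite /F' /put_seg; case: ifP => te; last exact: sh.
  by rewrite /put_fresh -/(narrow b) (negPf nb) => gq; apply: sh => //; rewrite hF.
split => // t ts; rewrite /F' /ps' /put_seg active_rcons eqxx /=.
case: ifP => te; first by rewrite (sub _ te) orbT.
by rewrite orbF; apply: mv.
Qed.

Lemma pass1_start proc b F ps : b \notin proc -> placed proc F ps ->
  (forall t, slot_in t -> cm (F t) != b.+1) ->
  placing proc b F ps (p b) /\ gray_pass1 b (fun t => gray (F t)) F ps.
Proof.
move=> nbp P nm.
have na t : active ps b t = false.
  by apply: contraNF nbp; apply: placed_proc P.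
split; last by split.
split.
- exact: pl_ok P.
- exact: pl_cnt P.
- move=> [[[j i] a] e] qp; have /andP[jp im] := pl_all P qp.
  by rewrite inE jp orbT im.
- by move=> t ts; rewrite na; apply/negbTE/nm.
by rewrite /cnt big1 ?add0n // => t _; rewrite na.
Qed.

Lemma pass1_end b gr0 F ps need : gray_pass1 b gr0 F ps ->
  (forall t, slot_in t -> (cm (F t) == b.+1) = active ps b t) ->
  (0 < need -> forall t, slot_in t -> inw b t -> ~~ cond1 b (F t)) ->
  gray_pass2 b gr0 F ps need.
Proof.
move=> G M h; case nb: (narrow b); last first.
  by constructor 1; split; [rewrite ?nb|move=> t /G[]].
case: need h => [_|need /(_ isT) h].
  by constructor 3; split => // t /G[].
constructor 2; split => // t ts gt; case: ifP => wt; last by case: (G t ts) => + _; apply.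
by have := h t ts wt; rewrite /cond1 nb gt M //= negbK.
Qed.

Lemma placing_end proc b F ps : placing proc b F ps 0 -> placed (rcons proc b) F ps.
Proof.
move=> P; split; first exact: pg_ok P.
  move=> j; rewrite mem_rcons inE => /predU1P[->|]; last exact: pg_cnt P j.
  by have := pg_need P; lia.
by move=> [[[j i] a] e] /(pg_all P); rewrite mem_rcons.
Qed.

(* The bound on gray slots is kept for all unions of slots that do not cut a
   processed window: the window of the new job can then be split off. *)
Definition few_gray (proc : seq nat) (gr : pred nat) := forall Y : pred nat,
  (forall j, j \in proc -> (forall t, inw j t -> Y t) \/ (forall t, inw j t -> ~~ Y t)) ->
  ld * (\sum_(t <- slots) (Y t && gr t)) <= ln * (\sum_(t <- slots) Y t).

(** This is what the order of processing is for: a window that came earlier, being no longer, cannot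
    properly contain that of [b]. *)
Lemma sub_or_disjoint j b : j < n -> b < n -> wl j <= wl b ->
  subw j b \/ forall t, inw j t -> ~~ inw b t.
Proof.
move=> jn bn le; have := lam jn bn; have [_ r1 _] := rdT jn.
have [_ r2 _] := rdT bn; move: le; rewrite /wl /subw /inw => le h.
case jb: ((r b <= r j) && (d j <= d b)); first by left.
by right => t; lia.
Qed.

Lemma sum_window b : b < n -> \sum_(t <- slots) inw b t = wl b.
Proof. by move=> /rdT[r1 r2 r3]; rewrite sum_interval //; rewrite /wl; lia. Qed.

Lemma few_gray_step proc b gr0 F ps need :
  b < n -> {in proc, forall j, j < n /\ wl j <= wl b} ->
  placing proc b F ps need -> few_gray proc gr0 -> gray_pass2 b gr0 F ps need ->
  few_gray (rcons proc b) (fun t => gray (F t)).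
Proof.
move=> bn hp P fg G Y hY.
have hYp j : j \in proc ->
    (forall t, inw j t -> Y t) \/ (forall t, inw j t -> ~~ Y t).
  by move=> jp; apply: hY; rewrite mem_rcons inE jp orbT.
have easy : shrunk gr0 F -> ld * (\sum_(t <- slots) (Y t && gray (F t)))
    <= ln * (\sum_(t <- slots) Y t).
  move=> sh; apply: leq_trans (fg Y hYp); rewrite leq_mul2l; apply/orP; right.
  rewrite big_seq [leqRHS]big_seq; apply: leq_sum => t; rewrite mem_slots => ts.
  by case: (Y t) => //=; case g: (gray (F t)) => //; rewrite sh.
case: G => [[_ /easy//]|[nb mv]|[_ /easy//]].
case: (hY b); first by rewrite mem_rcons inE eqxx.
  (* Earlier windows lie inside the window of [b] or are disjoint from it, so [Y'] cuts none of them
     and the old bound applies. Inside the window, every gray slot runs [b], hence there are at most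
     [p b] of them. *)
  move=> bY; pose Y' t := Y t && ~~ inw b t.
  have h' : ld * (\sum_(t <- slots) (Y' t && gr0 t)) <= ln * (\sum_(t <- slots) Y' t).
    apply: fg => j jp; have [jn jw] := hp j jp; have := rdT jn => -[_ rj _].
    case: (sub_or_disjoint jn bn jw) => [/andP[h1 h2]|h].
      by right => t; rewrite /inw /Y' /inw; lia.
    case: (hYp j jp) => h3; last by right => t /h3; rewrite /Y'; case: (Y t).
    by left => t tj; rewrite /Y' (h3 _ tj) (h _ tj).
  have -> : \sum_(t <- slots) Y t = \sum_(t <- slots) Y' t + wl b.
    rewrite -(sum_window bn) -big_split; apply: eq_bigr => t _ /=.
    by rewrite /Y'; case wt: (inw b t); [rewrite bY|rewrite andbT addn0].
  have le : \sum_(t <- slots) (Y t && gray (F t)) <=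
            \sum_(t <- slots) (Y' t && gr0 t) + cnt ps b.
    rewrite /cnt -big_split /= big_seq [leqRHS]big_seq; apply: leq_sum => t.
    rewrite mem_slots => ts; case g: (gray (F t)); last by rewrite andbF.
    have := mv t ts g; rewrite /Y'; case wt: (inw b t) => h.
      by rewrite h; case: (Y t); rewrite ?andbF.
    by rewrite h !andbT; case: (Y t).
  rewrite mulnDr; apply: leq_trans (_ : _ <= ld * (\sum_(t <- slots) (Y' t && gr0 t) + cnt ps b)) _.
    by rewrite leq_mul2l le orbT.
  rewrite mulnDr; apply: leq_add => //; apply: leq_trans (plam bn).
  by rewrite mulnC leq_mul2r; have := pg_need P; lia.
move=> bY; apply: leq_trans (fg Y hYp); rewrite leq_mul2l; apply/orP; right.
rewrite big_seq [leqRHS]big_seq; apply: leq_sum => t; rewrite mem_slots => ts.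
case Yt: (Y t) => //=; case g: (gray (F t)) => //; have := mv t ts g.
by case: ifP => [/bY|_ ->//]; rewrite Yt.
Qed.

Lemma few_gray_nil (gr : pred nat) : (forall t, slot_in t -> ~~ gr t) -> few_gray [::] gr.
Proof.
move=> h Y _; rewrite big_seq big1 ?muln0 // => t.
by rewrite mem_slots => /h /negPf->; rewrite andbF.
Qed.

(** Only [b] and earlier jobs whose windows lie inside that of [b] can run there, and all of these
    were accepted; the missing slots of [b] are charged to its own area. *)
Lemma window_load proc b F ps need G : b < n ->
  {in proc, forall j, j < n /\ wl j <= wl b} -> b \notin proc ->
  uniq G -> {in G, forall j, j < n} -> {subset b :: proc <= G} ->
  placing proc b F ps need ->
  \sum_(t <- slots | inw b t) \sum_(i <- iota 0 m) load ps i t + need * sz b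
    <= area r d (fun j => p j * sz j) G b.
Proof.
move=> bn hp nbp uG Gn sG P.
rewrite /area (sum_seq_iota _ _ uG Gn).
have -> : need * sz b = \sum_(j <- iota 0 n) (j == b) * (need * sz b).
  by rewrite sum_pred1 ?iota_uniq // mem_iota add0n bn mul1n.
have le : \sum_(t <- slots | inw b t) \sum_(i <- iota 0 m) load ps i t <=
   \sum_(t <- slots | inw b t) \sum_(j <- iota 0 n) active ps j t * sz j.
  rewrite big_seq_cond [leqRHS]big_seq_cond; apply: leq_sum => t /andP[].
  rewrite mem_slots => ts wt; have ok := pg_ok P ts.
  under eq_bigr => i _ do rewrite /load big_mkcond.
  rewrite exchange_big; apply: leq_sum => j _ /=.
  case aj: (active ps j t); last first.
    rewrite big1 // => i _; case: ifP => // /runs_active; by rewrite aj.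
  have [i0 ri0] := active_runs aj; rewrite mul1n.
  have -> : \sum_(i <- iota 0 m) (if runs ps j i t then sz j else 0) =
            \sum_(i <- iota 0 m) (i == i0) * sz j.
    apply: eq_bigr => i _; case: eqP => [->|ne]; first by rewrite ri0 mul1n.
    by case: ifP => // ri; case: ne; apply: (so_one ok ri ri0).
  by rewrite sum_pred1 ?iota_uniq //; case: (_ \in _); rewrite ?mul1n.
apply: leq_trans (leq_add le (leqnn _)) _.
rewrite exchange_big -big_split [leqRHS]big_mkcond big_seq [leqRHS]big_seq /=.
apply: leq_sum => j; rewrite mem_iota add0n => /andP[_ jn].
rewrite -big_distrl /=.
have lec : \sum_(t <- slots | inw b t) active ps j t <= cnt ps j.
  by rewrite /cnt big_mkcond; apply: leq_sum => t _; case: ifP.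
case: eqP => [jb|jb].
  have bb : subw b b by apply/andP.
  rewrite jb sG ?inE ?eqxx //= bb /= mul1n -mulnDl leq_mul2r.
  by rewrite jb in lec; rewrite -(pg_need P) leq_add2r lec orbT.
rewrite mul0n addn0; case jp: (j \in proc).
  have [_ jw] := hp j jp; rewrite sG ?inE ?jp ?orbT //=.
  case: (sub_or_disjoint jn bn jw) => [->|dis].
    by rewrite leq_mul2r -(pg_cnt P jp) lec orbT.
  rewrite big1_seq // => t /andP[wt]; rewrite mem_slots => ts.
  apply/eqP; rewrite eqb0; apply/negP => aj; have [i ri] := active_runs aj.
  by have := dis _ (so_win (pg_ok P ts) ri); rewrite wt.
rewrite big1_seq // => t /andP[wt]; rewrite mem_slots => ts.
apply/eqP; rewrite eqb0; apply/negP => /hasP[[[[j' i] a] e] qp /andP[/eqP ej _]].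
have /andP[+ _] := pg_all P qp; rewrite ej inE jp orbF => /eqP; exact: jb.
Qed.

(** If slots were lacking, all [m] hosts would be in use in each slot of the window where [b] does
    not run. The load found there, together with the missing part of [b], then exceeds the cap of
    the greedy test. *)
Lemma enough_slots proc b gr0 F ps need G : b < n -> 0 < m ->
  {in proc, forall j, j < n /\ wl j <= wl b} -> b \notin proc ->
  uniq G -> {in G, forall j, j < n} -> {subset b :: proc <= G} ->
  placing proc b F ps need -> few_gray proc gr0 -> gray_pass2 b gr0 F ps need ->
  2 * ld * area r d (fun j => p j * sz j) G b <= (ld - ln) * m * wl b * D ->
  ln <= ld -> 0 < ld ->
  (0 < need -> forall t, slot_in t -> inw b t -> ~~ cond2 b (F t)) ->
  need = 0.
Proof.
move=> bn m0 hp nbp uG Gn sG P fg G2 cap lnd ld0 full.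
case: (posnP need) => // n0; move/(_ n0): full => full; exfalso.
have WL := window_load bn hp nbp uG Gn sG P.
have /andP[sb0 sbD] := szD bn.
set A := area _ _ _ _ _ in cap WL; set L := \sum_(t <- slots | inw b t) _ in WL.
have cb : \sum_(t <- slots) (inw b t && active ps b t) <= cnt ps b.
  by apply: leq_sum => t _; case: (inw b t).
have Hn := pg_need P.
pose c := \sum_(t <- slots) (inw b t && active ps b t).
have cE : \sum_(t <- slots) (inw b t && ~~ active ps b t) + c = wl b.
  rewrite -(sum_window bn) -big_split; apply: eq_bigr => t _ /=.
  by case: (inw b t); case: (active ps b t).
have LE (x : nat -> nat) : \sum_(t <- slots | inw b t) x t = \sum_(t <- slots) inw b t * x t.
  by rewrite big_mkcond; apply: eq_bigr => t _; case: (inw b t); rewrite ?mul1n.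
have cc : c + need <= p b by rewrite -Hn leq_add2r.
have pw := plam bn.
(* Narrow case: the slots without [b] are not gray, so each has load at least m / 2, and there are
   at least (1 - lam) |chi_b| of them. The missing part of [b] makes the excess strict. *)
have [nar|wide] := boolP (narrow b).
  have lb : \sum_(t <- slots) (inw b t && ~~ active ps b t) * (m * D) <= 2 * L.
    rewrite /L LE big_distrr /= big_seq [leqRHS]big_seq; apply: leq_sum => t.
    rewrite mem_slots => ts; case wt: (inw b t) => //=; rewrite mul1n.
    case at_: (active ps b t) => //; rewrite mul1n.
    have ok := pg_ok P ts; have := full t ts wt.
    rewrite /cond2 (pg_mark P) // at_ andbT -leqNgt => mh.
    have ng : gray (F t) = false.
      apply/negP => gt; case: G2 => [[]|[_ mv]|[n00 _]]; [by rewrite nar| |lia].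
      by have := mv t ts gt; rewrite wt at_.
    have := so_ge ok; rewrite ng subn0 mul0n addn0; apply: leq_trans.
    by rewrite leq_mul2r mh orbT.
  rewrite -big_distrl /= in lb.
  set N := \sum_(t <- slots) _ in lb cE; set K := m * D in lb.
  have h3 : N * K < 2 * A.
    have h0 : 0 < need * sz b by rewrite muln_gt0 n0.
    by move: lb WL h0; clear; lia.
  have h4 : (ld - ln) * wl b <= ld * N.
    by rewrite mulnBl; have : ld * wl b <= ld * N + ld * p b; [rewrite -mulnDr leq_mul2l; lia|lia].
  have h5 : (ld - ln) * wl b * K <= ld * (N * K) by rewrite mulnA leq_mul2r h4 orbT.
  have h6 : ld * (N * K) < ld * (2 * A) by rewrite ltn_mul2l ld0.
  move: cap h5 h6; rewrite /K; have -> : 2 * ld * A = ld * (2 * A) by ring.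
  by have -> : (ld - ln) * m * wl b * D = (ld - ln) * wl b * (m * D) ; [ring | lia].
(* Wide case: each of the [N] slots without [b] has twice its load at least m, less 1 if gray, and
   each of the [c] slots with [b] more than 1. With c + need <= p_b <= lam |chi_b| and at most lam
   |chi_b| gray slots, the sum N m + c + need - g is at least (1 - lam) m |chi_b|. *)
have sh : shrunk gr0 F.
  by case: G2 => [[]//|[nb _]|[n00 _]]; [case/negP: wide|lia].
pose g := \sum_(t <- slots) (inw b t && gr0 t).
have gle : ld * g <= ln * wl b.
  rewrite -(sum_window bn); apply: fg => j jp; have [jn jw] := hp j jp.
  case: (sub_or_disjoint jn bn jw) => [/andP[h1 h2]|h]; last by right.
  by left => t; rewrite /inw; lia.
have lb : \sum_(t <- slots) (inw b t && ~~ active ps b t) * (m * D) + c * D <= 2 * L + g * D.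
  rewrite /L LE big_distrr /c /g !big_distrl -!big_split /= big_seq [leqRHS]big_seq.
  apply: leq_sum => t; rewrite mem_slots => ts; case wt: (inw b t) => //=; rewrite mul1n.
  have ok := pg_ok P ts; have gg := sh t ts.
  case at_: (active ps b t) => /=; rewrite mul1n mul0n.
    have [i ri] := active_runs at_; have := load_gt0 ok ri bn.
    by move: wide; rewrite /narrow; lia.
  rewrite addn0; have := full t ts wt.
  rewrite /cond2 (pg_mark P) // at_ andbT -leqNgt => mh.
  have := so_ge ok; case gt: (gray (F t)) => /=; last first.
    rewrite subn0 mul0n addn0 => h; apply: leq_trans (leq_addr _ _).
    by apply: leq_trans h; rewrite leq_mul2r mh orbT.
  rewrite (gg gt) mul1n subn1 => h.
  have : m * D <= (ch (F t)).-1 * D + D by rewrite addnC -mulSn leq_mul2r; lia.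
  lia.
rewrite -big_distrl /= in lb.
set N := \sum_(t <- slots) _ in lb cE.
have h1 : N * (m * D) + c * D + need * D < 2 * A + g * D.
  have : need * D < need * (2 * sz b) by rewrite ltn_mul2l n0; move: wide; rewrite /narrow; lia.
  by move: lb WL; lia.
case: (m) m0 => // m' _ in h1 cap *.
have h2 : wl b * m'.+1 <= N * m'.+1 + c + need + p b * m' by nia.
have h3 : ld * (wl b * m'.+1) <= ld * (N * m'.+1 + c + need) + ln * wl b * m'.
  apply: leq_trans (_ : _ <= ld * (N * m'.+1 + c + need + p b * m')) _.
    by rewrite leq_mul2l h2 orbT.
  by rewrite mulnDr leq_add2l mulnA leq_mul2r [ld * _]mulnC pw orbT.
have h4 : ld * ((N * m'.+1 + c + need) * D) < ld * (2 * A) + ld * (g * D).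
  by rewrite -mulnDr ltn_mul2l ld0 !mulnDl -mulnA.
have h5 : ld * (g * D) <= ln * wl b * D by rewrite mulnA leq_mul2r gle orbT.
have D0 : 0 < D by lia.
have h6 : ld * (N * m'.+1 + c + need) * D <
    ((ld - ln) * m'.+1 * wl b + ln * wl b) * D.
  by move: cap h4 h5; have -> : 2 * ld * A = ld * (2 * A) ; [ring | lia].
rewrite ltn_mul2r D0 /= in h6.
have h7 : (ld - ln) * m'.+1 * wl b = ld * (wl b * m'.+1) - ln * wl b * m' - ln * wl b.
  by rewrite !mulnBl -subnDA; congr (_ - _); ring.
have h8 : ln * wl b * m' + ln * wl b <= ld * (wl b * m'.+1).
  by rewrite mulnS; have : ln * wl b * m'.+1 <= ld * wl b * m'.+1; [rewrite !leq_mul2r lnd !orbT|lia].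
lia.
Qed.

End Slots.

(** * Reasoning about loops *)

Definition frame P (s s' : state) : Prop :=
  (forall x, ~~ wrv P x -> vars s' x = vars s x) /\
  (forall a, ~~ wra P a -> arrs s' a = arrs s a).

Lemma frame_den P s : frame P s (den P s).
Proof. by split => x; [apply: den_var|apply: den_arr]. Qed.

Lemma frame_trans P s1 s2 s3 : frame P s1 s2 -> frame P s2 s3 -> frame P s1 s3.
Proof. by move=> [h1 h2] [h3 h4]; split => x h; rewrite ?h3 ?h4 ?h1 ?h2. Qed.

Lemma frame_sub P Q s s' :
  (forall x, wrv P x -> wrv Q x) -> (forall a, wra P a -> wra Q a) ->
  frame P s s' -> frame Q s s'.
Proof.
move=> h1 h2 [f1 f2]; split => x h; [apply: f1|apply: f2].
  by apply: contra h; apply: h1.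
by apply: contra h; apply: h2.
Qed.

Lemma frame_set_var P s x v : wrv P x -> frame P s (set_var s x v).
Proof.
by move=> w; split => // y wy; rewrite /= /upd; case: eqP wy => // ->; rewrite w.
Qed.

Lemma frame_set_cell P s a i v : wra P a -> frame P s (set_cell s a i v).
Proof.
by move=> w; split => // y wy; rewrite /= /upd; case: eqP wy => // ->; rewrite w.
Qed.

(** The frame relates each intermediate state to the initial one, so that an invariant has to
    mention only what the body changes. *)
Lemma for_ind (I : nat -> state -> Prop) i P s :
  i != 0 -> ~~ wrv P 0 -> ~~ wrv P i ->
  (forall k s' v, I k s' -> I k (set_var s' i v)) -> I 0 s ->
  (forall k s', k < vars s 0 -> vars s' i = k -> frame (PFor i P) s s' ->
     I k s' -> I k.+1 (den P s')) ->
  I (vars s 0) (den (PFor i P) s).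
Proof.
move=> i0 w0 wi Iv I0 step /=; set F := fun s => _.
have: forall k, k <= vars s 0 ->
    [/\ I k (iter k F (set_var s i 0)), vars (iter k F (set_var s i 0)) i = k
      & frame (PFor i P) s (iter k F (set_var s i 0))].
  elim=> [|k IH] le.
    split; [exact: Iv|by rewrite /= /upd eqxx|].
    by apply: frame_set_var; rewrite /= eqxx.
  have [h1 h2 h3] := IH (ltnW le); split; rewrite iterS {1}/F.
  - by apply: Iv; apply: step.
  - by rewrite /= /upd eqxx den_var // h2 addn1.
  apply: frame_trans h3 _; apply: (@frame_trans _ _ (den P (iter k F (set_var s i 0)))).
    by apply: frame_sub (frame_den _ _) => // x /= ->; rewrite orbT.
  by apply: frame_set_var; rewrite /= eqxx.
by move=> /(_ _ (leqnn _)) [].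
Qed.

Lemma den_seq P Q s : den (PSeq P Q) s = den Q (den P s). Proof. by []. Qed.

Lemma den_if e P Q s :
  den (PIf e P Q) s = if eval s e != 0 then den P s else den Q s.
Proof. by []. Qed.

Lemma den_assign x e s : den (PAssign x e) s = set_var s x (eval s e).
Proof. by []. Qed.

Lemma den_put a e f s : den (PPut a e f) s = set_cell s a (eval s e) (eval s f).
Proof. by []. Qed.

Lemma den_skip s : den PSkip s = s. Proof. by []. Qed.

Definition ltE e f := Bin Leq (Bin Add e (Const 1)) f.

Lemma eval_ltE s e f : eval s (ltE e f) = (eval s e < eval s f).
Proof. by rewrite /= addn1. Qed.

Definition nE := Get 0 (Const 1).

(** Every loop runs up to the length of the input; the guard skips the indices that are not jobs. *)
Definition PJ i P := PFor i (PIf (ltE (Var i) nE) P PSkip).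

Lemma forJ_ind (I : nat -> state -> Prop) i P s n :
  i != 0 -> ~~ wrv P 0 -> ~~ wrv P i -> ~~ wra P 0 ->
  arrs s 0 1 = n -> n <= vars s 0 ->
  (forall k s' v, I k s' -> I k (set_var s' i v)) -> I 0 s ->
  (forall k s', k < n -> vars s' i = k -> frame (PJ i P) s s' ->
     I k s' -> I k.+1 (den P s')) ->
  I n (den (PJ i P) s).
Proof.
move=> i0 w0 wi wa En le Iv I0 step.
have := @for_ind (fun k => I (minn k n)) i (PIf (ltE (Var i) nE) P PSkip) s i0.
rewrite (minn_idPr le); apply.
- by rewrite /= orbF.
- by rewrite /= orbF.
- by move=> k s' v; apply: Iv.
- by rewrite min0n.
move=> k s' ks vk fr; have En' : arrs s' 0 1 = n by rewrite fr.2 //= orbF.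
rewrite den_if eval_ltE /= vk En'; case: ltnP => kn /=.
  rewrite (minn_idPl kn); exact: step.
by rewrite (minn_idPr (leqW kn)).
Qed.

(* Runs [body] on all jobs in decreasing order of a key; [better] compares the
   keys of the jobs held by variables [i] and [b], and array [a] records the
   jobs that are done. *)
Definition PSelect a i b better :=
  PSeq (PAssign b nE)
    (PJ i (PIf (ltE (Get a (Var i)) (Const 1))
      (PIf (ltE (Var b) nE) (PIf better (PAssign b (Var i)) PSkip)
        (PAssign b (Var i))) PSkip)).

Definition POrdered a st i b better body :=
  PJ st (PSeq (PSelect a i b better)
    (PSeq (PPut a (Var b) (Const 1)) body)).

Lemma uniq_size_not_full n (s : seq nat) : uniq s -> {in s, forall j, j < n} ->
  size s < n -> exists2 j, j < n & j \notin s.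
Proof.
move=> us sn lt.
have [|h] := boolP (has (fun j => j \notin s) (iota 0 n)).
  by case/hasP => j; rewrite mem_iota add0n => /andP[_ jn] js; exists j.
suff: n <= size s by rewrite leqNgt lt.
rewrite -(size_iota 0 n); apply: uniq_leq_size; first exact: iota_uniq.
move=> j jn; apply/negPn/negP => js; case/negP: h; apply/hasP.
by exists j.
Qed.

Section Ordered.

Variables (n : nat) (key : nat -> rat) (a st i b : nat) (better : expr) (body : prog).
Variable s0 : state.
Let PO := POrdered a st i b better body.

Hypotheses (i0 : i != 0) (b0 : b != 0) (st0 : st != 0) (a0 : a != 0).
Hypotheses (ib : i != b) (sti : st != i) (stb : st != b).
Hypotheses (w0 : ~~ wrv body 0) (wst : ~~ wrv body st).
Hypotheses (wa0 : ~~ wra body 0) (wa : ~~ wra body a).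
Hypothesis (En : arrs s0 0 1 = n) (le : n <= vars s0 0).
Hypothesis betterP : forall s, frame PO s0 s -> vars s i < n -> vars s b < n ->
  (eval s better != 0) = (key (vars s b) < key (vars s i))%R.

Lemma wra_PO0 : wra PO 0 = false.
Proof. by rewrite /PO /= eq_sym (negPf a0) (negPf wa0). Qed.

Lemma wrv_PO0 : wrv PO 0 = false.
Proof.
rewrite /PO /= (negPf w0) !orbF ![0 == _]eq_sym.
by rewrite (negPf i0) (negPf b0) (negPf st0).
Qed.

Lemma POE x : [|| x == st, x == i, x == b | wrv body x] -> wrv PO x.
Proof. by rewrite /PO /=; case: (x == st); case: (x == i); case: (x == b); rewrite ?orbT ?orbF. Qed.

Lemma select_best (sg : seq nat) s : frame PO s0 s -> uniq sg ->
  {in sg, forall j, j < n} -> size sg < n ->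
  (forall j, j < n -> (arrs s a j != 0) = (j \in sg)) ->
  let s' := den (PSelect a i b better) s in
  [/\ vars s' b < n, vars s' b \notin sg
    & forall j, j < n -> j \notin sg -> (key j <= key (vars s' b))%R].
Proof.
move=> fr us sn lt done s'.
pose t := set_var s b (eval s nE).
have Es : arrs s 0 1 = n by rewrite fr.2 // wra_PO0.
have frt : frame PO s0 t.
  by apply: frame_trans fr _; apply: frame_set_var; apply: POE; rewrite eqxx !orbT.
(* The value [n] in variable [b] means that there is no candidate yet; at the end it is excluded
   because some job is still to be done. *)
pose I k (u : state) := (vars u b = n /\ forall j, j < k -> j \in sg) \/
  [/\ vars u b < n, vars u b \notin sg
    & forall j, j < k -> j \notin sg -> (key j <= key (vars u b))%R].
have : I n s'.
  rewrite /s' /PSelect den_seq den_assign -/t; apply: (@forJ_ind I i _ t n) => //.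
  - by rewrite /= ![0 == _]eq_sym (negPf b0).
  - by rewrite /= (negPf ib).
  - by have := frt.1 0; rewrite wrv_PO0 => ->.
  - move=> k u v; rewrite /I /= /upd [b == i]eq_sym (negPf ib); exact.
  - by left; rewrite /t /= /upd eqxx Es.
  move=> k u kn ui fru.
  have fr0 : frame PO s0 u.
    apply: frame_trans frt _; apply: frame_sub fru.
      by move=> x h; apply: POE; move: h => /=; rewrite !orbF; case: (x == i);
        case: (x == b); rewrite ?orbT ?orbF.
    by [].
  have Ea : arrs u a = arrs s a by rewrite fru.2.
  have Eu : arrs u 0 1 = n by rewrite fr0.2 // wra_PO0.
  rewrite !den_if !eval_ltE /= ui Ea Eu.
  have dk := done _ kn; case sk: (arrs s a k) dk => [|v] /= ks; last first.
    case=> [[ub h]|[h1 h2 h3]]; [left|right].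
      by split => // j; rewrite ltnS leq_eqVlt => /predU1P[->|/h].
    by split => // j; rewrite ltnS leq_eqVlt => /predU1P[->|/h3//]; rewrite -ks.
  have new c : (forall j, j < k -> j \notin sg -> (key j <= key k)%R) -> c = k ->
      I k.+1 (set_var u b c).
    move=> h ->; right; rewrite /= /upd eqxx; split => //; first by rewrite -ks.
    by move=> j; rewrite ltnS leq_eqVlt => /predU1P[->|/h].
  case=> [[ub h]|[h1 h2 h3]].
    by rewrite ub ltnn /=; apply: new => // j /h ->.
  rewrite h1 /= betterP ?ui //; case: ltrP => kk; last first.
    by right; split => // j; rewrite ltnS leq_eqVlt => /predU1P[->|/h3].
  by apply: new => // j jk js; apply: le_trans (h3 _ jk js) (ltW kk).
case=> [[_ h]|//].
have [j jn js] := uniq_size_not_full us sn lt.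
by rewrite (h j jn) in js.
Qed.

(** Shared by the two phases: repeated extraction of a best job becomes an induction along a sorted
    list of all jobs, where [sg] holds those already treated. *)
Lemma ordered_ind (I : seq nat -> state -> Prop) :
  (forall j, j < n -> arrs s0 a j = 0) ->
  (forall sg s x v, (x == st) || (x == i) || (x == b) -> I sg s -> I sg (set_var s x v)) ->
  (forall sg s j v, I sg s -> I sg (set_cell s a j v)) ->
  I [::] s0 ->
  (forall sg s, frame PO s0 s -> vars s b < n -> uniq sg -> {in sg, forall j, j < n} ->
     vars s b \notin sg -> {in sg, forall j, key (vars s b) <= key j}%R ->
     I sg s -> I (rcons sg (vars s b)) (den body s)) ->
  exists sg, [/\ perm_eq sg (iota 0 n), pairwise (fun i j => key j <= key i)%R sg
    & I sg (den PO s0)].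
Proof.
move=> d0 Iv Ia I0 step.
pose J k s := exists sg, [/\ [/\ size sg = k, uniq sg & {in sg, forall j, j < n}],
  pairwise (fun i j => key j <= key i)%R sg,
  forall j, j < n -> (arrs s a j != 0) = (j \in sg),
  forall j l, j \in sg -> l < n -> l \notin sg -> (key l <= key j)%R & I sg s].
have : J n (den PO s0).
  apply: (@forJ_ind J st _ s0 n) => //.
  - by rewrite /= (negPf w0) ![0 == _]eq_sym (negPf b0) (negPf i0).
  - by rewrite /= (negPf sti) (negPf stb) (negPf wst).
  - by rewrite /= (negPf wa0) eq_sym (negPf a0).
  - move=> k s v [sg [h1 h2 h3 h4 h5]]; exists sg; split => //.
    by apply: Iv => //; rewrite eqxx.
  - exists [::]; split => // j jn; by rewrite d0.
  move=> k s kn _ fr [sg [[h1 us sn] h2 h3 h4 h5]].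
  rewrite den_seq.
  have sk : size sg < n by rewrite h1.
  have [] := select_best fr us sn sk h3.
  have frs : frame (PSelect a i b better) s (den (PSelect a i b better) s) := frame_den _ _.
  have Is : I sg (den (PSelect a i b better) s).
    rewrite /PSelect den_seq den_assign.
    apply: (@forJ_ind (fun _ => I sg) i _ _ n) => //.
    - by rewrite /= ![0 == _]eq_sym (negPf b0).
    - by rewrite /= (negPf ib).
    - by rewrite /= fr.2 // wra_PO0.
    - by rewrite /= /upd eq_sym (negPf b0) fr.1 // wrv_PO0.
    - by move=> _ u v; apply: Iv; rewrite eqxx orbT.
    - by apply: Iv => //; rewrite eqxx !orbT.
    move=> k' u _ _ _ Iu; rewrite !den_if den_assign den_skip.
    by do ?case: ifP => _ //; apply: Iv => //; rewrite eqxx !orbT.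
  set s' := den (PSelect a i b better) s in frs Is *; move=> bn bs bmax; clearbody s'.
  rewrite den_seq den_put.
  have frs0 : frame PO s0 s'.
    apply: frame_trans fr _; apply: frame_sub frs => //.
    by move=> x h; apply: POE; move: h => /=; rewrite !orbF; case: (x == i);
        case: (x == b); rewrite ?orbT ?orbF.
  have E : vars (set_cell s' a (vars s' b) 1) b = vars s' b by [].
  exists (rcons sg (vars s' b)); split.
  - split; rewrite ?size_rcons ?h1 ?rcons_uniq ?bs //.
    by move=> j; rewrite mem_rcons inE => /predU1P[->//|/sn].
  - rewrite pairwise_rcons h2 andbT; apply/allP => j js /=; exact: h4.
  - move=> j jn; rewrite den_arr // /= /upd eqxx mem_rcons inE.
    by case: (j == vars s' b); rewrite //= frs.2 // h3.
  - move=> j l; rewrite !mem_rcons !inE negb_or => /predU1P[->|js] ln /andP[_ ls].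
      exact: bmax.
    exact: h4.
  apply: (step sg (set_cell s' a (vars s' b) 1)) => //.
  - by apply: frame_trans frs0 _; apply: frame_set_cell; rewrite /PO /= eqxx.
  - by move=> j js; apply: h4.
  exact: Ia.
move=> [sg [[h1 us sn] h2 _ _ h5]]; exists sg; split => //.
apply: uniq_perm => //; first exact: iota_uniq.
have [] := uniq_min_size us _ (_ : size (iota 0 n) <= size sg) => //.
  by move=> j /sn; rewrite mem_iota add0n.
by rewrite size_iota h1.
Qed.

End Ordered.

(** * The selection phase *)

(* Variables: vD the common denominator of the requirements, vJm the job with
   the largest p_j / |chi_j|, vC the capacity factor in the acceptance test,
   vBest the current job, vN the number of cells, vNeed the number of slots
   that the current job still lacks.  Arrays: aSz the requirements times vD;
   cell number k consists of the slots aA[k], ..., aB[k] - 1, whose state is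
   held in aH, aU, aG and aM. *)
Notation vD := 2 (only parsing).
Notation vJm := 3 (only parsing).
Notation vC := 4 (only parsing).
Notation vStep := 5 (only parsing).
Notation vBest := 6 (only parsing).
Notation vI := 7 (only parsing).
Notation vK := 8 (only parsing).
Notation vI2 := 9 (only parsing).
Notation vAcc := 10 (only parsing).
Notation vOk := 11 (only parsing).
Notation vN := 12 (only parsing).
Notation vNeed := 13 (only parsing).
Notation vHost := 14 (only parsing).
Notation vCut := 15 (only parsing).
Notation aSz := 2 (only parsing).
Notation aDone := 3 (only parsing).
Notation aSel := 4 (only parsing).
Notation aDone2 := 5 (only parsing).
Notation aA := 6 (only parsing).
Notation aB := 7 (only parsing).
Notation aH := 8 (only parsing).
Notation aU := 9 (only parsing).
Notation aG := 10 (only parsing).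
Notation aM := 11 (only parsing).

Definition addE := Bin Add.
Definition subE := Bin Defs.Sub.
Definition mulE := Bin Mul.
Definition divE := Bin Div.
Definition leE := Bin Leq.
(** An encoded job takes seven cells, and the jobs start at cell 2, after the horizon and the number
    of jobs. *)
Definition fldE k v := Get 0 (addE (Const k) (mulE (Const 7) (Var v))).
Definition rE := fldE 2.
Definition dE := fldE 3.
Definition pE := fldE 4.
Definition snE := fldE 5.
Definition sdE := fldE 6.
Definition wnE := fldE 7.
Definition wdE := fldE 8.
Definition wlE v := addE (subE (dE v) (rE v)) (Const 1).
Definition szE v := Get aSz (Var v).

Definition Emit e := PSeq (PPut 1 (Var 1) e) (PAssign 1 (addE (Var 1) (Const 1))).

Lemma output_emit e s : output (den (Emit e) s) = rcons (output s) (eval s e).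
Proof.
rewrite /output /= /upd /= addn1 mkseqS eqxx; congr rcons.
by apply/eq_in_map => i; rewrite mem_iota add0n => /andP[_ ?]; rewrite ltn_eqF.
Qed.

Lemma big_iotaS (k : nat) (P : pred nat) (F : nat -> nat) :
  \sum_(j <- iota 0 k.+1 | P j) F j =
  \sum_(j <- iota 0 k | P j) F j + (if P k then F k else 0).
Proof. by rewrite -addn1 iotaD big_cat /= big_cons big_nil add0n; case: (P k); rewrite ?addn0. Qed.

Lemma all_iotaS (k : nat) (P : pred nat) :
  all P (iota 0 k.+1) = all P (iota 0 k) && P k.
Proof. by rewrite -[k.+1]addn1 iotaD all_cat /= andbT. Qed.

(** The product of all denominators serves as the common one: its length is at most the sum of
    theirs. In each product the left factor is the short one, as [oke] demands. *)
Definition PInit m :=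
  PSeq (PAssign vD (Const 1))
  (PSeq (PJ vI (PAssign vD (mulE (sdE vI) (Var vD))))
  (PSeq (PJ vI (PPut aSz (Var vI) (mulE (snE vI) (divE (Var vD) (sdE vI)))))
  (PSeq (PJ vI (PIf (ltE (mulE (pE vJm) (wlE vI)) (mulE (pE vI) (wlE vJm)))
           (PAssign vJm (Var vI)) PSkip))
        (PAssign vC (mulE (subE (wlE vJm) (pE vJm)) (mulE (Const m) (Var vD))))))).

(** Products of truth values act as conjunctions. *)
Definition PArea :=
  PSeq (PAssign vAcc (Const 0))
    (PJ vI2 (PIf (mulE (ltE (Const 0) (Get aSel (Var vI2)))
                    (mulE (leE (rE vK) (rE vI2)) (leE (dE vI2) (dE vK))))
      (PAssign vAcc (addE (Var vAcc) (mulE (pE vI2) (szE vI2)))) PSkip)).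

Definition PCheck :=
  PSeq (PAssign vOk (Const 1))
    (PJ vK (PSeq PArea
      (PIf (leE (mulE (Const 2) (mulE (wlE vJm) (Var vAcc))) (mulE (wlE vK) (Var vC)))
        PSkip (PAssign vOk (Const 0))))).

Definition PAccept :=
  PSeq (PPut aSel (Var vBest) (Const 1))
  (PSeq PCheck
    (PIf (Var vOk) (Emit (Var vBest)) (PPut aSel (Var vBest) (Const 0)))).

Definition densityE :=
  ltE (mulE (mulE (wnE vBest) (wdE vI)) (mulE (mulE (pE vI) (snE vI)) (sdE vBest)))
      (mulE (mulE (wnE vI) (wdE vBest)) (mulE (mulE (pE vBest) (snE vBest)) (sdE vI))).

(** The output starts at cell 1: cell 0 is reserved for the number of selected jobs, known only at
    the end. *)
Definition PSel :=
  PSeq (PAssign 1 (Const 1))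
  (PSeq (POrdered aDone vStep vI vBest densityE PAccept)
        (PPut 1 (Const 0) (subE (Var 1) (Const 1)))).

Section Input.

Variables (X : nat -> nat) (l m : nat).
Let n := X 1.
Let T := X 0.
Definition rl j := X (2 + 7 * j).
Definition dl j := X (3 + 7 * j).
Definition pl j := X (4 + 7 * j).
Definition sn j := X (5 + 7 * j).
Definition sd j := X (6 + 7 * j).
Definition wn j := X (7 + 7 * j).
Definition wd j := X (8 + 7 * j).
Definition wlj j := dl j - rl j + 1.
Definition Dv := \prod_(0 <= j < n) sd j.
Definition szv j := sn j * (Dv %/ sd j).
Definition av j := pl j * szv j.

Hypothesis nl : n <= l.

Definition env s := arrs s 0 = X /\ vars s 0 = l.

Lemma env_frame P s s' : frame P s s' -> env s -> ~~ wrv P 0 -> ~~ wra P 0 -> env s'.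
Proof. by move=> [f1 f2] [e1 e2] h1 h2; split; rewrite ?f1 ?f2. Qed.

Lemma env_den P s : env s -> ~~ wrv P 0 -> ~~ wra P 0 -> env (den P s).
Proof. exact: env_frame (frame_den _ _). Qed.

Lemma env_n s : env s -> arrs s 0 1 = n.
Proof. by case=> ->. Qed.

Lemma env_nl s : env s -> n <= vars s 0.
Proof. by case=> _ ->. Qed.

Lemma PInitP s : env s -> vars s vJm = 0 ->
  (forall j, j < n -> 0 < wlj j) ->
  let s' := den (PInit m) s in let jm := vars s' vJm in
  [/\ vars s' vD = Dv, forall j, j < n -> arrs s' aSz j = szv j,
      vars s' vC = (wlj jm - pl jm) * (m * Dv), 0 < n -> jm < n
    & forall j, j < n -> pl j * wlj jm <= pl jm * wlj j].
Proof.
move=> E J0 wl0; rewrite /PInit !den_seq.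
set P4 := PJ _ (PIf _ _ _); set P3 := PJ _ (PPut _ _ _); set P2 := PJ _ _.
set s1 := den (PAssign vD _) s; set s2 := den P2 s1; set s3 := den P3 s2.
set s4 := den P4 s3.
have E1 : env s1 by [].
have E2 : env s2 := env_den (P:=P2) E1 isT isT.
have E3 : env s3 := env_den (P:=P3) E2 isT isT.
have E4 : env s4 := env_den (P:=P4) E3 isT isT.
have D2 : vars s2 vD = Dv.
  apply: (@forJ_ind (fun k u => vars u vD = \prod_(0 <= j < k) sd j) vI _ s1 n) => //.
  - exact: env_n E1.
  - exact: env_nl E1.
  - by rewrite /s1 /= big_geq.
  move=> k u kn uk fr h; rewrite /= big_nat_recr //= mulnC -h /upd /= uk.
  by have [-> _] := env_frame fr E1 isT isT.
have S3 : forall j, j < n -> arrs s3 aSz j = szv j.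
  apply: (@forJ_ind (fun k u => forall j, j < k -> arrs u aSz j = szv j) vI _ s2 n) => //.
  - exact: env_n E2.
  - exact: env_nl E2.
  move=> k u kn uk fr h j; rewrite /= /upd /= uk; case: eqP => [-> _|ne jk].
    by rewrite fr.1 // D2; have [-> _] := env_frame fr E2 isT isT.
  by apply: h; lia.
have D3 : vars s3 vD = Dv by rewrite /s3 den_var.
have J3 : vars s3 vJm = 0 by rewrite /s3 den_var // /s2 den_var.
have [jn4 J4] : (0 < n -> vars s4 vJm < n) /\
    forall j, j < n -> pl j * wlj (vars s4 vJm) <= pl (vars s4 vJm) * wlj j.
  apply: (@forJ_ind (fun k u => (0 < n -> vars u vJm < n) /\
    forall j, j < k -> pl j * wlj (vars u vJm) <= pl (vars u vJm) * wlj j) vI _ s3 n) => //.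
  - exact: env_n E3.
  - exact: env_nl E3.
  - by rewrite J3.
  move=> k u kn uk fr [hn h]; have [X0 _] := env_frame fr E3 isT isT.
  have jn : vars u vJm < n by apply: hn; lia.
  rewrite den_if eval_ltE /= uk X0 -/(rl k) -/(dl k) -/(pl k) -/(wlj k).
  rewrite -/(rl (vars u vJm)) -/(dl (vars u vJm)) -/(pl (vars u vJm)) -/(wlj (vars u vJm)).
  case: (ltnP (pl (vars u vJm) * wlj k)) => lt /=; last first.
    split=> // j; rewrite ltnS leq_eqVlt => /predU1P[->|/h] //.
  split=> [_|j]; rewrite /upd /= // ltnS leq_eqVlt => /predU1P[->//|jk].
  have := h _ jk; have := wl0 _ jn; have := wl0 _ (ltn_trans jk kn).
  move: lt; set a := pl j; set b := pl k; set c := pl _; set wa := wlj j.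
  set wb := wlj k; set wc := wlj _ => h1 h2 h3 h4.
  rewrite -(leq_pmul2r h3).
  have : a * wc * wb <= c * wa * wb by rewrite leq_mul2r h4 orbT.
  have : c * wb * wa <= b * wc * wa by rewrite leq_mul2r (ltnW h1) orbT.
  rewrite ![_ * _ * wa]mulnAC ![_ * _ * wb]mulnAC.
  lia.
have D4 : vars s4 vD = Dv by rewrite /s4 den_var.
split => //.
- by rewrite /= /s4 den_arr // /s3 S3.
- by rewrite /= /upd /= D4; case: E4 => ->.
Qed.

Lemma PAreaP s (G : seq nat) : env s -> (forall j, j < n -> arrs s aSel j = (j \in G)) ->
  (forall j, j < n -> arrs s aSz j = szv j) ->
  vars (den PArea s) vAcc =
  \sum_(j <- iota 0 n | (j \in G) && subw rl dl j (vars s vK)) av j.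
Proof.
move=> E S Z; rewrite /PArea den_seq.
set s1 := den _ s; have E1 : env s1 by [].
apply: (@forJ_ind (fun k u => vars u vAcc =
  \sum_(j <- iota 0 k | (j \in G) && subw rl dl j (vars s vK)) av j) vI2 _ s1 n) => //.
- exact: env_n E1.
- exact: env_nl E1.
- by rewrite /= big_nil.
move=> k u kn uk fr h; have [X0 _] := env_frame fr E1 isT isT.
have K : vars u vK = vars s vK by rewrite fr.1.
have Sk : arrs u aSel k = (k \in G) by rewrite fr.2 //= S.
have Zk : arrs u aSz k = szv k by rewrite fr.2 //= Z.
rewrite den_if big_iotaS /subw; move: h K Sk Zk X0 uk => /= h -> + + -> ->.
rewrite -/(rl k) -/(dl k) -/(rl (vars s vK)) -/(dl (vars s vK)) -/(pl k) => -> ->.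
have -> (b1 b2 b3 : bool) : ((0 + 1 <= b1) * (b2 * b3) != 0) = [&& b1, b2 & b3].
  by case: b1; case: b2; case: b3.
by case: ifP => _; rewrite ?addn0 /= /upd /= h.
Qed.

Lemma PCheckP s (G : seq nat) : env s -> (forall j, j < n -> arrs s aSel j = (j \in G)) ->
  (forall j, j < n -> arrs s aSz j = szv j) ->
  uniq G -> {in G, forall j, j < n} ->
  (vars (den PCheck s) vOk != 0) =
  within n rl dl av (2 * wlj (vars s vJm)) (fun k => wlj k * vars s vC) G.
Proof.
move=> E S Z uG Gn; rewrite /PCheck den_seq /within.
set s1 := den _ s; have E1 : env s1 by [].
apply: (@forJ_ind (fun k u => (vars u vOk != 0) = all (fun k => 
   2 * wlj (vars s vJm) * area rl dl av G k <= wlj k * vars s vC) (iota 0 k)) vK _ s1 n) => //.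
- exact: env_n E1.
- exact: env_nl E1.
move=> k u kn uk fr h; have Eu := env_frame fr E1 isT isT.
rewrite den_seq all_iotaS -h.
have := @PAreaP u G Eu _ _; set v := den PArea u => Av.
have Ev : env v := env_den (P:=PArea) Eu isT isT.
have [X0 _] := Ev.
have Kv : vars v vK = k by rewrite /v den_var.
have Jv : vars v vJm = vars s vJm by rewrite /v den_var // fr.1.
have Cv : vars v vC = vars s vC by rewrite /v den_var // fr.1.
have Ov : vars v vOk = vars u vOk by rewrite /v den_var.
clearbody v; rewrite den_if /= Kv Jv Cv X0 -/(rl k) -/(dl k) -/(rl (vars s vJm)) -/(dl (vars s vJm)).
rewrite -/(wlj k) -/(wlj (vars s vJm)) mulnA.
have -> : vars v vAcc = area rl dl av G k.
  rewrite Av ?uk; first by rewrite /area (sum_seq_iota _ _ uG Gn).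
  - by move=> j jn; rewrite fr.2 //= S.
  by move=> j jn; rewrite fr.2 //= Z.
by case: (_ <= _) => /=; rewrite ?andbT ?andbF ?Ov.
Qed.

Section Accept.

Variables (c1 : nat) (cap : nat -> nat).
Local Notation step := (greedy_step n rl dl av c1 cap).

Lemma PAcceptP s x0 (G : seq nat) : env s ->
  (forall j, j < n -> arrs s aSel j = (j \in G)) ->
  (forall j, j < n -> arrs s aSz j = szv j) ->
  uniq G -> {in G, forall j, j < n} -> vars s vBest < n -> vars s vBest \notin G ->
  c1 = 2 * wlj (vars s vJm) -> cap = (fun k => wlj k * vars s vC) ->
  output s = x0 :: G ->
  let s' := den PAccept s in let G' := step G (vars s vBest) in
  output s' = x0 :: G' /\ forall j, j < n -> arrs s' aSel j = (j \in G').
Proof.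
move=> E S Z uG Gn bn nb Ec Ecap O; rewrite /PAccept den_seq den_put den_seq.
set b := vars s vBest in bn nb *; set s1 := set_cell _ _ _ _.
have E1 : env s1 by [].
have S1 j : j < n -> arrs s1 aSel j = (j \in rcons G b).
  by move=> jn; rewrite /= /upd /= mem_rcons inE; case: (j == _) => //=; rewrite S.
have Gn1 : {in rcons G b, forall j, j < n}.
  by move=> j; rewrite mem_rcons inE => /predU1P[->|/Gn].
have uG1 : uniq (rcons G b) by rewrite rcons_uniq nb.
have := PCheckP E1 S1 Z uG1 Gn1; set s2 := den PCheck s1 => h.
have b2 : vars s2 vBest = b by rewrite /s2 den_var.
have O2 : output s2 = x0 :: G by rewrite -O /output /s2 den_arr // den_var.
have S2 : arrs s2 aSel = arrs s1 aSel by rewrite /s2 den_arr.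
clearbody s2; rewrite den_if [eval _ _]/= h /greedy_step Ec Ecap.
case: ifP => _.
  rewrite output_emit O2 rcons_cons /= b2; split => // j jn.
  by rewrite /upd /= S2 S1.
split; first by rewrite -O2.
move=> j jn; rewrite den_put /= /upd /= b2 S2; case: eqP => [->|ne].
  by rewrite (negPf nb).
by rewrite /= /upd /= -/b; case: eqP => // _; rewrite S.
Qed.

(** The density w / (s p), for w = wn / wd and s = sn / sd. *)
Definition key j : rat := ((wn j * sd j)%:R / (wd j * (pl j * sn j))%:R)%R.

Hypothesis pos : forall j, j < n -> [/\ 0 < pl j, 0 < sn j, 0 < sd j & 0 < wd j].

Lemma densityP s : env s -> vars s vI < n -> vars s vBest < n ->
  (eval s densityE != 0) = (key (vars s vBest) < key (vars s vI))%R.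
Proof.
move=> [X0 _]; rewrite /densityE eval_ltE /= X0.
set i := vars s vI; set b := vars s vBest => iN bN.
rewrite -/(wn b) -/(wn i) -/(wd b) -/(wd i) -/(pl b) -/(pl i) -/(sn b) -/(sn i) -/(sd b) -/(sd i).
have [p1 p2 p3 p4] := pos iN; have [q1 q2 q3 q4] := pos bN.
rewrite /key ltr_pdivrMr ?ltr0n ?muln_gt0 ?q1 ?q2 ?q4 //.
rewrite mulrAC ltr_pdivlMr ?ltr0n ?muln_gt0 ?p1 ?p2 ?p4 // -!natrM ltr_nat.
rewrite eqb0 negbK; congr (_ < _); ring.
Qed.

Lemma PSelP s : env s -> (forall j, j < n -> arrs s aDone j = 0) ->
  (forall j, j < n -> arrs s aSel j = 0) ->
  (forall j, j < n -> arrs s aSz j = szv j) -> arrs s 1 0 = 0 ->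
  c1 = 2 * wlj (vars s vJm) -> cap = (fun k => wlj k * vars s vC) ->
  let s' := den PSel s in
  exists sg, let G := greedy n rl dl av c1 cap sg in
  [/\ perm_eq sg (iota 0 n), pairwise (fun i j => key j <= key i)%R sg,
      output s' = size G :: G & forall j, j < n -> arrs s' aSel j = (j \in G)].
Proof.
move=> E d0 S0 Z o0 Ec Ecap; rewrite /PSel !den_seq den_assign.
set s1 := set_var _ _ _; have E1 : env s1 by [].
set P := POrdered _ _ _ _ _ _; set s2 := den P s1.
pose I sg (u : state) := output u = 0 :: greedy n rl dl av c1 cap sg /\
  forall j, j < n -> arrs u aSel j = (j \in greedy n rl dl av c1 cap sg).
have [||||sg [h1 h2 [h3 h4]]] := @ordered_ind n key aDone vStep vI vBest densityE
    PAccept s1 isT isT isT isT isT isT isT isT isT isT isT (env_n E1) (env_nl E1)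
    (fun u fr => @densityP u (env_frame fr E1 isT isT)) I d0.
- by move=> sg u x v /orP[/orP[]|] /eqP-> [].
- by move=> sg u j v [].
- by split => //; rewrite /output /mkseq /= o0.
- move=> sg u fr bn us sn nb _ [h1 h2]; rewrite /I greedy_rcons.
  apply: PAcceptP => //.
  + exact: env_frame fr E1 isT isT.
  + by move=> j jn; rewrite fr.2 //= Z.
  + exact: subseq_uniq (greedy_subseq _ _ _ _ _ _ _) us.
  + by move=> j /(mem_subseq (greedy_subseq _ _ _ _ _ _ _)) /sn.
  + by apply: contra nb; apply: mem_subseq; apply: greedy_subseq.
  + by rewrite fr.1.
  + by rewrite Ecap fr.1.
exists sg; rewrite -/P -/s2 in h3 h4; clearbody s2.
set G := greedy _ _ _ _ _ _ _ in h3 h4 *; split => //.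
rewrite den_put; have v1 : vars s2 1 = (size G).+1.
  by rewrite -[LHS](size_mkseq (arrs s2 1)) -/(output s2) h3.
have := h3; rewrite /output /= v1 subn1 /= !/mkseq /= => -[_ e].
rewrite {1}/upd /=; congr (_ :: _); rewrite -[RHS]e.
by apply/eq_in_map => i; rewrite mem_iota /upd /=; case: i.
Qed.

End Accept.

End Input.

(** * Cells *)

Definition cellE a := Get a (Var vK).

(** The right part becomes a new cell at the end of the list, so no index shifts and the loop in
    progress continues with the left part. The old right end is copied before it is overwritten. *)
Definition PSplit :=
  PSeq (PPut aA (Var vN) (Var vCut))
  (PSeq (PPut aB (Var vN) (cellE aB))
  (PSeq (PPut aH (Var vN) (cellE aH))
  (PSeq (PPut aU (Var vN) (cellE aU))
  (PSeq (PPut aG (Var vN) (cellE aG))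
  (PSeq (PPut aM (Var vN) (cellE aM))
  (PSeq (PPut aB (Var vK) (Var vCut))
        (PAssign vN (addE (Var vN) (Const 1))))))))).

Definition PCut :=
  PFor vK (PIf (mulE (ltE (cellE aA) (Var vCut)) (ltE (Var vCut) (cellE aB)))
    PSplit PSkip).

(** The initial load [vD] is fictitious: it keeps the slots from being gray before any narrow job is
    placed. Cells are half-open, so windows are cut off at their deadline plus one. *)
Definition PCells :=
  PSeq (PPut aA (Const 0) (Const 1))
  (PSeq (PPut aB (Const 0) (addE (Get 0 (Const 0)) (Const 1)))
  (PSeq (PPut aG (Const 0) (Var vD))
  (PSeq (PAssign vN (Const 1))
    (PJ vI (PSeq (PAssign vCut (rE vI)) (PSeq PCut
           (PSeq (PAssign vCut (addE (dE vI) (Const 1))) PCut))))))).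

Definition incell (s : state) k t := arrs s aA k <= t < arrs s aB k.
Definition cellof (s : state) k :=
  Cell (arrs s aH k) (arrs s aU k) (arrs s aG k) (arrs s aM k).
Definition crosses (s : state) k c := arrs s aA k < c < arrs s aB k.

Lemma den_split s : vars s vK < vars s vN ->
  let s' := den PSplit s in let N := vars s vN in let c := vars s vCut in
  let k := vars s vK in
  [/\ forall j, arrs s' aA j = if j == N then c else arrs s aA j,
      forall j, arrs s' aB j = if j == k then c else if j == N then arrs s aB k else arrs s aB j,
      forall j, cellof s' j = if j == N then cellof s k else cellof s j
    & vars s' vN = N.+1].
Proof.
move=> lt s' N c k; rewrite /s' /PSplit !den_seq !den_put den_assign.
have kN : (k == N) = false by rewrite ltn_eqF.
split=> [j|j|j|]; rewrite /cellof /= /upd /= -?/N -?/c -?/k ?eqxx ?addn1 //.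
by case: (j == N).
Qed.

Section Repr.

Variables (X : nat -> nat) (l : nat).
Let n := X 1.
Let T := X 0.
Local Notation rl := (rl X).
Local Notation dl := (dl X).
Local Notation pl := (pl X).
Local Notation env := (env X l).
Local Notation slot_in := (slot_in T).

Hypothesis nl : n <= l.

(** [F] gives the state of each single slot; with an exponential horizon it exists only in the
    proof, and the cells are its compressed form. *)
Record repr s (F : nat -> cellst) : Prop := Repr {
  rp_in : forall k t, incell s k t -> [/\ slot_in t, F t = cellof s k & k < vars s vN];
  rp_cov : forall t, slot_in t -> exists k, incell s k t;
  rp_dis : forall k k' t, incell s k t -> incell s k' t -> k = k' }.

Lemma crosses_incell s k c : crosses s k c -> incell s k c.
Proof. by rewrite /crosses /incell => /andP[/ltnW-> ->]. Qed.

Lemma crosses_uniq s F k k' c : repr s F -> crosses s k c -> incell s k' c -> k = k'.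
Proof. by move=> R /crosses_incell h1 h2; apply: (rp_dis R h1 h2). Qed.

Lemma split_repr s F : repr s F -> crosses s (vars s vK) (vars s vCut) ->
  let s' := den PSplit s in
  [/\ repr s' F, forall c k, crosses s' k c -> exists k', crosses s k' c
    & forall k, ~~ crosses s' k (vars s vCut)].
Proof.
move=> R cr s'; have kN : vars s vK < vars s vN.
  by have [] := rp_in R (crosses_incell cr).
have [hA hB hC hN] := den_split kN; rewrite -/s' in hA hB hC hN.
move: kN hA hB hC hN cr; set N := vars s vN; set k := vars s vK; set c := vars s vCut.
move=> kN hA hB hC hN cr; have nk : (N == k) = false by rewrite gtn_eqF.
have inE' j t : incell s' j t = if j == N then (c <= t) && incell s k t
    else if j == k then (t < c) && incell s k t else incell s j t.
  rewrite /incell hA hB; move: cr; rewrite /crosses.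
  case: (j =P N) => [->|_]; first by rewrite nk; lia.
  by case: (j =P k) => [->|//]; lia.
have noN t : ~~ incell s N t by apply/negP => /(rp_in R)[_ _]; rewrite ltnn.
split.
- split=> [j t|t ts|j j' t].
  + rewrite inE' hC hN; case: (j =P N) => [->|_]; first by case/andP => _ /(rp_in R)[].
    case: (j =P k) => [->|_]; first by case/andP => _ /(rp_in R)[? ? ?]; split => //; lia.
    by move=> /(rp_in R)[? ? ?]; split => //; lia.
  + have [j jt] := rp_cov R ts; case: (j =P k) jt => [->|/eqP ne] jt.
      case: (ltnP t c) => tc; [exists k|exists N]; rewrite inE' ?eqxx ?tc //.
      by rewrite eq_sym nk.
    exists j; rewrite inE' (negPf ne) ifF //; apply/negP => /eqP jN.
    by move: jt; rewrite jN (negPf (noN t)).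
  have D := rp_dis R.
  rewrite !inE'.
  case: (boolP (j == N)) => /eqP jN; case: (boolP (j' == N)) => /eqP j'N;
  case: (boolP (j == k)) => /eqP jk; case: (boolP (j' == k)) => /eqP j'k;
  first [lia | by move=> /andP[_ h1] h2; have := D _ _ _ h1 h2; lia
    | by move=> h1 /andP[_ h2]; have := D _ _ _ h1 h2; lia | exact: D].
- move=> c' j; rewrite /crosses hA hB; move: cr; rewrite /crosses.
  case: (j =P N) => [->|_] cr h; last by exists j; move: h; case: eqP => [->|//]; lia.
  by exists k; move: h; rewrite nk; lia.
move=> j; rewrite /crosses hA hB; case: (j =P N) => [->|_]; first by rewrite nk ltnn.
case: (j =P k) => [_|ne]; first by rewrite ltnn andbF.
apply/negP => h; case: ne; exact: (crosses_uniq R h (crosses_incell cr)).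
Qed.

Lemma PCutP s F : env s -> repr s F -> vars s vN < l ->
  let s' := den PCut s in
  [/\ repr s' F, forall c k, crosses s' k c -> exists k', crosses s k' c,
      forall k, ~~ crosses s' k (vars s vCut) & vars s' vN <= (vars s vN).+1].
Proof.
move=> E R Nl s'; set c := vars s vCut.
(* A point lies in one cell only: after one split nothing crosses the cut any more, and [vN] has
   grown by just one. *)
pose I k u := [/\ repr u F, forall c k, crosses u k c -> exists k', crosses s k' c
  & (vars u vN = vars s vN /\ forall k', k' < k -> ~~ crosses u k' c) \/
    (vars u vN = (vars s vN).+1 /\ forall k', ~~ crosses u k' c)].
have : I l s'.
  rewrite -E.2; apply: for_ind => //.
  - move=> k u v [[R1 R2 R3] h1 h2]; split => //.
  - by split=> //; [move=> c' k h; exists k|left].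
  move=> k u kl uk fr [Ru h1 h2]; rewrite den_if [eval _ _]/=.
  have Ec : vars u vCut = c by rewrite fr.1.
  have -> b1 b2 : ((nat_of_bool b1) * (nat_of_bool b2) != 0) = b1 && b2.
    by case: b1; case: b2.
  rewrite !addn1 uk Ec -/(crosses u k c); case: ifP => cr.
    case: h2 => [[e _]|[_ /(_ k)]]; last by rewrite cr.
    have cr' : crosses u (vars u vK) (vars u vCut) by rewrite uk Ec.
    have [R' h3 h4] := split_repr Ru cr'; split => //.
      by move=> c' k' /h3 [k2 /h1].
    right; split; last by rewrite -Ec.
    have [] := @den_split u; last by rewrite e.
    by have [_ _] := rp_in Ru (crosses_incell cr'); rewrite uk.
  split => //; case: h2 => [[e h]|[e h]]; [left|right] => //; split => // k'.
  by rewrite ltnS leq_eqVlt => /predU1P[->|/h]; rewrite ?cr.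
case=> R' h1 h2; split => //.
  (* An index that the loop does not reach is at least [l], hence at least [vN], so its cell is
     empty. *)
  case: h2 => [[e h]|[e h]] // k; case: (ltnP k l) => kl; first exact: h.
  apply/negP => /crosses_incell /(rp_in R')[_ _]; rewrite e; lia.
by case: h2 => [[-> _]|[-> _]].
Qed.

Lemma PCellsP s : env s -> 2 * n + 1 < l ->
  (forall a k, (a == aA) || (a == aB) || (a == aH) || (a == aU) || (a == aM) ->
     arrs s a k = 0) ->
  let s' := den PCells s in
  [/\ repr s' (fun=> Cell 0 0 (vars s vD) 0), vars s' vN <= 2 * n + 1
    & forall j k, j < n -> ~~ crosses s' k (rl j) && ~~ crosses s' k (dl j).+1].
Proof.
move=> E nl2 Z s'; set F := fun=> _.
rewrite /s' /PCells !den_seq !den_put den_assign; set s1 := set_var _ _ _.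
have E1 : env s1 by [].
have R1 : repr s1 F.
  have T0 : arrs s 0 0 = T by case: E => ->.
  have inE' k t : incell s1 k t = (k == 0) && slot_in t.
    rewrite /incell /s1 /= /upd /= T0 /slot_in; case: (k == 0) => /=; first lia.
    by rewrite !Z //; lia.
  split=> [k t|t ts|k k' t].
  - rewrite inE' => /andP[/eqP-> ts]; split => //.
    by rewrite /cellof /s1 /= /upd /= !Z.
  - by exists 0; rewrite inE'.
  by rewrite !inE' => /andP[/eqP-> _] /andP[/eqP-> _].
apply: (@forJ_ind (fun i u => [/\ repr u F, vars u vN <= 2 * i + 1
    & forall j k, j < i -> ~~ crosses u k (rl j) && ~~ crosses u k (dl j).+1])
  vI _ s1 n) => //.
- exact: env_n E1.
- exact: (env_nl nl E1).
- by move=> k u v [[R2 R3 R4] h1 h2]; split.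
move=> i u iN ui fr [R h1 h2]; rewrite !den_seq.
have Eu := env_frame fr E1 isT isT; have [X0 _] := Eu.
set u1 := den (PAssign vCut (rE vI)) u; have Ru1 : repr u1 F by case: R.
have N1 : vars u1 vN < l by rewrite /u1 /= /upd /=; lia.
have [R2 c2 d2 n2] := @PCutP u1 F Eu Ru1 N1; have Eu2 := env_den (P:=PCut) (s:=u1) Eu isT isT.
set u2 := den PCut u1 in R2 c2 d2 n2 Eu2 *.
set u3 := den (PAssign vCut _) u2; have Ru3 : repr u3 F by case: R2.
have n2' : vars u2 vN <= (vars u vN).+1 by [].
have N3 : vars u3 vN < l by rewrite /u3 /= /upd /=; lia.
have [R4 c4 d4 n4] := @PCutP u3 F Eu2 Ru3 N3.
have n4' : vars (den PCut u3) vN <= (vars u2 vN).+1 by [].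
have e1 : vars u1 vCut = rl i by rewrite /u1 /= /upd /= ui X0.
have e3 : vars u3 vCut = (dl i).+1.
  rewrite /u3 den_assign /= /upd /=.
  have -> : vars u2 vI = i by rewrite /u2 den_var.
  by case: Eu2 => -> _; rewrite addn1.
split => //; first lia.
have back c k : crosses (den PCut u3) k c -> exists k', crosses u2 k' c.
  by move=> /c4 [k' h]; exists k'.
have back2 c k : crosses u2 k c -> exists k', crosses u k' c.
  by move=> /c2 [k' h]; exists k'.
move=> j k; rewrite ltnS leq_eqVlt => /predU1P[->|ji]; last first.
  apply/andP; split; apply/negP => /back [k1 /back2 [k2 h]];
    have /andP[h3 h4] := h2 j k2 ji; by rewrite h in h3 h4.
rewrite -e3 (d4 k) andbT; apply/negP => /back [k1]; rewrite -e1.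
by apply/negP.
Qed.

End Repr.

(** * Running one job *)

Definition PEmit4 :=
  PSeq (Emit (Var vBest)) (PSeq (Emit (Var vHost))
  (PSeq (Emit (cellE aA)) (Emit (subE (cellE aB) (Const 1))))).

(** As windows do not cut cells, the left end of a nonempty cell decides whether the whole cell lies
    in the window. *)
Definition availE :=
  mulE (ltE (Const 0) (Var vNeed)) (mulE (leE (rE vBest) (cellE aA))
    (mulE (leE (cellE aA) (dE vBest)) (ltE (cellE aA) (cellE aB)))).

(** A cell with more slots than are lacking is split first. Nothing is lacking afterwards, so this
    happens at most once per job. *)
Definition PTake upd :=
  PSeq (PAssign vCut (addE (cellE aA) (Var vNeed)))
  (PSeq (PIf (ltE (Var vCut) (cellE aB)) PSplit PSkip)
  (PSeq (PAssign vNeed (subE (Var vNeed) (subE (cellE aB) (cellE aA))))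
  (PSeq upd PEmit4))).

Definition PPass cond upd := PFor vK (PIf (mulE cond availE) (PTake upd) PSkip).

Definition enc_pieces (ps : seq (nat * nat * nat * nat)) :=
  flatten [seq (let: (j, i, a, e) := q in [:: j; i; a; e]) | q <- ps].

Lemma enc_pieces_rcons ps j i a e :
  enc_pieces (rcons ps (j, i, a, e)) = enc_pieces ps ++ [:: j; i; a; e].
Proof. by rewrite /enc_pieces map_rcons flatten_rcons. Qed.

Lemma emit4_output s : output (den PEmit4 s) =
  output s ++ [:: vars s vBest; vars s vHost; arrs s aA (vars s vK); arrs s aB (vars s vK) - 1].
Proof.
rewrite /PEmit4 den_seq !output_emit -!cats1 -!catA /=.
by rewrite /upd /=.
Qed.

Lemma inwE r d j t : inw r d j t = (r j <= t <= d j). Proof. by []. Qed.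

Section Pass.

Variables (X : nat -> nat) (l : nat).
Let n := X 1.
Let T := X 0.
Local Notation rl := (rl X).
Local Notation dl := (dl X).
Local Notation pl := (pl X).
Local Notation env := (env X l).
Local Notation slot_in := (slot_in T).
Local Notation repr := (repr X).
Local Notation inw := (inw rl dl).
Local Notation Dv := (Dv X).
Local Notation szv := (szv X).

Hypothesis nl : n <= l.

Definition ctx b s := [/\ env s, vars s vBest = b, vars s vD = Dv & arrs s aSz b = szv b].

Definition cuts s := forall j k, j < n ->
  ~~ crosses s k (rl j) && ~~ crosses s k (dl j).+1.

Lemma update_repr s s' F k q : repr s F ->
  arrs s' aA = arrs s aA -> arrs s' aB = arrs s aB -> vars s' vN = vars s vN ->
  arrs s aA k < arrs s aB k ->
  (forall j, cellof s' j = if j == k then q else cellof s j) ->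
  repr s' (put_seg F (arrs s aA k) (arrs s aB k).-1 q).
Proof.
move=> R hA hB hN ne hC.
have inE' j t : incell s' j t = incell s j t by rewrite /incell hA hB.
have segE t : (arrs s aA k <= t <= (arrs s aB k).-1) = incell s k t.
  by rewrite /incell; lia.
split=> [j t|t ts|j j' t].
- rewrite inE' hN hC /put_seg segE => h; have [h1 h2 h3] := rp_in R h; split => //.
  case: eqP h => [->->//|ne'] h; case: ifP => // h'; case: ne'.
  exact: (rp_dis R h h').
- by have [j h] := rp_cov R ts; exists j; rewrite inE'.
by rewrite !inE'; apply: (rp_dis R).
Qed.

(** What distinguishes the two passes: the test on a cell, the host used, the change of state and
    the invariant [PI]. *)
Variables (cond : expr) (upd : prog) (b : nat).
Variables (cnd : pred cellst) (hst : cellst -> nat) (up : cellst -> cellst).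
Variable PI : (nat -> cellst) -> seq (nat * nat * nat * nat) -> nat -> Prop.

Hypothesis bn : b < n.
Hypothesis condP : forall s, ctx b s -> eval s cond = cnd (cellof s (vars s vK)).
Hypothesis updP : forall s, ctx b s -> let s' := den upd s in
  vars s' vHost = hst (cellof s (vars s vK)) /\
  forall j, cellof s' j =
    if j == vars s vK then up (cellof s (vars s vK)) else cellof s j.
Hypothesis uv : forall x, x != vHost -> ~~ wrv upd x.
Hypothesis ua : forall a, a < 8 -> ~~ wra upd a.
Hypothesis cnd_up : forall q, cnd (up q) = false.
Hypothesis PI_step : forall F ps need q a e,
  PI F ps need -> a <= e -> inw b a -> inw b e -> e.+1 - a <= need -> cnd q ->
  (forall t, a <= t <= e -> F t = q) ->
  PI (put_seg F a e (up q)) (rcons ps (b, hst q, a, e)) (need - (e.+1 - a)).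

Lemma wrv_upd x : x != vHost -> wrv upd x = false.
Proof. by move=> /uv /negPf. Qed.

Lemma wra_upd a : a < 8 -> wra upd a = false.
Proof. by move=> /ua /negPf. Qed.

(** The summand [0 < vars u vNeed] reserves a place for the one split that the job may still
    cause. *)
Definition pass_inv pre N0 u F ps :=
  [/\ [/\ ctx b u, repr u F & cuts u], PI F ps (vars u vNeed),
      output u = pre ++ enc_pieces ps & vars u vN + (0 < vars u vNeed) <= N0].

Lemma PTakeP u pre N0 F ps : let k := vars u vK in
  pass_inv pre N0 u F ps -> cnd (cellof u k) -> 0 < vars u vNeed ->
  rl b <= arrs u aA k <= dl b -> arrs u aA k < arrs u aB k ->
  let u' := den (PTake upd) u in
  exists F' ps', [/\ pass_inv pre N0 u' F' ps',
    0 < vars u' vNeed -> ~~ cnd (cellof u' k) &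
    0 < vars u' vNeed -> forall j t, j != k -> incell u' j t ->
      incell u j t /\ cellof u' j = cellof u j].
Proof.
move=> k [[C R Cu] P O N] cq n0 Aw AB u'; rewrite /u' /PTake 4!den_seq.
set q := cellof u k in cq; set A := arrs u aA k in Aw AB.
set need := vars u vNeed in P N n0.
set u1 := den (PAssign vCut _) u.
have k1 : vars u1 vK = k by [].
have c1 : vars u1 vCut = A + need by [].
have R1 : repr u1 F by case: R.
have Cu1 : cuts u1 by [].
have kin : incell u k A by rewrite /incell leqnn AB.
have kN : k < vars u vN by have [] := rp_in R kin.
set u2 := den (PIf _ PSplit PSkip) u1.
(* [B2] is the right end of the part taken: [A + need] after a split, the old right end
   otherwise. *)
have [B2 [h1 h2 h3 h4]] : exists B2, [/\ [/\ repr u2 F, cuts u2 & ctx b u2],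
   [/\ vars u2 vK = k, vars u2 vNeed = need, arrs u2 aA k = A, arrs u2 aB k = B2 & cellof u2 k = q],
   [/\ A < B2, B2 - A <= need, output u2 = output u & vars u2 vN <= (vars u vN) + (B2 - A == need)] &
   B2 - A < need -> u2 = u1].
  have ec : eval u1 (Var vCut) = A + need by [].
  have eB : eval u1 (cellE aB) = arrs u aB k by [].
  have cB : arrs u1 aB k = arrs u aB k by [].
  rewrite /u2 den_if eval_ltE ec eB.
  case: ltnP => cB'; last first.
    exists (arrs u aB k); split => //; split => //.
      by move: cB'; lia.
    by rewrite leq_addr.
  rewrite [_ != 0]/=.
  have cr : crosses u1 (vars u1 vK) (vars u1 vCut).
    rewrite /crosses k1 c1; change (A < A + need < arrs u aB k); lia.
  have [R2 b2 _] := split_repr nl R1 cr.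
  have lt1 : vars u1 vK < vars u1 vN := kN.
  have [hA hB hC hN] := den_split lt1.
  exists (A + need); set v := den PSplit u1 in R2 b2 hA hB hC hN *.
  have kN' : (k == vars u1 vN) = false by rewrite ltn_eqF.
  have vE x : x != vN -> vars v x = vars u1 x by move=> h; rewrite /v den_var //= orbF.
  have aE a : a < 6 -> arrs v a = arrs u1 a.
    by move=> h; rewrite /v den_arr //=; move: a h; do 6!case=> //.
  have Ov : output v = output u by rewrite /output (vE 1) // (aE 1).
  clearbody v; split=> //.
  - split => //.
      move=> j k' jn; apply/andP; split; apply/negP => /b2 [k2 h];
      have /andP[g3 g4] := Cu j k2 jn; [apply: (negP g3)|apply: (negP g4)]; exact: h.
    case: C => [[e1 e2] C1 C2 C3]; split; rewrite ?vE ?aE //.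
    by split; rewrite ?vE ?aE.
  - split; rewrite ?vE //; first by rewrite hA kN'.
      by rewrite hB k1 eqxx.
    by rewrite hC kN'.
  - split => //; [lia|lia|].
    by rewrite hN addKn eqxx addn1.
  by rewrite addKn ltnn.
clearbody u2; case: h1 => R2 Cu2 C2; case: h2 => k2 n2 A2 B2e q2; case: h3 => AB2 len O2 N2.
set u3 := den (PAssign vNeed _) u2.
have n3 : vars u3 vNeed = need - (B2 - A).
  by rewrite /u3 /= /Defs.upd /= k2 n2 A2 B2e.
have k3 : vars u3 vK = k by rewrite -k2.
have C3 : ctx b u3 by case: C2.
have q3 : cellof u3 k = q by rewrite -q2.
have A3 : arrs u3 aA k = A by rewrite -A2.
have B3 : arrs u3 aB k = B2 by rewrite -B2e.
have N3 : vars u3 vN = vars u2 vN by [].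
have O3 : output u3 = output u by rewrite -O2.
have R3 : repr u3 F by case: R2.
have Cu3 : cuts u3 by [].
have I3 j : (incell u3 j = incell u2 j) * (cellof u3 j = cellof u2 j) by [].
clearbody u3.
have [hh hc] := updP C3; set u4 := den upd u3 in hh hc *.
have v4 x : x != vHost -> vars u4 x = vars u3 x by move=> h; rewrite /u4 den_var ?uv.
have a4 a : a < 8 -> arrs u4 a = arrs u3 a by move=> h; rewrite /u4 den_arr ?ua.
have AB3 : arrs u3 aA k < arrs u3 aB k by rewrite A3 B3.
have hc' j : cellof u4 j = if j == k then up q else cellof u3 j by rewrite hc k3 q3.
have R4 := update_repr R3 (a4 aA isT) (a4 aB isT) (v4 vN isT) AB3 hc'.
rewrite A3 B3 in R4.
have I4 j t : incell u4 j t = incell u3 j t by rewrite /incell !a4.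
have X4 j t : crosses u4 j t = crosses u3 j t by rewrite /crosses !a4.
have C4 : ctx b u4.
  case: C3 => [[e1 e2] e3 e4 e5]; split; rewrite ?v4 ?a4 //.
  by split; rewrite ?v4 ?a4.
have O4 : output u4 = output u by rewrite -O3 /output v4 // a4.
have k4 : vars u4 vK = k by rewrite v4.
have hh' : vars u4 vHost = hst q by rewrite hh k3 q3.
have n4 : vars u4 vNeed = need - (B2 - A) by rewrite v4.
have b4 : vars u4 vBest = b by case: C4.
have A4 : arrs u4 aA k = A by rewrite a4.
have B4 : arrs u4 aB k = B2 by rewrite a4.
have N4 : vars u4 vN = vars u2 vN by rewrite v4.
clearbody u4.
have O5 := emit4_output u4; rewrite O4 b4 hh' k4 A4 B4 O in O5.
set u5 := den PEmit4 u4 in O5 *.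
have v5 x : x != 1 -> vars u5 x = vars u4 x by move=> h; rewrite /u5 den_var //= !(negPf h).
have a5 a : a != 1 -> arrs u5 a = arrs u4 a by move=> h; rewrite /u5 den_arr //= !(negPf h).
have c5 j : cellof u5 j = cellof u4 j by rewrite /cellof !a5.
have I5 j t : incell u5 j t = incell u4 j t by rewrite /incell !a5.
have X5 j t : crosses u5 j t = crosses u4 j t by rewrite /crosses !a5.
clearbody u5.
have R5 : repr u5 (put_seg F A B2.-1 (up q)).
  case: R4 => r1 r2 r3; split => [j t|t /r2 [j h]|j j' t]; rewrite ?I5 ?c5 ?v5 //.
  - exact: r1.
  - by exists j; rewrite I5.
  exact: r3.
have C5 : ctx b u5.
  case: C4 => [[e1 e2] e3 e4 e5]; split; rewrite ?v5 ?a5 //.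
  by split; rewrite ?v5 ?a5.
have n5 : vars u5 vNeed = need - (B2 - A) by rewrite v5.
have N5 : vars u5 vN = vars u2 vN by rewrite v5.
exists (put_seg F A B2.-1 (up q)), (rcons ps (b, hst q, A, B2.-1)).
have eB : B2.-1.+1 = B2 by lia.
split.
- split.
  + split => //; move=> j k' jn; rewrite !X5 !X4; exact: Cu3.
  + rewrite n5; have -> : need - (B2 - A) = need - (B2.-1.+1 - A) by rewrite eB.
    apply: PI_step => //.
    * by lia.
    * rewrite inwE; have /andP[_ nc] := Cu2 b k bn.
      by move: nc; rewrite /crosses A2 B2e; lia.
    * by rewrite eB.
    move=> t te; have tin : incell u2 k t by rewrite /incell A2 B2e; lia.
    by have [_ -> _] := rp_in R2 tin.
  + by rewrite O5 enc_pieces_rcons subn1 catA.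
  rewrite N5 n5; apply: leq_trans N; rewrite n0; move: N2 len; case: eqP => [->|/eqP ne].
    by rewrite subnn; lia.
  move=> N2 len; have -> : 0 < need - (B2 - A) by lia. lia.
- by rewrite n5 c5 hc' eqxx cnd_up.
rewrite n5 => n5'; have e2 := h4 (_ : B2 - A < need).
move=> j t jk; rewrite I5 I4 c5 hc' (negPf jk) !I3 e2 //; by lia.
Qed.

Lemma PPassP s F ps pre N0 :
  pass_inv pre N0 s F ps -> N0 <= l ->
  let s' := den (PPass cond upd) s in
  exists F' ps', pass_inv pre N0 s' F' ps' /\
    (0 < vars s' vNeed -> forall t, slot_in t -> inw b t -> ~~ cnd (F' t)).
Proof.
move=> S0 Nl s'.
pose I k u := exists F' ps', pass_inv pre N0 u F' ps' /\
  (0 < vars u vNeed -> forall k' t, k' < k -> incell u k' t -> inw b t ->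
    ~~ cnd (cellof u k')).
have C0 : ctx b s by case: S0 => -[].
have El : vars s 0 = l by case: C0 => -[].
have : I l s'.
  rewrite -El; apply: for_ind => //.
  - by rewrite /= wrv_upd.
  - by rewrite /= wrv_upd.
  - move=> k u v [F' [ps' [[[h1 [R1 R2 R3] h3] h4 h5 h6] h7]]]; exists F', ps'.
    by split.
  - by exists F, ps; split.
  move=> k u kl uk fr [F' [ps' [S H]]]; rewrite den_if.
  have [[Cu Ru Ku] Pu Ou Nu] := S.
  have -> : (eval u (mulE cond availE) != 0) =
    [&& cnd (cellof u k), 0 < vars u vNeed, rl b <= arrs u aA k, arrs u aA k <= dl b
      & arrs u aA k < arrs u aB k].
    have [[X0 _] b0 _ _] := Cu.
    have -> : eval u (mulE cond availE) = eval u cond * eval u availE by [].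
    rewrite condP // /availE /= b0 X0 uk !addn1.
    have B5 (b1 b2 b3 b4 b5 : bool) : (b1 * (b2 * (b3 * (b4 * b5))) != 0) = [&& b1, b2, b3, b4 & b5].
      by case: b1; case: b2; case: b3; case: b4; case: b5.
    by rewrite B5.
  case: ifP => [/and5P[cq n0 A1 A2 AB]|ncond].
    rewrite -uk in cq A1 A2 AB.
    have [|F2 [ps2 [S2 H1 H2]]] := PTakeP S cq n0 _ AB; first by rewrite A1.
    exists F2, ps2; split => // n2 j t; rewrite ltnS leq_eqVlt => /predU1P[-> _ _|jk jt wt].
      by rewrite -uk; apply: H1.
    have jk' : j != vars u vK by rewrite uk ltn_eqF.
    by have [h1 ->] := H2 n2 j t jk' jt; apply: H h1 wt.
  exists F', ps'; split => // n0 j t; rewrite ltnS leq_eqVlt => /predU1P[->|]; last exact: H.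
  move=> kt wt; apply/negP => cq; move/negP: ncond; apply.
  (* No cell crosses the release time, so a cell that meets the window has its left end in it; the
     test can then only have failed because of [cnd]. *)
  have /andP[c1 _] := Ku b k bn.
  move: kt wt c1; rewrite cq n0 /incell /crosses inwE /=; lia.
case=> F' [ps' [S H]]; exists F', ps'; split => // n0 t ts wt.
have [[_ R _] _ _ N] := S; have [k kt] := rp_cov R ts; have [_ -> kN] := rp_in R kt.
by apply: H kt wt => //; lia.
Qed.

End Pass.

(** * The scheduling phase *)

Definition markE :=
  subE (Const 1) (mulE (leE (cellE aM) (addE (Var vBest) (Const 1)))
                       (leE (addE (Var vBest) (Const 1)) (cellE aM))).
Definition narrowE := leE (mulE (Const 2) (szE vBest)) (Var vD).
Definition cond1E := mulE narrowE (mulE (ltE (mulE (Const 2) (cellE aG)) (Var vD)) markE).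
Definition cond2E m := mulE (ltE (cellE aH) (Const m)) markE.
Definition PMark := PPut aM (Var vK) (addE (Var vBest) (Const 1)).
Definition PGray :=
  PSeq (PAssign vHost (cellE aU))
  (PSeq (PPut aG (Var vK) (addE (cellE aG) (szE vBest))) PMark).
Definition PFresh :=
  PSeq (PAssign vHost (cellE aH))
  (PSeq (PPut aH (Var vK) (addE (cellE aH) (Const 1)))
  (PSeq (PIf narrowE (PSeq (PPut aU (Var vK) (Var vHost))
           (PPut aG (Var vK) (szE vBest))) PSkip) PMark)).
Definition PPlace m :=
  PIf (Get aSel (Var vBest))
    (PSeq (PAssign vNeed (pE vBest))
    (PSeq (PPass cond1E PGray) (PPass (cond2E m) PFresh))) PSkip.
Definition orderE := ltE (wlE vI) (wlE vBest).
Definition PSched m := POrdered aDone2 vStep vI vBest orderE (PPlace m).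
Definition PMain m := PSeq (PInit m) (PSeq PSel (PSeq PCells (PSched m))).

Lemma wf_PMain m : wf (PMain m). Proof. by []. Qed.

Lemma mark_eval x y : 1 - (x <= y) * (y <= x) = (x != y).
Proof. by case: ltngtP. Qed.

Section Sched.

Variables (X : nat -> nat) (l m : nat).
Let n := X 1.
Let T := X 0.
Local Notation rl := (rl X).
Local Notation dl := (dl X).
Local Notation pl := (pl X).
Local Notation env := (env X l).
Local Notation slot_in := (slot_in T).
Local Notation repr := (repr X).
Local Notation inw := (inw rl dl).
Local Notation D := (Dv X).
Local Notation sz := (szv X).

Hypothesis nl3 : 3 * n + 1 <= l.

Lemma nl_of : n <= l. Proof. lia. Qed.

Lemma cond1P b s : ctx X l b s ->
  eval s cond1E = cond1 D sz b (cellof s (vars s vK)).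
Proof.
case=> _ b0 d0 s0; rewrite /= b0 d0 s0 !addn1 mark_eval /cond1 /narrow /gray /=.
by case: (_ <= _); case: (_ < _); case: (_ != _).
Qed.

Lemma cond2P b s : ctx X l b s ->
  eval s (cond2E m) = cond2 m b (cellof s (vars s vK)).
Proof.
case=> _ b0 d0 s0; rewrite /= b0 !addn1 mark_eval /cond2 /=.
by case: (_ < _); case: (_ != _).
Qed.

Lemma PGrayP b s : ctx X l b s -> let s' := den PGray s in
  vars s' vHost = cu (cellof s (vars s vK)) /\
  forall j, cellof s' j =
    if j == vars s vK then put_gray sz b (cellof s (vars s vK)) else cellof s j.
Proof.
case=> _ b0 d0 s0; split=> // j; rewrite /cellof /= /upd /= b0 s0 addn1 /put_gray /=.
by case: eqP => // ->.
Qed.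

Lemma PFreshP b s : ctx X l b s -> let s' := den PFresh s in
  vars s' vHost = ch (cellof s (vars s vK)) /\
  forall j, cellof s' j =
    if j == vars s vK then put_fresh D sz b (cellof s (vars s vK)) else cellof s j.
Proof.
case=> _ b0 d0 s0; rewrite /PFresh /cellof /= /upd /= b0 s0 d0 !addn1 /put_fresh /=.
case: (2 * sz b <= D) => /=; rewrite /upd /= ?b0 ?addn1; split=> // j;
  by case: (j =P vars s vK) => [e|_]; rewrite ?e.
Qed.

Hypothesis rdT : forall j, j < n -> [/\ 0 < rl j, rl j <= dl j & dl j <= T].
Hypothesis lam : forall j k, j < n -> k < n ->
  [|| subw rl dl j k, subw rl dl k j, dl j < rl k | dl k < rl j].
Hypothesis szD : forall j, j < n -> 0 < sz j <= D.
Variables (ln ld : nat).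
Hypothesis plam : forall j, j < n -> pl j * ld <= ln * wlj X j.
Hypotheses (lnd : ln <= ld) (ld0 : 0 < ld) (m0 : 0 < m).

(** Marks are never cleared; old ones are harmless because each job has its own. *)
Definition marks (proc : seq nat) (F : nat -> cellst) :=
  forall t b, slot_in t -> b \notin proc -> cm (F t) != b.+1.

Lemma marks_seg proc b F a e q : cm q = b.+1 -> b \in proc -> marks proc F ->
  marks proc (put_seg F a e q).
Proof.
move=> cq bp M t b' ts nb; rewrite /put_seg; case: ifP => _; last exact: M.
by rewrite cq eqSS; apply: contraNneq nb => <-.
Qed.

Lemma marks_sub (p1 p2 : seq nat) F : {subset p1 <= p2} -> marks p1 F -> marks p2 F.
Proof. by move=> s M t b ts nb; apply: M => //; apply: contra nb => /s. Qed.

Variable (G : seq nat).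
Hypotheses (uG : uniq G) (Gn : {in G, forall j, j < n}).
Hypothesis cap : forall b, b \in G ->
  2 * ld * area rl dl (av X) G b <= wlj X b * ((ld - ln) * (m * D)).

Local Notation placed := (placed n T m D rl dl pl sz).
Local Notation placing := (placing n T m D rl dl pl sz).
Local Notation few_gray := (few_gray T ln ld rl dl).

Lemma PPlaceP proc b s F ps pre N0 :
  b \in G -> b \notin proc -> {subset proc <= G} ->
  {in proc, forall j, wlj X j <= wlj X b} ->
  ctx X l b s -> arrs s aSel b = 1 ->
  repr s F -> cuts X s -> placed proc F ps ->
  few_gray proc (fun t => gray D (F t)) -> marks proc F ->
  output s = pre ++ enc_pieces ps -> vars s vN < N0 -> N0 <= l ->
  let s' := den (PPlace m) s in
  exists F' ps', [/\ [/\ repr s' F', cuts X s' & placed (rcons proc b) F' ps'],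
    few_gray (rcons proc b) (fun t => gray D (F' t)), marks (rcons proc b) F',
    output s' = pre ++ enc_pieces ps' & vars s' vN <= N0].
Proof.
move=> bG nbp sG wlp C sel R Cu P FG M O N Nl s'; have bn := Gn bG.
have [E b0 _ _] := C.
have -> : s' = den (PPass (cond2E m) PFresh)
    (den (PPass cond1E PGray) (den (PAssign vNeed (pE vBest)) s)).
  by rewrite /s' /PPlace den_if [eval _ _]/= b0 sel [_ != 0]/= 2!den_seq.
clear s'; set s1 := den (PAssign vNeed _) s.
have n1 : vars s1 vNeed = pl b by rewrite /s1 /= /upd /= b0; case: E => ->.
pose gr0 t := gray D (F t).
have [P1 G1] := pass1_start nbp P (fun t ts => M t b ts nbp).
have Ms : marks (b :: proc) F by apply: marks_sub M => j; rewrite inE orbC => ->.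
have bb : b \in b :: proc by rewrite inE eqxx.
pose PI1 F ps need := [/\ placing proc b F ps need, gray_pass1 T D b gr0 F ps
  & marks (b :: proc) F].
have step1 F' ps' need q a e : PI1 F' ps' need -> a <= e -> inw b a -> inw b e ->
    e.+1 - a <= need -> cond1 D sz b q -> (forall t, a <= t <= e -> F' t = q) ->
    PI1 (put_seg F' a e (put_gray sz b q)) (rcons ps' (b, cu q, a, e)) (need - (e.+1 - a)).
  move=> [h1 h2 h3] ae wa we le cq Fq.
  have [h4 h5] := pass1_step rdT bn nbp h1 h2 ae wa we le cq Fq.
  by split => //; apply: marks_seg.
have S1 : pass_inv X l b PI1 pre N0 s1 F ps.
  split => //.
  - by split => //; [case: R => r1 r2 r3; split].
  - by rewrite n1; split.
  - by move: N; rewrite n1 /s1 /= /upd /=; lia.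
have uv1 x : x != vHost -> ~~ wrv PGray x by move=> h; rewrite /= !orbF.
have ua1 a : a < 8 -> ~~ wra PGray a by move: a; do 8!case=> //.
have c1 q : cond1 D sz b (put_gray sz b q) = false by rewrite /cond1 /= eqxx !andbF.
have [F1 [ps1 [S2 H1]]] := PPassP nl_of bn (@cond1P b) (@PGrayP b) uv1 ua1 c1 step1 S1 Nl.
set s2 := den (PPass cond1E PGray) s1 in S2 H1 *; clearbody s2.
have [[C2 R2 Cu2] [P2 G2 M2] O2 N2] := S2.
have GG := pass1_end G2 (pg_mark P2) H1.
pose PI2 F ps need := [/\ placing proc b F ps need,
  gray_pass2 T D rl dl sz b gr0 F ps need & marks (b :: proc) F].
have step2 F' ps' need q a e : PI2 F' ps' need -> a <= e -> inw b a -> inw b e ->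
    e.+1 - a <= need -> cond2 m b q -> (forall t, a <= t <= e -> F' t = q) ->
    PI2 (put_seg F' a e (put_fresh D sz b q)) (rcons ps' (b, ch q, a, e)) (need - (e.+1 - a)).
  move=> [h1 h2 h3] ae wa we le cq Fq.
  have [h4 h5] := pass2_step rdT szD bn nbp h1 h2 ae wa we le cq Fq.
  have cm' : cm (put_fresh D sz b q) = b.+1 by rewrite /put_fresh; case: (2 * sz b <= D).
  apply: (And3 h4 h5); exact: (@marks_seg _ b F' a e _ cm' bb h3).
have S3 : pass_inv X l b PI2 pre N0 s2 F1 ps1 by split.
have uv2 x : x != vHost -> ~~ wrv PFresh x by move=> h; rewrite /= !orbF.
have ua2 a : a < 8 -> ~~ wra PFresh a by move: a; do 8!case=> //.
have c2 q : cond2 m b (put_fresh D sz b q) = false.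
  by rewrite /cond2 /put_fresh; case: (2 * sz b <= D) => /=; rewrite eqxx andbF.
have [F2 [ps2 [S4 H2]]] := PPassP nl_of bn (@cond2P b) (@PFreshP b) uv2 ua2 c2 step2 S3 Nl.
set s3 := den (PPass (cond2E m) PFresh) s2 in S4 H2 *; clearbody s3.
have [[C4 R4 Cu4] [P4 G4 M4] O4 N4] := S4.
have hp : {in proc, forall j, j < n /\ wl rl dl j <= wl rl dl b}.
  by move=> j jp; split; [apply/Gn/sG|apply: wlp].
have sbG : {subset b :: proc <= G} by move=> j; rewrite inE => /predU1P[->|/sG].
have z : vars s3 vNeed = 0.
  apply: (enough_slots rdT lam szD plam bn m0 hp nbp uG Gn sbG P4 FG G4 _ lnd ld0 H2).
  apply: leq_trans (cap bG) _; rewrite -/(wlj X b).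
  have -> : (ld - ln) * m * wl rl dl b * D = wlj X b * ((ld - ln) * (m * D)); last by [].
  by change (wl rl dl b) with (wlj X b); ring.
have FG' := few_gray_step rdT lam plam bn hp P4 FG G4.
rewrite z in P4 N4.
exists F2, ps2; split => //.
- by split => //; apply: placing_end.
- by apply: marks_sub M4 => j; rewrite mem_rcons.
by move: N4; rewrite addn0.
Qed.

Lemma placed_nil : placed [::] (fun=> Cell 0 0 D 0) [::].
Proof.
split => // t ts; split => //=.
- by move=> i; rewrite /load big_pred0.
- by rewrite /gray /=; case: ltnP => //; lia.
by rewrite /gray /=; lia.
Qed.

(** Negated, since [POrdered] proceeds by decreasing keys and short windows come first. *)
Definition wkey j : rat := (- (wlj X j)%:R)%R.

Lemma PSchedP s pre : env s -> vars s vD = D ->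
  (forall j, j < n -> arrs s aSz j = sz j) ->
  (forall j, j < n -> arrs s aSel j = (j \in G)) ->
  (forall j, j < n -> arrs s aDone2 j = 0) ->
  repr s (fun=> Cell 0 0 D 0) -> cuts X s -> vars s vN <= 2 * n + 1 ->
  output s = pre ->
  exists proc F ps, [/\ proc =i G, placed proc F ps &
    output (den (PSched m) s) = pre ++ enc_pieces ps].
Proof.
move=> E d0 Z S dn R Cu N O.
(* Each job adds at most one cell to the initial 2n + 1, so all indices stay within the range of the
   loops. *)
pose I sg u := let proc := [seq j <- sg | j \in G] in
  exists F ps, [/\ [/\ repr u F, cuts X u & placed proc F ps],
    few_gray proc (fun t => gray D (F t)), marks proc F,
    output u = pre ++ enc_pieces ps & vars u vN <= 2 * n + 1 + size sg].
have nl := nl_of.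
have keyP u : frame (PSched m) s u -> vars u vI < n -> vars u vBest < n ->
    (eval u orderE != 0) = (wkey (vars u vBest) < wkey (vars u vI))%R.
  move=> fr _ _; have [X0 _] := env_frame fr E isT isT.
  rewrite /orderE eval_ltE [eval _ _]/= [eval _ _]/= X0 /wkey ltrN2 ltr_nat.
  by rewrite eqb0 negbK.
have [||||sg [h1 _ [F [ps [h2 _ _ h3 _]]]]] := @ordered_ind n wkey aDone2 vStep vI vBest orderE
    (PPlace m) s isT isT isT isT isT isT isT isT isT isT isT (env_n E) (env_nl nl E)
    keyP I dn.
- by move=> sg u x v /orP[/orP[]|] /eqP-> [F [ps [[[r1 r2 r3] h2 h3] h4 h5 h6 h7]]];
    exists F, ps; split => //; split.
- move=> sg u j v [F [ps [[[r1 r2 r3] h2 h3] h4 h5 h6 h7]]].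
  by exists F, ps; split => //; split.
- exists (fun=> Cell 0 0 D 0), [::]; split => //.
  + by split => //; exact: placed_nil.
  + by apply: few_gray_nil => t ts; rewrite /gray /=; lia.
  + by rewrite O cats0.
  by rewrite addn0.
- move=> sg u fr bn us sn nb kb [F [ps [[h1 h2 h3] h4 h5 h6 h7]]].
  set b := vars u vBest in bn nb kb *.
  have Eu := env_frame fr E isT isT.
  have selb : arrs u aSel b = (b \in G) by rewrite fr.2 //= S.
  rewrite /I filter_rcons size_rcons; case bG: (b \in G) selb => selb; last first.
    have -> : den (PPlace m) u = u.
      by rewrite /PPlace den_if [eval _ _]/= -/b selb [_ != 0]/= den_skip.
    by exists F, ps; split => //; lia.
  have C : ctx X l b u.
    by split => //; [rewrite fr.1|rewrite fr.2 //= Z].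
  have sN : size sg < n.
    have := uniq_leq_size (s1 := b :: sg) (s2 := iota 0 n).
    rewrite /= nb us size_iota; apply => // j; rewrite inE mem_iota add0n.
    by case/predU1P => [->//|/sn].
  have Nu : vars u vN < 2 * n + 1 + (size sg).+1 by lia.
  have Nl : 2 * n + 1 + (size sg).+1 <= l by lia.
  have [|||F' [ps' H]] := @PPlaceP [seq j <- sg | j \in G] b u F ps pre _
     bG _ _ _ C selb h1 h2 h3 h4 h5 h6 Nu Nl.
  + by rewrite mem_filter (negPf nb) andbF.
  + by move=> j; rewrite mem_filter => /andP[].
  + move=> j; rewrite mem_filter => /andP[_ /kb].
    by rewrite /wkey lerN2 ler_nat.
  by exists F', ps'.
exists [seq j <- sg | j \in G], F, ps; split => //; last by case: h2.
move=> j; rewrite mem_filter (perm_mem h1) mem_iota add0n /=.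
by case jG: (j \in G) => //=; rewrite Gn.
Qed.

End Sched.

(** * Instances and their encodings *)

Lemma nth_flatten_const (T : Type) (x0 : T) (N : nat) (ss : seq (seq T)) i c :
  all (fun s => size s == N) ss -> c < N -> i < size ss ->
  nth x0 (flatten ss) (N * i + c) = nth x0 (nth [::] ss i) c.
Proof.
elim: ss i => [|s ss IH] [|i] //= /andP[/eqP sN h] cN ile.
  by rewrite muln0 add0n nth_cat sN cN.
rewrite nth_cat sN mulnS -addnA ltnNge leq_addr /= addKn; exact: IH.
Qed.

Lemma sum_iota1 T (f : nat -> nat) :
  \sum_(t <- iota 1 T) f t = \sum_(t < T) f t.+1.
Proof.
rewrite -[1]/(1 + 0) iotaDl big_map.
by rewrite -[in RHS](big_mkord predT (fun t => f t.+1)) /index_iota subn0.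
Qed.

Lemma sum_iota0 n (P : pred nat) (f : nat -> nat) :
  \sum_(j <- iota 0 n | P j) f j = \sum_(j < n | P j) f j.
Proof. by rewrite -[in RHS](big_mkord P f) /index_iota subn0. Qed.

Section Instance.

Variables (I : instance).
Hypotheses (V : valid_instance I) (L : laminar I).

Let x := encode_instance I.
Let n := size (jobs I).
Let T := horizon I.
Definition input := nth 0 x.
Local Notation X := input.
Local Notation sz := (szv X).
Local Notation D := (Dv X).

Lemma size_jobs_flatten : size (flatten (map encode_job (jobs I))) = 7 * n.
Proof. by rewrite /n; elim: (jobs I) => //= j s IH; rewrite IH mulnS. Qed.

Lemma size_encode : size x = 2 + 7 * n.
Proof. by rewrite /x /encode_instance size_cat size_jobs_flatten. Qed.

Lemma input1 : X 1 = n. Proof. by []. Qed.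
Lemma input0 : X 0 = T. Proof. by []. Qed.

Lemma input_job (j : jobidx I) c : c < 7 ->
  X (c.+2 + 7 * j) = nth 0 (encode_job (jobof j)) c.
Proof.
move=> c7; have -> : X (c.+2 + 7 * j) = nth 0 (flatten (map encode_job (jobs I))) (7 * j + c).
  by rewrite addnC !addnS.
rewrite nth_flatten_const ?size_map //; last by elim: (jobs I).
rewrite (nth_map (jobof j)) //; congr (nth 0 (encode_job _) c).
exact: esym (tnth_nth (jobof j) (in_tuple (jobs I)) j).
Qed.

Lemma relE (j : jobidx I) : rl X j = release (jobof j).
Proof. exact: (input_job j (isT : 0 < 7)). Qed.
Lemma deadE (j : jobidx I) : dl X j = deadline (jobof j).
Proof. exact: (input_job j (isT : 1 < 7)). Qed.
Lemma plenE (j : jobidx I) : pl X j = plen (jobof j).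
Proof. exact: (input_job j (isT : 2 < 7)). Qed.
Lemma snE' (j : jobidx I) : sn X j = `|numq (req (jobof j))|%N.
Proof. exact: (input_job j (isT : 3 < 7)). Qed.
Lemma sdE' (j : jobidx I) : sd X j = `|denq (req (jobof j))|%N.
Proof. exact: (input_job j (isT : 4 < 7)). Qed.
Lemma wnE' (j : jobidx I) : wn X j = `|numq (weight (jobof j))|%N.
Proof. exact: (input_job j (isT : 5 < 7)). Qed.
Lemma wdE' (j : jobidx I) : wd X j = `|denq (weight (jobof j))|%N.
Proof. exact: (input_job j (isT : 6 < 7)). Qed.

Lemma wljE (j : jobidx I) : wlj X j = wlen j.
Proof. by rewrite /wlj relE deadE. Qed.

Lemma ratE (q : rat) : (0 <= q)%R -> q = (`|numq q|%N%:R / `|denq q|%N%:R)%R.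
Proof.
move=> q0; rewrite -{1}(divq_num_den q) !natr_absz !ger0_norm ?numq_ge0 //.
Qed.

Lemma sd_gt0 (j : jobidx I) : 0 < sd X j.
Proof. by rewrite sdE' absz_gt0 denq_eq0. Qed.

Lemma D_gt0 : 0 < D.
Proof.
rewrite /Dv big_mkord; apply: prodn_gt0 => i; exact: (sd_gt0 i).
Qed.

Lemma sd_dvd (j : jobidx I) : sd X j %| D.
Proof. by rewrite /Dv big_mkord (bigD1 j) //= dvdn_mulr. Qed.

Lemma szE' (j : jobidx I) : ((sz j)%:R = D%:R * req (jobof j) :> rat)%R.
Proof.
have [_ _ /andP[r0 _] _] := V j.
rewrite [in RHS](ratE (ltW r0)) -snE' -sdE' /szv natrM.
rewrite -{2}(divnK (sd_dvd j)) natrM.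
have := sd_gt0 j; rewrite -(ltr_nat rat) => h.
by field; rewrite gt_eqF.
Qed.

Lemma sz_bounds (j : jobidx I) : 0 < sz j <= D.
Proof.
have [_ _ /andP[r0 r1] _] := V j; have := szE' j; have := D_gt0.
rewrite -(ltr_nat rat) -(ltr_nat rat 0 (sz j)) -(ler_nat rat (sz j)) => d0 ->.
by rewrite mulr_gt0 // ger_pMr.
Qed.

(** Area times density is the weight up to the unit [D], which occurs on both sides of the final
    inequality and cancels. *)
Lemma weightE (j : jobidx I) :
  ((av X j)%:R * key X j = D%:R * weight (jobof j) :> rat)%R.
Proof.
have [_ p0 /andP[r0 _] w0] := V j.
rewrite [in RHS](ratE w0) -wnE' -wdE' /av /key natrM /szv.
rewrite -{2}(divnK (sd_dvd j)) !natrM.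
have := sd_gt0 j; rewrite -(ltr_nat rat) => h1.
have : 0 < wd X j by rewrite wdE' absz_gt0 denq_eq0.
rewrite -(ltr_nat rat) => h2.
have : 0 < sn X j by rewrite snE' absz_gt0 numq_eq0 gt_eqF.
rewrite -(ltr_nat rat) => h3.
have : 0 < pl X j by rewrite plenE.
rewrite -(ltr_nat rat) => h4.
by field; rewrite !gt_eqF.
Qed.

Lemma ordP (P : nat -> Prop) : (forall j : jobidx I, P j) -> forall j, j < n -> P j.
Proof. by move=> h j jn; exact: (h (Ordinal jn)). Qed.

Lemma pos_input j : j < X 1 -> [/\ 0 < pl X j, 0 < sn X j, 0 < sd X j & 0 < wd X j].
Proof.
move: j; apply: (ordP (P := fun j => [/\ 0 < pl X j, 0 < sn X j, 0 < sd X j & 0 < wd X j])).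
move=> j; have [_ p0 /andP[r0 _] w0] := V j; split.
- by rewrite plenE.
- by rewrite snE' absz_gt0 numq_eq0 gt_eqF.
- exact: sd_gt0.
by rewrite wdE' absz_gt0 denq_eq0.
Qed.

Lemma rdT_input j : j < X 1 -> [/\ 0 < rl X j, rl X j <= dl X j & dl X j <= X 0].
Proof.
move: j; apply: (ordP (P := fun j => [/\ 0 < rl X j, rl X j <= dl X j & dl X j <= X 0])).
by move=> j; rewrite relE deadE; have [] := V j.
Qed.

Lemma szD_input j : j < X 1 -> 0 < sz j <= D.
Proof. move: j; exact: (ordP (P := fun j => 0 < sz j <= D) sz_bounds). Qed.

Lemma window_inw (j : jobidx I) (t : slotidx I) :
  (t \in window j) = inw (rl X) (dl X) j t.+1.
Proof. by rewrite inE /inw relE deadE. Qed.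

(** Windows are nonempty and within the horizon, so their end points are slots and inclusion of sets
    gives inclusion of intervals. If the intervals were neither nested nor apart, the later release
    time would lie in both. *)
Lemma lam_input j k : j < X 1 -> k < X 1 ->
  [|| subw (rl X) (dl X) j k, subw (rl X) (dl X) k j, dl X j < rl X k | dl X k < rl X j].
Proof.
move=> jn kn; pose oj : jobidx I := Ordinal jn; pose ok : jobidx I := Ordinal kn.
have TE : T = X 0 by [].
have [r1 r2 r3] := rdT_input jn; have [q1 q2 q3] := rdT_input kn.
have sub_w (a b : jobidx I) : window a \subset window b -> subw (rl X) (dl X) a b.
  have [a1 a2 a3] := rdT_input (ltn_ord a).
  move/subsetP => h; have h1 : (rl X a).-1 < T by lia.
  have h2 : (dl X a).-1 < T by lia.
  have := h (Ordinal h1); have := h (Ordinal h2); rewrite !window_inw /inw /subw /=.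
  by rewrite !prednK; lia.
have := L oj ok => /or3P[/sub_w ->|/sub_w ->|dis]; rewrite ?orbT //.
apply/negPn/negP => no.
pose t := maxn (rl X j) (rl X k).
have tT : t.-1 < T by rewrite /t; lia.
have t1 : Ordinal tT \in window oj.
  rewrite window_inw /inw /= prednK; last by rewrite /t; lia.
  by move: no; rewrite /subw /t; lia.
have t2 : Ordinal tT \in window ok.
  rewrite window_inw /inw /= prednK; last by rewrite /t; lia.
  by move: no; rewrite /subw /t; lia.
by move: dis; rewrite disjoint_subset => /subsetP /(_ _ t1); rewrite inE t2.
Qed.

Section Feasible.

Variables (m : nat) (O : {set jobidx I}).
Hypothesis Of : feasible m O.

Definition memO (j : nat) := j \in [seq val o | o <- enum O].

Lemma memOE (j : jobidx I) : memO j = (j \in O).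
Proof. by rewrite /memO mem_map ?mem_enum //; apply: val_inj. Qed.

(** Double counting: a job inside the window spends at least p_j of its slots there, and each slot
    offers at most [m] units of resource. *)
Lemma feasible_area k : k < X 1 ->
  \sum_(j <- iota 0 (X 1) | memO j && subw (rl X) (dl X) j k) av X j
    <= m * wlj X k * D.
Proof.
move=> kn; rewrite sum_iota0; have [sch [h1 h2 h3 h4 h5]] := Of.
pose w (t : slotidx I) := inw (rl X) (dl X) k t.+1.
pose f (j : jobidx I) := \sum_(t | w t) \sum_(i < m) (j \in sch i t) * sz j.
apply: (@leq_trans (\sum_(j : jobidx I) f j)).
  rewrite big_mkcond; apply: leq_sum => j _ /=.
  rewrite memOE; case: ifP => // /andP[jO jk].
  rewrite /av plenE; apply: (@leq_trans (#|[set t in window j | [exists i, j \in sch i t]]| * sz j)).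
    by rewrite leq_mul2r h5 ?orbT.
  rewrite -sum1_card big_distrl /= /f big_mkcond [leqRHS]big_mkcond /=.
  apply: leq_sum => t _; rewrite inE window_inw /w.
  case: ifP => // /andP[tj /existsP[i ji]]; rewrite ifT.
    by rewrite (bigD1 i) //= ji mul1n leq_addr.
  case/andP: tj => a1 a2; case/andP: jk => b1 b2; apply/andP; split.
    exact: leq_trans b1 a1.
  exact: leq_trans a2 b2.
rewrite /f exchange_big /=; apply: (@leq_trans (\sum_(t | w t) m * D)).
  apply: leq_sum => t _; rewrite exchange_big /=.
  apply: (@leq_trans (\sum_(i < m) D)); last by rewrite sum_nat_const card_ord.
  apply: leq_sum => i _.
  have -> : \sum_(j : jobidx I) (j \in sch i t) * sz j = \sum_(j in sch i t) sz j.
    by rewrite [RHS]big_mkcond; apply: eq_bigr => j _; case: (_ \in _); rewrite ?mul1n.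
  rewrite -(ler_nat rat) natr_sum.
  under eq_bigr => j _ do rewrite szE'.
  by rewrite -mulr_sumr ler_piMr // h3.
rewrite sum_nat_const; have -> : #|w| = wlj X k.
  rewrite -sum1_card big_mkcond /=.
  have [r1 r2 r3] := rdT_input kn.
  have := @sum_interval (X 0) (rl X k) (dl X k) r1 _ r3.
  have -> : wlj X k = (dl X k).+1 - rl X k by rewrite /wlj; lia.
  rewrite sum_iota1 => <-; last by lia.
  by apply: eq_bigr => t _; rewrite unfold_in /w /inw; case: (_ && _).
by rewrite mulnA [wlj X k * m]mulnC.
Qed.

End Feasible.

End Instance.

(** * Correctness *)

Lemma lift_ords n (G : seq nat) : {in G, forall j, j < n} ->
  exists sel : seq 'I_n, map val sel = G.
Proof.
elim: G => [|j G IH] h; first by exists [::].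
have [|sel e] := IH; first by move=> k kG; apply: h; rewrite inE kG orbT.
have jn : j < n by apply: h; rewrite inE eqxx.
by exists (Ordinal jn :: sel); rewrite /= e.
Qed.

Definition plain_piece m I (q : piece m I) : nat * nat * nat * nat :=
  let: (j, i, a, e) := q in (nat_of_ord j, nat_of_ord i, a, e).

Lemma lift_pieces m I (ps : seq (nat * nat * nat * nat)) :
  {in ps, forall q, let: (j, i, _, _) := q in (j < size (jobs I)) && (i < m)} ->
  exists qs : seq (piece m I), map (@plain_piece m I) qs = ps.
Proof.
elim: ps => [|[[[j i] a] e] ps IH] h; first by exists [::].
have [|qs eq] := IH; first by move=> q qp; apply: h; rewrite inE qp orbT.
have /andP[jn im] := h (j, i, a, e) (mem_head _ _).
by exists ((Ordinal jn, Ordinal im, a, e) :: qs); rewrite /= eq.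
Qed.

Lemma schedule_of_runs m I (qs : seq (piece m I)) i t j :
  (j \in schedule_of qs i t) = runs (map (@plain_piece m I) qs) j i t.+1.
Proof. by rewrite inE /runs has_map; apply: eq_has => -[[[j' i'] a] e]. Qed.

Lemma encode_pieces m I (qs : seq (piece m I)) :
  flatten (map (@encode_piece m I) qs) = enc_pieces (map (@plain_piece m I) qs).
Proof.
by rewrite /enc_pieces -map_comp; congr flatten; apply: eq_map => -[[[j i] a] e].
Qed.

Section Correct.

Variables (m : nat) (I : instance).
Hypotheses (m0 : 0 < m) (V : valid_instance I) (L : laminar I).
Hypothesis short : forall j : jobidx I, plen (jobof j) <= wlen j.

Let n := size (jobs I).
Let x := encode_instance I.
Local Notation X := (input I).
Local Notation sz := (szv X).
Local Notation D := (Dv X).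

Lemma placed_schedules (sel : seq (jobidx I)) (qs : seq (piece m I)) proc F :
  proc =i map val sel ->
  placed n (X 0) m D (rl X) (dl X) (pl X) sz proc F (map (@plain_piece m I) qs) ->
  schedules [set j in sel] (schedule_of qs).
Proof.
move=> pE P; set ps := map _ _ in P.
have act (j : jobidx I) i t : j \in schedule_of qs i t -> active ps j t.+1.
  by rewrite schedule_of_runs => /runs_active.
have tin (t : slotidx I) : slot_in (X 0) t.+1 by rewrite /slot_in input0 ltn_ord.
split.
- move=> i t; apply/subsetP => j /act aj; have := placed_proc P aj.
  by rewrite pE mem_map ?inE //; apply: val_inj.
- move=> i t j; rewrite schedule_of_runs => rj.
  by rewrite window_inw; apply: (so_win (pl_ok P (tin t)) rj).
- move=> i t; have D0 := D_gt0 I; have h := so_le (pl_ok P (tin t)) i.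
  move: h; rewrite /load sum_iota0 -(ler_nat rat) natr_sum.
  rewrite (eq_bigl (fun j => j \in schedule_of qs i t)); last by move=> j; rewrite schedule_of_runs.
  under eq_bigr => j _ do rewrite (szE' V).
  by rewrite -mulr_sumr ger_pMr ?ltr0n.
- move=> i i' t j; rewrite !schedule_of_runs => r1 r2.
  exact: val_inj (so_one (pl_ok P (tin t)) r1 r2).
move=> j; rewrite inE => js.
have jp : val j \in proc by rewrite pE map_f.
rewrite -plenE -(pl_cnt P jp) /cnt sum_iota1 -sum1_card big_mkcond [leqRHS]big_mkcond /=.
apply: leq_sum => t _; case aj: (active ps j t.+1) => //.
have [i ri] := active_runs aj.
have im : i < m by apply: leq_trans (so_host (pl_ok P (tin t)) ri) (so_hm (pl_ok P (tin t))).
rewrite ifT // inE window_inw (so_win (pl_ok P (tin t)) ri) /=.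
by apply/existsP; exists (Ordinal im); rewrite schedule_of_runs.
Qed.

(** With lam = [ln / ld], the quotient of the two coefficients is 1/2 - lam (1/2 + 1/m). Subtraction
    is truncated, so where this value would be negative the bound holds with coefficient 0. *)
Lemma algorithm_correct : exists (ln ld : nat) sel (qs : seq (piece m I)),
  [/\ ln = 0 \/ exists j : jobidx I, ln = plen (jobof j) /\ ld = wlen j,
      0 < ld,
      output (den (PMain m) (init_state x)) = encode_solution sel qs,
      schedules [set j in sel] (schedule_of qs) &
      ((m * ld - m * ln - 2 * ln)%:R * opt m I
         <= (2 * m * ld)%:R * profit [set j in sel] :> rat)%R].
Proof.
pose l := size x; have El : l = 2 + 7 * n by rewrite /l size_encode.
have nl : X 1 <= l by rewrite input1 El -/n; lia.
have nl3 : 3 * X 1 + 1 <= l by rewrite input1 El -/n; lia.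
set s0 := init_state x; have E0 : env X l s0 by [].
have wl0 j : j < X 1 -> 0 < wlj X j by rewrite /wlj addn1.
have [d1 z1 C1 jn1 J1] := PInitP m nl E0 (erefl : vars s0 vJm = 0) wl0.
rewrite /PMain 3!den_seq; set s1 := den (PInit m) s0 in d1 z1 C1 jn1 J1 *.
set jm := vars s1 vJm in C1 jn1 J1.
have E1 : env X l s1 := env_den (P := PInit m) E0 isT isT.
have zero a i : (2 < a) -> arrs s1 a i = 0.
  move=> a2; rewrite /s1 den_arr; first by case: a a2.
  by move: a a2; do 3!case=> //.
have o1 : arrs s1 1 0 = 0 by rewrite /s1 den_arr.
clearbody s1.
pose ln := pl X jm; pose ld := wlj X jm.
have ld0 : 0 < ld by rewrite /ld /wlj addn1.
have lnd : ln <= ld /\ (ln = 0 \/ exists j : jobidx I, ln = plen (jobof j) /\ ld = wlen j).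
  case: (posnP (X 1)) => [n0|/jn1 jn].
    (* Without jobs, the field read for [jm] lies beyond the input and defaults to 0. *)
    have -> : ln = 0; last by split => //; left.
    have n00 : n = 0 by rewrite -n0.
    by rewrite /ln /pl /input nth_default // -/x -/l El n00.
  pose j : jobidx I := Ordinal jn.
  have h1 : ln = plen (jobof j) by rewrite /ln -[jm]/(val j) plenE.
  have h2 : ld = wlen j by rewrite /ld -[jm]/(val j) wljE.
  by split; [rewrite h1 h2|right; exists j].
case: lnd => lnd jj.
pose c1 := 2 * ld; pose cap k := wlj X k * vars s1 vC.
have [sg] := PSelP nl (@pos_input I V) (c1 := c1) (cap := cap) E1
  (fun j _ => zero aDone j isT) (fun j _ => zero aSel j isT) z1 o1 erefl erefl.
set s2 := den PSel s1; set G := greedy _ _ _ _ _ _ sg => -[h1 h2 h3 h4].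
have E2 : env X l s2 := env_den (P := PSel) E1 isT isT.
have d2 : vars s2 vD = D by rewrite /s2 den_var.
have z2 j : j < X 1 -> arrs s2 aSz j = sz j by move=> jn; rewrite /s2 den_arr // z1.
have zero2 a i : 4 < a -> arrs s2 a i = 0.
  move=> a4; rewrite /s2 den_arr; first by rewrite zero //; lia.
  by move: a a4; do 5!case=> //.
clearbody s2.
have nl2 : 2 * X 1 + 1 < l by rewrite input1 El -/n; lia.
have zc a k : (a == aA) || (a == aB) || (a == aH) || (a == aU) || (a == aM) -> arrs s2 a k = 0.
  by do ?[case/orP]; move/eqP->; apply: zero2.
have [R3 N3 X3] := PCellsP nl E2 nl2 zc.
set s3 := den PCells s2 in R3 N3 X3 *.
have E3 : env X l s3 := env_den (P := PCells) E2 isT isT.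
have d3 : vars s3 vD = D by rewrite /s3 den_var.
have z3 j : j < X 1 -> arrs s3 aSz j = sz j by move=> jn; rewrite /s3 den_arr // z2.
have S3 j : j < X 1 -> arrs s3 aSel j = (j \in G) by move=> jn; rewrite /s3 den_arr // h4.
have Z3 j : j < X 1 -> arrs s3 aDone2 j = 0 by move=> _; rewrite /s3 den_arr // zero2.
have o3 : output s3 = size G :: G by rewrite -h3 /output /s3 den_var // den_arr.
rewrite d2 in R3; clearbody s3.
have us : uniq sg by rewrite (perm_uniq h1) iota_uniq.
have Gsub : subseq G sg := greedy_subseq _ _ _ _ _ _ _.
have uG : uniq G := subseq_uniq Gsub us.
have Gn : {in G, forall j, j < X 1}.
  by move=> j /(mem_subseq Gsub); rewrite (perm_mem h1) mem_iota add0n => /andP[].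
have capG b : b \in G -> 2 * ld * area (rl X) (dl X) (av X) G b
    <= wlj X b * ((ld - ln) * (m * D)).
  move=> /Gn bn; have := greedy_within (X 1) (rl X) (dl X) (av X) c1 cap sg.
  rewrite -/G => /allP /(_ b); rewrite mem_iota add0n bn => /(_ isT).
  by rewrite /cap C1.
have [proc [F [ps [pG P4 o4]]]] := PSchedP nl3 (@rdT_input I V) (@lam_input I V L)
  (@szD_input I V) J1 lnd ld0 m0 uG Gn capG E3 d3 z3 S3 Z3 R3 X3 N3 o3.
have [sel es] := @lift_ords n G Gn.
have [qs eq] : exists qs : seq (piece m I), map (@plain_piece m I) qs = ps.
  apply: lift_pieces => -[[[j i] a] e] qp; have /andP[jp ->] := pl_all P4 qp.
  by rewrite andbT; apply: Gn; rewrite -pG.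
exists ln, ld, sel, qs; split => //.
- rewrite o4 /encode_solution encode_pieces eq /=.
  by rewrite -(size_map val) es -es.
- by apply: (@placed_schedules _ _ proc F); [rewrite es|rewrite eq].
have q12 : m * ld - m * ln - 2 * ln <= 2 * m * ld by nia.
have selE : (\sum_(j <- G) (av X j)%:R * key X j = D%:R * profit [set j in sel] :> rat)%R.
  rewrite -es big_map /profit mulr_sumr.
  rewrite big_uniq /=; last by rewrite -(map_inj_uniq val_inj) es.
  by apply: eq_big => [j|j _]; [rewrite inE|rewrite (weightE V)].
have D0 : (0 < D%:R :> rat)%R by rewrite ltr0n D_gt0.
have prof0 : (0 <= profit [set j in sel])%R.
  by apply: sumr_ge0 => j _; have [] := V j.
have key0 j : j < X 1 -> (0 <= key X j)%R by rewrite /key divr_ge0 ?ler0n.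
rewrite /opt; apply: (big_ind (fun y => ((m * ld - m * ln - 2 * ln)%:R * y
         <= (2 * m * ld)%:R * profit [set j in sel] :> rat)%R)).
- by rewrite mulr0 mulr_ge0 ?ler0n.
- by move=> y z hy hz; rewrite maxEle; case: ifP.
move=> O /boolp.asboolP Of.
(* The rejected job has p_b <= lam |chi_b| <= lam |chi_k| and requirement at most 1. Its area is
   thus at most lam |chi_k|, a fraction lam / m of the capacity: this is the origin of the term
   1/m. *)
have sat k b A : k < X 1 -> b < X 1 -> subw (rl X) (dl X) b k ->
    cap k < c1 * (A + av X b) -> (m * ld - m * ln - 2 * ln) *
    (\sum_(j <- iota 0 (X 1) | memO O j && subw (rl X) (dl X) j k) av X j)
      <= 2 * m * ld * A.
  move=> kn bn bk; rewrite /cap C1 /c1 -/ln -/ld => h.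
  have hO := feasible_area V Of kn.
  have hb := J1 _ bn; rewrite -/ln -/ld in hb.
  have hw : wlj X b <= wlj X k.
    by move: bk; have [? ? ?] := rdT_input V bn; rewrite /subw /wlj; lia.
  have ha : ld * av X b <= ln * wlj X k * D.
    have /andP[_ sD] := szD_input V bn; rewrite /av mulnA.
    apply: leq_mul => //; rewrite mulnC; apply: leq_trans hb _.
    by rewrite leq_mul2l hw orbT.
  set q1 := _ - _; apply: leq_trans (_ : q1 * (m * wlj X k * D) <= _).
    by rewrite leq_mul2l hO orbT.
  have -> : q1 * (m * wlj X k * D) = m * (q1 * (wlj X k * D)) by ring.
  have -> : 2 * m * ld * A = m * (2 * ld * A) by ring.
  rewrite leq_mul2l; apply/orP; right; rewrite /q1 !mulnBl.
  move: h; rewrite mulnDr.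
  have -> : wlj X k * ((ld - ln) * (m * D)) = m * ld * (wlj X k * D) - m * ln * (wlj X k * D).
    by rewrite mulnA [wlj X k * _]mulnC mulnBl mulnBl; congr (_ - _); ring.
  have -> : 2 * ln * (wlj X k * D) = 2 * (ln * wlj X k * D) by ring.
  have -> : 2 * ld * av X b = 2 * (ld * av X b) by ring.
  by move: ha; lia.
have rd j : j < X 1 -> rl X j <= dl X j by case/(rdT_input V).
have := greedy_profit rd (@lam_input I V L) q12 sat h1 h2 key0.
rewrite -/G selE.
have -> : (\sum_(j <- iota 0 (X 1) | memO O j) (av X j)%:R * key X j = D%:R * profit O :> rat)%R.
  rewrite -[X 1]subn0 -/(index_iota 0 _) big_mkord /profit mulr_sumr.
  by apply: eq_big => [j|j _]; [rewrite memOE|rewrite (weightE V)].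
by rewrite ![(_ * (D%:R * _))%R]mulrCA ler_pM2l.
Qed.

End Correct.

(** * The guarantee for a real bound on the ratios *)

Local Open Scope ring_scope.

Theorem theorem2 (R : realType) (m : nat) (lambda : R) :
  (1 <= m)%N -> 0 < lambda -> lambda < 1 - 2 / (m%:R + 2) ->
  exists (A : cmd) (p : {poly nat}),
    forall I : instance,
      valid_instance I -> laminar I ->
      (forall j : jobidx I, (plen (jobof j))%:R <= lambda * (wlen j)%:R) ->
      exists (sel : seq (jobidx I)) (ps : seq (piece m I)) (time : nat),
        [/\ computes A (encode_instance I) (encode_solution sel ps) time,
            (time <= p.[bitsize (encode_instance I)])%N,
            schedules [set j in sel] (schedule_of ps)
          & (1 / 2 - lambda * (1 / 2 + 1 / m%:R)) * ratr (opt m I)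
              <= ratr (profit [set j in sel])].
Proof.
move=> m0 l0 l1; have [p hp] := computes_comp (wf_PMain m).
(* The program cannot read the real number [lambda]; it computes the largest ratio p_j / |chi_j| of
   the instance instead. This is at most [lambda], and the guarantee decreases as the ratio
   grows. *)
exists (comp (PMain m)), p => I V L lam.
have lt1 : lambda < 1.
  by apply: lt_trans l1 _; rewrite ltrBlDr ltrDl divr_gt0 // ltr_wpDl ?ler0n.
have short (j : jobidx I) : (plen (jobof j) <= wlen j)%N.
  rewrite -(ler_nat R); apply: le_trans (lam j) _.
  by rewrite ger_pMl ?ltW // ltr0n /wlen addn1.
have [ln [ld [sel [qs [hl ld0 out sch prof]]]]] := algorithm_correct m0 V L short.
have [t [hc ht]] := hp (encode_instance I).
exists sel, qs, t; split => //; first by rewrite -out.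
have ldR : 0 < ld%:R :> R by rewrite ltr0n.
have mR : 0 < m%:R :> R by rewrite ltr0n.
have lnR : ln%:R <= lambda * ld%:R :> R.
  by case: hl => [->|[j [-> ->]]] //; rewrite mulr_ge0 // ltW.
have opt0 : 0 <= opt m I.
  rewrite /opt; apply: (big_ind (fun y : rat => 0 <= y)) => //.
    by move=> y z hy hz; rewrite maxEle; case: ifP.
  by move=> O _; apply: sumr_ge0 => j _; have [] := V j.
have optR : 0 <= ratr (opt m I) :> R by rewrite ler0q.
have profR : (m * ld - m * ln - 2 * ln)%:R * ratr (opt m I)
    <= (2 * m * ld)%:R * ratr (profit [set j in sel]) :> R.
  by move: prof; rewrite -(ler_rat R) !rmorphM /= !ratr_nat.
have q2 : 0 < (2 * m * ld)%:R :> R by rewrite ltr0n !muln_gt0 m0 ld0.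
rewrite -(ler_pM2l q2); apply: le_trans profR; rewrite mulrA.
apply: ler_wpM2r => //.
(* Truncation can only raise the coefficient, namely to 0 where the difference is negative. *)
apply: (@le_trans _ _ (m%:R * ld%:R - m%:R * ln%:R - 2 * ln%:R)); last first.
  rewrite -!natrM; case: (leqP (m * ln + 2 * ln) (m * ld)) => h.
    by rewrite -subnDA natrB // natrD opprD addrA.
  apply: (@le_trans _ _ 0); last exact: ler0n.
  by rewrite -addrA -opprD subr_le0 -natrD ler_nat ltnW.
have -> : (2 * m * ld)%:R * (1 / 2 - lambda * (1 / 2 + 1 / m%:R)) =
    m%:R * ld%:R - (m%:R + 2) * (lambda * ld%:R) :> R.
  by rewrite !natrM; field; rewrite gt_eqF.
have : (m%:R + 2) * ln%:R <= (m%:R + 2) * (lambda * ld%:R) :> R.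
  by rewrite ler_wpM2l // addr_ge0 ?ler0n.
lra.
Qed.
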